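(* Let $\Lambda\subset\mathbb{N}$ and let $p_1,\ldots,p_k$ be rationally independent integer polynomials with $p_i(0)=0$ for $i=1,\ldots,k$. Then for every $\varepsilon>0$, the set $$\left\{n\in\mathbb{N}\colon \bar d\bigl(\Lambda\cap(\Lambda+p_1(n))\cap\cdots\cap(\Lambda+p_k(n))\bigr)\geq\bar d(\Lambda)^{k+1}-\varepsilon\right\}$$ is syndetic.
   Context: $\mathbb{N}=\{1,2,\ldots\}$. For $\Lambda\subset\mathbb{N}$ the upper density is $\bar d(\Lambda)=\limsup_{N\to\infty}|\Lambda\cap[1,N]|/N$, and $\Lambda+m=\{x+m:x\in\Lambda\}$ for $m\in\mathbb{Z}$. An integer polynomial is a polynomial taking integer values on the integers. A family $p_1,\ldots,p_k$ of integer polynomials is rationally independent if every nontrivial integer combination of them is not constant. A set $\Lambda\subset\mathbb{N}$ is syndetic if there exists $M\in\mathbb{N}$ such that every interval (in $\mathbb{N}$) of length greater than $M$ intersects $\Lambda$ nontrivially. *)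

(* Defs.v *)
From HB Require Import structures.
From mathcomp Require Import all_boot all_order all_algebra finmap.
From mathcomp Require Import all_classical all_reals all_analysis.

Set Implicit Arguments.
Unset Strict Implicit.
Unset Printing Implicit Defensive.

Import Order.TTheory GRing.Theory Num.Theory.

Local Open Scope classical_set_scope.
Local Open Scope ring_scope.

(* N = {1, 2, ...}.  Subsets of N are sets of integers contained in [posints],
   so that translation by an arbitrary integer is the literal one. *)
Definition posints : set int := [set n | 0 < n].

Definition translate (A : set int) (m : int) : set int :=
  [set x + m | x in A].

Definition counting_fun (A : set int) (N : nat) : nat :=
  #|` fset_set (A `&` [set` `[1%:Z, N%:Z]]) |.

(* The sequence takes values in [0, 1] (its 0-th term is 0 / 0 = 0), so the
   real-valued limsup is the usual one. *)
Definition upper_density (R : realType) (A : set int) : R :=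
  limn_sup (fun N : nat => (counting_fun A N)%:R / N%:R).

Definition integer_poly (R : realType) (p : {poly R}) : Prop :=
  forall m : int, p.[m%:~R] \is a Num.int.

(* For an integer polynomial the floor changes nothing, see [int_hornerE]. *)
Definition int_horner (R : realType) (p : {poly R}) (n : int) : int :=
  Num.floor p.[n%:~R].

Definition rationally_independent (R : realType) (k : nat)
    (p : 'I_k -> {poly R}) : Prop :=
  forall c : 'I_k -> int, (exists i, c i != 0) ->
  forall a : R, \sum_(i < k) (c i)%:~R *: p i <> a%:P.

Definition syndetic (S : set int) : Prop :=
  exists2 M : int, posints M &
    forall a b : int, posints a -> M < b - a ->
      S `&` [set` `[a, b]] !=set0.

Lemma int_hornerE (R : realType) (p : {poly R}) (n : int) :
  integer_poly p -> (int_horner p n)%:~R = p.[n%:~R].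
Proof. by move=> ip; apply/floorK/ip. Qed.

(* [fset_set] sends infinite sets to the empty one; this does not occur in
   [counting_fun]. *)
Lemma finite_counting_set (A : set int) (N : nat) :
  finite_set (A `&` [set` `[1%:Z, N%:Z]]).
Proof.
apply: (@sub_finite_set _ _ (Posz @` `I_N.+1)); last first.
  exact/finite_image/finite_II.
move=> x [_] /=; rewrite in_itv /= => /andP[x1 xN].
by case: x x1 xN => // n _ nN; exists n.
Qed.

(* Main.v *)
From HB Require Import structures.
Require Import Defs.
From mathcomp Require Import all_boot all_order all_algebra complex ring lra zify.
From mathcomp Require Import cyclic separable cyclotomic finmap.
From mathcomp Require Import mathcomp_extra boolp classical_sets functions cardinality set_interval.
From mathcomp Require Import reals topology normedtype sequences.
Set Implicit Arguments.
Unset Strict Implicit.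
Unset Printing Implicit Defensive.
Import Order.TTheory GRing.Theory Num.Theory.
Import numFieldNormedType.Exports.
Local Open Scope classical_set_scope.
Local Open Scope ring_scope.

(** Suppose that the set of good [n] is not syndetic. It has arbitrarily long gaps,
and averaging over longer and longer gaps gives a translation invariant mean [M] on
the integers that only sees bad [n]. On the other hand, choose intervals [[1, N_j]]
along which the density of the given set tends to its upper density; the ultralimit
of the averages over these intervals is a probability space with a measure
preserving transformation, on which the set becomes a function [f] with integral
its upper density (Furstenberg's correspondence). The integral of
[f * prod_i T^(- p_i n) f] is at most the upper density of the intersection that
belongs to [n]. So it is enough to bound from below, for every invariant mean [M],
the mean over [n] of these integrals, with [n] restricted to multiples of some [V]:
this is [khintchine].

The reason for the bound is that for rationally independent polynomials such means
depend only on the projections of the functions to the functions of finite period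
([rational_factor]). Once this is known, [f] may be replaced by its projection
[rho] to the functions of a period [W]; for [n] in the multiples of some [V] all the
[p_i n] are divisible by [W], and the mean is the integral of [f * rho ^ k], which
is that of [rho ^ k.+1] and at least the power [k.+1] of that of [f].

The proof of [rational_factor] avoids the structure theory of characteristic
factors. Induction on polynomial families by van der Corput's inequality ([pet])
bounds the mean by a uniformity seminorm [N s] of any weak limit of the dual
functions. The degree of this seminorm is then lowered step by step, down to the
seminorm [N 1] ([lower1]): a large seminorm of order [r + 1] means that the
differences of order [r] of the weak limit correlate with eigenfunctions
([eig_pick]); moving the differences to the functions of the mean ([interchange])
one obtains means with one more eigenfunction and one function less that is
arbitrary, for which the result is known by induction on the number of arbitrary
functions; the Cauchy--Schwarz--Gowers inequality ([gcs]) then bounds a seminorm of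
order [r]. So an arbitrary function in a slot can be exchanged for an eigenfunction
([swap]), and finally all of them ([ctrl_all]). For eigenfunctions the claim is
Weyl's equidistribution theorem ([weyl], [eigen_av]).

What remains is that a function with large [N 1] correlates with an eigenfunction.
As the transformation is not ergodic, the eigenvalue is an invariant function. It
is built by hand ([csys_eigen]): the finite intervals are cut into blocks of slowly
growing length, and Fourier analysis on a cyclic group gives a frequency for each
block ([correlate], [blocks]).

All the bounds are uniform in the functions and in the mean [M]; this is what allows
the results for different families, weights and progressions to be combined. *)

(** * Means *)

Lemma eqW (d : Order.disp_t) (T : porderType d) (x y : T) : x = y -> (x <= y)%O.
Proof. by move=> ->. Qed.

Section Means.
Variable R : realType.

Definition bdd (Y : Type) (f : Y -> R) := exists K : R, forall y, `|f y| <= K.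

(** A mean is a finitely additive probability. It is only specified on bounded
functions, the single identity [meanP] being additivity and homogeneity at once. *)
Structure mean (Y : Type) := Mean {
  mean_fun :> (Y -> R) -> R;
  meanP : forall f g c, bdd f -> bdd g ->
    mean_fun (fun y => f y + c * g y) = mean_fun f + c * mean_fun g;
  mean_ge0 : forall f, bdd f -> (forall y, 0 <= f y) -> 0 <= mean_fun f;
  mean1 : mean_fun (fun=> 1) = 1 }.

Section Bdd.
Variable Y : Type.
Implicit Types f g : Y -> R.

Lemma bdd_cst c : bdd (fun _ : Y => c).
Proof. by exists `|c|. Qed.

Lemma bddD f g : bdd f -> bdd g -> bdd (fun y => f y + g y).
Proof.
move=> [K Hf] [L Hg]; exists (K + L) => y.
by apply: le_trans (ler_normD _ _) _; apply: lerD.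
Qed.

Lemma bddM f g : bdd f -> bdd g -> bdd (fun y => f y * g y).
Proof.
move=> [K Hf] [L Hg]; exists (K * L) => y.
by rewrite normrM ler_pM.
Qed.

Lemma bddN f : bdd f -> bdd (fun y => - f y).
Proof. by move=> [K Hf]; exists K => y; rewrite normrN. Qed.

Lemma bddB f g : bdd f -> bdd g -> bdd (fun y => f y - g y).
Proof. by move=> Hf Hg; apply: bddD => //; apply: bddN. Qed.

Lemma bddX f n : bdd f -> bdd (fun y => f y ^+ n).
Proof. by move=> [K Hf]; exists (K ^+ n) => y; rewrite normrX lerXn2r ?nnegrE ?(le_trans _ (Hf y)). Qed.

Lemma bdd_sum (I : Type) (r : seq I) (P : pred I) (F : I -> Y -> R) :
  (forall i, bdd (F i)) -> bdd (fun y => \sum_(i <- r | P i) F i y).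
Proof.
move=> HF; elim: r => [|i r IH]; first by exists 0 => y; rewrite big_nil normr0.
have [Pi|nPi] := boolP (P i); last first.
  by apply: eq_rect _ _ IH _ _; apply/funext => y; rewrite big_cons (negbTE nPi).
apply: (eq_rect _ (@bdd Y)); first exact: (bddD (HF i) IH).
by apply/funext => y; rewrite big_cons Pi.
Qed.

End Bdd.
Hint Resolve bdd_cst bddD bddM bddN bddB bddX : core.

Lemma bdd_comp (Y Z : Type) (f : Y -> R) (g : Z -> Y) :
  bdd f -> bdd (fun z => f (g z)).
Proof. by move=> [K HK]; exists K. Qed.

Section MeanTheory.
Variables (Y : Type) (M : mean Y).
Implicit Types f g : Y -> R.

Lemma meanD f g : bdd f -> bdd g -> M (fun y => f y + g y) = M f + M g.
Proof.
move=> Hf Hg; rewrite -[M g]mul1r -meanP //; congr (M _).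
by apply/funext => y; rewrite mul1r.
Qed.

Lemma meanZ c f : bdd f -> M (fun y => c * f y) = c * M f.
Proof.
move=> Hf.
have m0 : M (fun=> 0) = 0.
  have := @meanP _ M (fun=> 0) (fun=> 0) 1 (bdd_cst _ _) (bdd_cst _ _).
  have -> : (fun _ : Y => 0 + 1 * 0) = (fun=> 0 : R) by apply/funext => y; rewrite mul1r addr0.
  by rewrite mul1r => /eqP; rewrite -subr_eq0 opprD addrA subrr sub0r oppr_eq0 => /eqP.
rewrite -[RHS]add0r -m0 -meanP //; congr (M _).
by apply/funext => y; rewrite add0r.
Qed.

Lemma mean_cst c : M (fun=> c) = c.
Proof.
rewrite -[RHS]mulr1 -[X in _ * X](mean1 M) -meanZ //.
by congr (M _); apply/funext => y; rewrite mulr1.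
Qed.

Lemma meanN f : bdd f -> M (fun y => - f y) = - M f.
Proof.
move=> Hf; rewrite -mulN1r -meanZ //; congr (M _).
by apply/funext => y; rewrite mulN1r.
Qed.

Lemma meanB f g : bdd f -> bdd g -> M (fun y => f y - g y) = M f - M g.
Proof. by move=> Hf Hg; rewrite meanD ?meanN //; auto. Qed.

Lemma mean_le f g : bdd f -> bdd g -> (forall y, f y <= g y) -> M f <= M g.
Proof.
move=> Hf Hg fg; rewrite -subr_ge0 -meanB //; apply: mean_ge0; first exact: bddB.
by move=> y; rewrite subr_ge0.
Qed.

Lemma mean_le_cst f c : bdd f -> (forall y, f y <= c) -> M f <= c.
Proof. by move=> Hf fc; rewrite -[leRHS]mean_cst; apply: mean_le. Qed.

Lemma mean_ge_cst f c : bdd f -> (forall y, c <= f y) -> c <= M f.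
Proof. by move=> Hf fc; rewrite -[leLHS]mean_cst; apply: mean_le. Qed.

Lemma mean_norm f K : (forall y, `|f y| <= K) -> `|M f| <= K.
Proof.
move=> fK; have bf : bdd f by exists K.
have {}fK y : - K <= f y <= K by rewrite -ler_norml.
by rewrite ler_norml mean_ge_cst ?mean_le_cst // => y; have /andP[] := fK y.
Qed.

Lemma mean_sum (I : Type) (r : seq I) (P : pred I) (F : I -> Y -> R) :
  (forall i, bdd (F i)) ->
  M (fun y => \sum_(i <- r | P i) F i y) = \sum_(i <- r | P i) M (F i).
Proof.
move=> HF; elim: r => [|i r IH].
  rewrite big_nil -[RHS](mean_cst 0); congr (M _); apply/funext => y.
  by rewrite big_nil.
rewrite big_cons; have [Pi|nPi] := boolP (P i).
  rewrite -IH -meanD //; last exact: bdd_sum.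
  by congr (M _); apply/funext => y; rewrite big_cons Pi.
rewrite -IH; congr (M _); apply/funext => y; by rewrite big_cons (negbTE nPi).
Qed.

Lemma mean_sqr f : bdd f -> M f ^+ 2 <= M (fun y => f y ^+ 2).
Proof.
move=> Hf; have : 0 <= M (fun y => (f y - M f) ^+ 2).
  by apply: mean_ge0 => [|y]; [auto | exact: sqr_ge0].
have -> : (fun y => (f y - M f) ^+ 2) =
          (fun y => (f y ^+ 2 + (- (2 * M f)) * f y) + M f ^+ 2).
  by apply/funext => y; ring.
rewrite meanD ?meanD ?meanZ ?mean_cst //; try by auto.
by move=> h; rewrite -subr_ge0; apply: le_trans h _; apply/eqW; ring.
Qed.

Lemma mean_expn2 f r : bdd f -> M f ^+ (2 ^ r) <= M (fun y => f y ^+ (2 ^ r)).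
Proof.
move=> Hf; elim: r => [|r IH].
  by rewrite expr1; apply/eqW; congr (M _); apply/funext => y; rewrite expr1.
rewrite expnSr exprM.
have [r0|r0] := eqVneq r 0%N.
  rewrite r0 !expn0 expr1; apply: le_trans (mean_sqr Hf) _.
  by apply/eqW; congr (M _); apply/funext => y; rewrite mul1n.
apply: le_trans (_ : M (fun y => f y ^+ (2 ^ r)) ^+ 2 <= _).
  rewrite lerXn2r // nnegrE; last first.
    by apply: mean_ge0 => [|y]; [auto|]; case: (r) r0 => // s _; rewrite expnSr exprM sqr_ge0.
  by case: (r) r0 => // s _; rewrite expnSr exprM sqr_ge0.
apply: le_trans (mean_sqr _) _; first by auto.
by apply/eqW; congr (M _); apply/funext => y; rewrite exprM.
Qed.

End MeanTheory.

Lemma eq_mean (Y : Type) (M : mean Y) (f g : Y -> R) : f =1 g -> M f = M g.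
Proof. by move=> /funext ->. Qed.

Lemma bdd_mean (Y Z : Type) (M : mean Y) (F : Z -> Y -> R) K :
  (forall z y, `|F z y| <= K) -> bdd (fun z => M (F z)).
Proof. by move=> H; exists K => z; apply: mean_norm. Qed.

(** The average is over [H.+1] integers, so that it is never empty. *)
Definition avg_fun (H : nat) (a : nat -> R) := (\sum_(i < H.+1) a i) / H.+1%:R.

Lemma sz_gt0 (H : nat) : 0 < H.+1%:R :> R.
Proof. by rewrite ltr0n. Qed.
Lemma sz_neq0 (H : nat) : H.+1%:R != 0 :> R.
Proof. by rewrite pnatr_eq0. Qed.
Hint Resolve sz_gt0 sz_neq0 : core.

Fact avg_meanP H f g c : bdd f -> bdd g ->
  avg_fun H (fun y => f y + c * g y) = avg_fun H f + c * avg_fun H g.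
Proof.
by move=> _ _; rewrite /avg_fun big_split /= mulrDl -mulr_sumr mulrA.
Qed.
Fact avg_mean_ge0 H f : bdd f -> (forall y, 0 <= f y) -> 0 <= avg_fun H f.
Proof. by move=> _ f0; rewrite /avg_fun divr_ge0 // sumr_ge0. Qed.
Fact avg_mean1 H : avg_fun H (fun=> 1) = 1.
Proof. by rewrite /avg_fun sumr_const card_ord divff. Qed.
Fact avg_spec H : {m : mean nat | forall a, m a = avg_fun H a}.
Proof. by exists (Mean (@avg_meanP H) (@avg_mean_ge0 H) (avg_mean1 H)). Qed.
Definition avg H : mean nat := sval (avg_spec H).

Lemma avgE H a : avg H a = (\sum_(i < H.+1) a i) / H.+1%:R.
Proof. exact: (svalP (avg_spec H)). Qed.

Lemma eq_avg H (a b : nat -> R) : (forall i, (i <= H)%N -> a i = b i) -> avg H a = avg H b.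
Proof. by move=> ab; rewrite !avgE; congr (_ / _); apply: eq_bigr => i _; apply: ab; rewrite -ltnS. Qed.

Lemma avg_le H (a b : nat -> R) : (forall i, (i <= H)%N -> a i <= b i) -> avg H a <= avg H b.
Proof.
move=> ab; rewrite !avgE ler_pM2r ?invr_gt0 //.
by apply: ler_sum => i _; apply: ab; rewrite -ltnS.
Qed.

Lemma avg_le_cst H (a : nat -> R) c : (forall i, (i <= H)%N -> a i <= c) -> avg H a <= c.
Proof. by move=> ab; rewrite -[leRHS](mean_cst (avg H)); apply: avg_le. Qed.

Lemma avgD H a b : avg H (fun i => a i + b i) = avg H a + avg H b.
Proof. by rewrite !avgE big_split mulrDl. Qed.

Lemma avgZ H c a : avg H (fun i => c * a i) = c * avg H a.
Proof. by rewrite !avgE -mulr_sumr mulrA. Qed.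

Lemma mean_avg (Y : Type) (M : mean Y) H (a : nat -> Y -> R) :
  (forall i, bdd (a i)) ->
  M (fun y => avg H (fun i => a i y)) = avg H (fun i => M (a i)).
Proof.
move=> ba; under eq_mean do rewrite avgE mulrC.
rewrite meanZ ?mean_sum //; last exact: bdd_sum.
by rewrite mulrC avgE.
Qed.

Lemma bdd_avg (Y : Type) H (a : nat -> Y -> R) :
  (forall i, bdd (a i)) -> bdd (fun y => avg H (fun i => a i y)).
Proof.
move=> ba; have -> : (fun y => avg H (fun i => a i y)) = (fun y => (\sum_(i < H.+1) a i y) / H.+1%:R).
  by apply/funext => y; rewrite avgE.
by apply: bddM => //; apply: bdd_sum.
Qed.

Lemma avg_exists H (a : nat -> R) c : c <= avg H a -> exists2 i, (i <= H)%N & c <= a i.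
Proof.
move=> ca; have [//|no] := pselect (exists2 i, (i <= H)%N & c <= a i).
have : avg H a < c.
  rewrite avgE ltr_pdivrMr //.
  have -> : c * H.+1%:R = \sum_(i < H.+1) c by rewrite sumr_const card_ord mulr_natr.
  rewrite ltNge; apply/negP => /eqP h.
  have lt i : (i <= H)%N -> a i < c by move=> iH; rewrite ltNge; apply/negP => ?; apply: no; exists i.
  have : \sum_(i < H.+1) a i < \sum_(i < H.+1) c.
    rewrite -subr_gt0 -sumrB (bigD1 ord0) //= ltr_pwDl ?subr_gt0 ?lt //.
    by apply: sumr_ge0 => i _; rewrite subr_ge0 ltW ?lt // -ltnS.
  by move/eqP: h => h; rewrite ltNge h.
by rewrite ltNge ca.
Qed.

(** ** Ultralimits *)

Definition ultra : set_system nat := sval (cid (ultraFilterLemma (F := \oo) _)).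

Lemma ultra_ultra : UltraFilter ultra.
Proof. by rewrite /ultra; case: cid => /= U []. Qed.
#[local] Existing Instance ultra_ultra.

Lemma ultra_proper : ProperFilter ultra.
Proof. exact: ultra_proper. Qed.
#[local] Existing Instance ultra_proper.

Lemma ultra_oo (P : set nat) : (\forall n \near \oo, P n) -> ultra P.
Proof. by rewrite /ultra; case: cid => /= U [_ +]; exact. Qed.

Lemma ultra_ge K : ultra [set n | (K <= n)%N].
Proof. by apply: ultra_oo; exists K. Qed.

Lemma LIM_cvg_ex (a : nat -> R) : bdd a -> cvg (a n @[n --> ultra]).
Proof.
move=> [K aK].
have UF : UltraFilter (a n @[n --> ultra]).
  split=> [|G GF sG]; first exact: fmap_proper_filter.
  apply/seteqP; split=> [A GA|]; last exact: sG.
  have [//|nA] := in_ultra_setVsetC (a @^-1` A) ultra_ultra.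
  have /filter_ex[x []//] : G (A `&` ~` A) by apply: filterI => //; apply: sG.
have : compact `[- K, K]%classic := @segment_compact R (- K) K.
rewrite compact_ultra => /(_ _ UF) [].
  change (ultra [set n | `[- K, K]%classic (a n)]); apply: filterE => n /=.
  by rewrite in_itv /= -ler_norml.
by move=> x [_ ax]; apply/cvg_ex; exists x.
Qed.

Definition LIM_fun (a : nat -> R) : R := lim (a n @[n --> ultra]).

Lemma LIM_cvg (a : nat -> R) : bdd a -> a n @[n --> ultra] --> LIM_fun a.
Proof. by move=> /LIM_cvg_ex. Qed.

Fact LIM_meanP f g c : bdd f -> bdd g ->
  LIM_fun (fun y => f y + c * g y) = LIM_fun f + c * LIM_fun g.
Proof.
move=> /LIM_cvg Hf /LIM_cvg Hg; apply/cvg_lim => //.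
by apply: cvgD => //; apply: cvgM => //; apply: cvg_cst.
Qed.
Fact LIM_mean_ge0 f : bdd f -> (forall y, 0 <= f y) -> 0 <= LIM_fun f.
Proof.
move=> /LIM_cvg_ex Hf f0; apply: limr_ge => //.
by near=> n; apply: f0.
Unshelve. all: by end_near.
Qed.
Fact LIM_mean1 : LIM_fun (fun=> 1) = 1.
Proof. by apply/cvg_lim => //; apply: cvg_cst. Qed.
Fact LIM_spec : {m : mean nat | forall a, m a = LIM_fun a}.
Proof. by exists (Mean LIM_meanP LIM_mean_ge0 LIM_mean1). Qed.
Definition LIM : mean nat := sval LIM_spec.
Lemma LIME a : LIM a = LIM_fun a. Proof. exact: (svalP LIM_spec). Qed.

Lemma LIM_le_near (a b : nat -> R) : bdd a -> bdd b ->
  ultra [set n | a n <= b n] -> LIM a <= LIM b.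
Proof. by move=> Ha Hb ab; rewrite !LIME; apply: ler_lim; [exact: LIM_cvg_ex|exact: LIM_cvg_ex|]. Qed.

Lemma LIM_near_gt (a : nat -> R) c : bdd a -> c < LIM a -> ultra [set n | c < a n].
Proof.
rewrite LIME => Ha cl; have := LIM_cvg Ha; move/(@cvgr_gt R); exact.
Qed.

Lemma LIM_near_lt (a : nat -> R) c : bdd a -> LIM a < c -> ultra [set n | a n < c].
Proof.
rewrite LIME => Ha cl; have := LIM_cvg Ha; move/(@cvgr_lt R); exact.
Qed.

Lemma LIM_cvg0 (a : nat -> R) : bdd a ->
  (forall e, 0 < e -> ultra [set n | `|a n| <= e]) -> LIM a = 0.
Proof.
move=> Ha H; apply/eqP; rewrite -normr_le0; apply/ler_addgt0Pr => e e0; rewrite add0r.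
rewrite ler_norml; apply/andP; split.
  rewrite -[leLHS](mean_cst LIM); apply: LIM_le_near => //.
  by apply: filterS (H e e0) => n /=; rewrite ler_norml => /andP[].
rewrite -[leRHS](mean_cst LIM); apply: LIM_le_near => //.
by apply: filterS (H e e0) => n /=; rewrite ler_norml => /andP[].
Qed.

Lemma inv_small (K e : R) : 0 < e -> exists H0, forall H, (H0 <= H)%N -> K / H.+1%:R <= e.
Proof.
move=> e0; exists (Num.truncn (K / e)) => H h.
rewrite ler_pdivrMr // mulrC -ler_pdivrMr //; apply: ltW.
apply: lt_le_trans (truncnS_gt _) _.
by rewrite ler_nat ltnS.
Qed.

Lemma LIM_inv (K : R) : LIM (fun H => K / H.+1%:R) = 0.
Proof.
have b : bdd (fun H => K / H.+1%:R).
  exists `|K| => H; rewrite normrM normfV normr_nat ler_pdivrMr //.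
  by rewrite ler_peMr // ler1n.
apply: LIM_cvg0 => // e e0.
have [H0 hH0] := inv_small `|K| e0.
apply: filterS (ultra_ge H0) => H /= h.
by rewrite normrM normfV normr_nat; apply: hH0.
Qed.

(** ** Cesaro means *)

Lemma bdd_avgH (a : nat -> R) : bdd a -> bdd (fun H => avg H a).
Proof. by move=> [K aK]; exists K => H; apply: mean_norm. Qed.
Hint Resolve bdd_avgH : core.

Definition ces_fun (a : nat -> R) : R := LIM (fun H => avg H a).
Fact ces_meanP f g c : bdd f -> bdd g ->
  ces_fun (fun y => f y + c * g y) = ces_fun f + c * ces_fun g.
Proof.
move=> Hf Hg; rewrite /ces_fun -meanP; try by auto.
by apply: eq_mean => H; rewrite avgD avgZ.
Qed.
Fact ces_mean_ge0 f : bdd f -> (forall y, 0 <= f y) -> 0 <= ces_fun f.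
Proof. by move=> Hf f0; apply: mean_ge0 => [|H]; [auto|apply: mean_ge0]. Qed.
Fact ces_mean1 : ces_fun (fun=> 1) = 1.
Proof. by rewrite /ces_fun; under eq_mean do rewrite mean1; rewrite mean1. Qed.
Fact ces_spec : {m : mean nat | forall a, m a = ces_fun a}.
Proof. by exists (Mean ces_meanP ces_mean_ge0 ces_mean1). Qed.
Definition ces : mean nat := sval ces_spec.

Lemma cesE a : ces a = LIM (fun H => avg H a).
Proof. exact: (svalP ces_spec). Qed.

Lemma LIM_near0 (a b : nat -> R) K : bdd a -> bdd b ->
  (forall H, `|a H - b H| <= K / H.+1%:R) -> LIM a = LIM b.
Proof.
move=> Ha Hb ab; apply/eqP; rewrite -subr_eq0 -meanB //; apply/eqP/LIM_cvg0; first by auto.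
move=> e e0; have [H0 hH0] := inv_small K e0.
by apply: filterS (ultra_ge H0) => H /= h; apply: le_trans (ab H) (hH0 H h).
Qed.

Definition invm (M : mean nat) := forall a, bdd a -> M (fun n => a n.+1) = M a.

Lemma ces_inv : invm ces.
Proof.
move=> a [K aK]; have ba : bdd a by exists K.
rewrite !cesE; apply: (@LIM_near0 _ _ (K + K)); [apply: bdd_avgH; exact: bdd_comp|by auto|] => H.
rewrite !avgE -mulrBl normrM normfV normr_nat ler_pM2r ?invr_gt0 //.
rewrite [X in _ - X]big_ord_recl [X in X - _]big_ord_recr /=.
have -> : \sum_(i < H) a (bump 0 i) = \sum_(i < H) a i.+1 by [].
move: (\sum_(i < H) _) => s.
have -> : s + a H.+1 - (a 0%N + s) = a H.+1 - a 0%N by ring.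
by apply: le_trans (ler_normB _ _) _; apply: lerD.
Qed.

Lemma invm_add M a h : invm M -> bdd a -> M (fun n => a (n + h)%N) = M a.
Proof.
move=> iM ba; elim: h => [|h IH]; first by apply: eq_mean => n; rewrite addn0.
rewrite -IH -[RHS](iM (fun n => a (n + h)%N)); last exact: bdd_comp.
by apply: eq_mean => n; rewrite addSnnS.
Qed.

(** Restricting an invariant mean to a residue class and dilating it back. *)
Definition dil_fun (M : mean nat) (W : nat) (b : 'I_W.+1) (u : nat -> R) : R :=
  M (fun n => if (n %% W.+1 == b)%N then W.+1%:R * u (n %/ W.+1)%N else 0).

Lemma bdd_dil W (b : 'I_W.+1) u : bdd u ->
  bdd (fun n => if (n %% W.+1 == b)%N then W.+1%:R * u (n %/ W.+1)%N else 0).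
Proof.
move=> [K uK]; exists (W.+1%:R * `|K|) => n; case: ifP => _; last by rewrite normr0 mulr_ge0.
by rewrite normrM normr_nat ler_wpM2l //; apply: le_trans (uK _) (ler_norm K).
Qed.

Lemma dil_residue (M : mean nat) W (b : 'I_W.+1) : invm M ->
  M (fun n => if (n %% W.+1 == b)%N then W.+1%:R else 0) = 1.
Proof.
move=> iM; pose F i n : R := if (n %% W.+1 == i)%N then W.+1%:R else 0.
have bF i : bdd (F i).
  by exists W.+1%:R => n; rewrite /F; case: ifP => _; rewrite ?normr0 ?normr_nat.
have shift : forall i, (i <= W)%N -> M (F i) = M (F 0%N).
  elim=> [//|i IH iW]; rewrite -IH ?(ltnW iW) // -(iM (F i.+1)) //.
  apply: eq_mean => n; rewrite /F -addn1 -modnDml addn1.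
  have := ltn_pmod n (ltn0Sn W); move: (n %% _)%N => r; rewrite ltnS leq_eqVlt => /orP[/eqP->|rW].
    by rewrite modnn /=; case: ifP => // /eqP iE; move: iW; rewrite iE ltnn.
  by rewrite modn_small // eqSS.
have : M (fun n => avg W (fun i => F i n)) = 1.
  rewrite -[RHS](mean1 M); apply: eq_mean => n.
  have nW : (n %% W.+1 < W.+1)%N by rewrite ltn_pmod.
  rewrite avgE (bigD1 (Ordinal nW)) //= {1}/F eqxx big1 ?addr0 ?divff //.
  move=> i /eqP ni; rewrite /F; case: ifP => // /eqP ei; case: ni.
  by apply/val_inj; rewrite /= ei.
rewrite mean_avg // => e; rewrite -[RHS]e -[LHS](mean_cst (avg W)).
apply: eq_avg => i iW; rewrite (shift i iW).
have bW : (b <= W)%N by rewrite -ltnS.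
by rewrite -(shift b bW).

Qed.

Section Dil.
Variables (M : mean nat) (iM : invm M) (W : nat) (b : 'I_W.+1).
Fact dil_meanP f g c : bdd f -> bdd g ->
  dil_fun M b (fun y => f y + c * g y) = dil_fun M b f + c * dil_fun M b g.
Proof.
move=> Hf Hg; rewrite /dil_fun -meanP; try exact: bdd_dil.
by apply: eq_mean => n; case: ifP => _; ring.
Qed.
Fact dil_mean_ge0 f : bdd f -> (forall y, 0 <= f y) -> 0 <= dil_fun M b f.
Proof.
by move=> Hf f0; apply: mean_ge0 => [|n]; [exact: bdd_dil|case: ifP => _ //; rewrite mulr_ge0].
Qed.
Fact dil_mean1 : dil_fun M b (fun=> 1) = 1.
Proof. by rewrite /dil_fun -[RHS](dil_residue b iM); apply: eq_mean => n; rewrite mulr1. Qed.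
Fact dil_spec : {m : mean nat | forall a, m a = dil_fun M b a}.
Proof. by exists (Mean dil_meanP dil_mean_ge0 dil_mean1). Qed.
Definition dil : mean nat := sval dil_spec.

Lemma dilE u : dil u = dil_fun M b u. Proof. exact: (svalP dil_spec). Qed.

Lemma dil_inv : invm dil.
Proof.
move=> a ba; rewrite !dilE /dil_fun.
rewrite -[RHS](@invm_add M _ W.+1 iM); last exact: bdd_dil.
by apply: eq_mean => n; rewrite modnDr divnDr // divnn /= addn1.
Qed.
End Dil.

(** Every integer has exactly one residue, so that an invariant mean is the average
of its dilated restrictions to the residue classes. *)
Lemma mean_dil (M : mean nat) (iM : invm M) (W : nat) (u : nat -> R) : bdd u ->
  M u = avg W (fun b => dil iM (inord b : 'I_W.+1) (fun n => u (n * W.+1 + b)%N)).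
Proof.
move=> bu; pose F (i n : nat) := if (n %% W.+1 == (inord i : 'I_W.+1))%N then
   W.+1%:R * u (n %/ W.+1 * W.+1 + i)%N else 0.
transitivity (avg W (fun i => M (F i))); last by apply: eq_mean => i; rewrite dilE.
rewrite -mean_avg; last first.
  by move=> i; apply: bdd_dil (fun n => u (n * W.+1 + i)%N) _; exact: bdd_comp.
rewrite /F {F}.
apply: eq_mean => n; have nW : (n %% W.+1 < W.+1)%N by rewrite ltn_pmod.
rewrite avgE (bigD1 (Ordinal nW)) //= inordK // eqxx -divn_eq big1.
  by rewrite addr0 mulrAC divff // mul1r.
move=> i /eqP ni; rewrite inordK //; case: ifP => // /eqP ei; case: ni.
by apply/val_inj; rewrite /= ei.
Qed.

Lemma dil_exists (M : mean nat) (iM : invm M) (W : nat) (u : nat -> R) c : bdd u ->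
  c <= M u -> exists2 b, (b <= W)%N & exists2 M' : mean nat, invm M' & c <= M' (fun n => u (n * W.+1 + b)%N).
Proof.
move=> bu; rewrite (mean_dil iM W bu) => /avg_exists[b bW cb].
by exists b => //; exists (dil iM (inord b : 'I_W.+1)) => //; apply: dil_inv.
Qed.

(** For a fixed [h], each distance to [h] occurs at most twice. *)
Lemma avg_fejer H (a : nat -> R) : (forall n, 0 <= a n) ->
  avg H (fun h => avg H (fun h' => a `|h - h'|%N)) <= 2 * avg H a.
Proof.
move=> a0; apply: avg_le_cst => h hH.
rewrite !avgE mulrA ler_pM2r ?invr_gt0 //.
have -> : \sum_(i < H.+1) a `|h - i|%N = \sum_(0 <= i < H.+1) a `|h - i|%N.
  by rewrite big_mkord.
rewrite (big_cat_nat (leq0n h) (ltnW (_ : h < H.+1)%N)) //= mulrDl mul1r.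
rewrite -[\sum_(i < H.+1) a i](big_mkord xpredT).
apply: lerD.
  rewrite big_nat_rev /=.
  apply: le_trans (_ : \sum_(1 <= i < h.+1) a i <= _).
    rewrite big_add1 /=.

    apply: ler_sum_nat => i /andP[_ ih].
    by rewrite add0n distnEl; [rewrite subKn //|lia].
  rewrite [leRHS](big_cat_nat (leq0n 1)) //= [X in _ <= _ + X](big_cat_nat (_ : 1 <= h.+1)%N (_ : h.+1 <= H.+1)%N) //=.
  by rewrite addrCA ler_wpDr // addr_ge0 ?sumr_ge0.
rewrite -{1}[h]add0n big_addn.
rewrite [leRHS](big_cat_nat (leq0n (H.+1 - h)) (leq_subr _ _)) //=.
rewrite ler_wpDr ?sumr_ge0 //; apply: ler_sum_nat => i _.
by rewrite distnEr ?leq_addl // addnK.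
Qed.

End Means.

(** * Bounded functions on a space with an action of the integers *)

(** The first coordinate of a point will be the index of a finite interval of
integers and the second one a position in it. *)
Definition point := (nat * int)%type.

#[local] Hint Resolve bdd_cst bddD bddM bddN bddB bddX : core.
#[local] Hint Resolve sz_gt0 sz_neq0 : core.

Section Complex.
Variable R : realType.
Local Notation C := R[i].
Implicit Types z w : C.

Definition re z : R := complex.Re z.

Lemma reD z w : re (z + w) = re z + re w. Proof. by case: z => a b; case: w. Qed.
Lemma reN z : re (- z) = - re z. Proof. by case: z. Qed.
Lemma re_cc (c : R) z : re (c%:C%C * z) = c * re z.
Proof. by case: z => a b /=; rewrite mul0r subr0. Qed.
Lemma re_real (c : R) : re (c%:C%C) = c. Proof. by []. Qed.
Lemma re_conj z : re (z^*) = re z. Proof. by case: z. Qed.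
Lemma re_sq z : re (z * z^*) = re z ^+ 2 + complex.Im z ^+ 2.
Proof. by case: z => a b /=; ring. Qed.
Lemma re_sq_ge0 z : 0 <= re (z * z^*).
Proof. by rewrite re_sq addr_ge0 ?sqr_ge0. Qed.
Lemma re_le z w : z <= w -> re z <= re w.
Proof. by rewrite lecE => /andP[]. Qed.
Lemma re_norm z w : `|z| <= w -> `|re z| <= re w.
Proof.
move=> zw; have := le_trans (normc_ge_Re z) zw.
by rewrite lecE /= => /andP[].
Qed.
Lemma re_sum (I : Type) (r : seq I) (P : pred I) (F : I -> C) :
  re (\sum_(i <- r | P i) F i) = \sum_(i <- r | P i) re (F i).
Proof.
elim: r => [|i r IH]; first by rewrite !big_nil.
by rewrite !big_cons; case: (P i); rewrite ?reD IH.
Qed.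
Lemma sq_le1 z : (`|z| <= 1) = (re (z * z^*) <= 1).
Proof.
have e : `|z| ^+ 2 = (re (z * z^*))%:C%C.
  rewrite normCK re_sq; apply/eqP; rewrite eq_complex; case: z => a b /=.
  by apply/andP; split; apply/eqP; ring.
by rewrite -(@expr_le1 _ 2) // e lecE /= eqxx.
Qed.

End Complex.

Section Fun.
Variable R : realType.
Local Notation C := R[i].
Definition fn := point -> C.
HB.instance Definition _ := GRing.ComPzRing.on fn.
Implicit Types (f g : fn) (l : int).

Definition sh l f : fn := fun x => f (x.1, x.2 + l).
Definition cj f : fn := fun x => (f x)^*.
Definition cc (c : R) : fn := fun=> c%:C%C.

Lemma sh_is_zmod l : zmod_morphism (sh l). Proof. by []. Qed.
Lemma sh_is_monoid l : monoid_morphism (sh l). Proof. by []. Qed.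
HB.instance Definition _ l := GRing.isZmodMorphism.Build fn fn (sh l) (sh_is_zmod l).
HB.instance Definition _ l := GRing.isMonoidMorphism.Build fn fn (sh l) (sh_is_monoid l).
Lemma cj_is_zmod : zmod_morphism cj.
Proof. by move=> f g; apply/funext => x; rewrite /cj /= rmorphB. Qed.
Lemma cj_is_monoid : monoid_morphism cj.
Proof.
split=> [|f g]; first by apply/funext => x; rewrite /cj /= rmorph1.
by apply/funext => x; rewrite /cj /= rmorphM.
Qed.
HB.instance Definition _ := GRing.isZmodMorphism.Build fn fn cj cj_is_zmod.
HB.instance Definition _ := GRing.isMonoidMorphism.Build fn fn cj cj_is_monoid.

Lemma cjM f g : cj (f * g) = cj f * cj g. Proof. exact: rmorphM. Qed.
Lemma cjD f g : cj (f + g) = cj f + cj g. Proof. exact: rmorphD. Qed.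
Lemma cjB f g : cj (f - g) = cj f - cj g. Proof. exact: rmorphB. Qed.
Lemma cjN f : cj (- f) = - cj f. Proof. exact: rmorphN. Qed.
Lemma cj1 : cj 1 = 1. Proof. exact: rmorph1. Qed.
Lemma cj_sum (I : Type) (r : seq I) (P : pred I) (F : I -> fn) :
  cj (\sum_(i <- r | P i) F i) = \sum_(i <- r | P i) cj (F i).
Proof. exact: rmorph_sum. Qed.
Lemma cj_prod (I : Type) (r : seq I) (P : pred I) (F : I -> fn) :
  cj (\prod_(i <- r | P i) F i) = \prod_(i <- r | P i) cj (F i).
Proof. exact: rmorph_prod. Qed.
Lemma shM l f g : sh l (f * g) = sh l f * sh l g. Proof. by []. Qed.
Lemma shB l f g : sh l (f - g) = sh l f - sh l g. Proof. by []. Qed.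
Lemma sh1 l : sh l 1 = 1. Proof. by []. Qed.
Lemma sh_prod l (I : Type) (r : seq I) (P : pred I) (F : I -> fn) :
  sh l (\prod_(i <- r | P i) F i) = \prod_(i <- r | P i) sh l (F i).
Proof. exact: rmorph_prod. Qed.

Lemma shsh k l f : sh k (sh l f) = sh (k + l) f.
Proof. by apply/funext => x; rewrite /sh /= addrA. Qed.
Lemma sh0 f : sh 0 f = f.
Proof. by apply/funext => -[x y]; rewrite /sh /= addr0. Qed.
Lemma shK l f : sh (- l) (sh l f) = f.
Proof. by rewrite shsh addNr sh0. Qed.
Lemma shNK l f : sh l (sh (- l) f) = f.
Proof. by rewrite shsh addrN sh0. Qed.
Lemma cjK f : cj (cj f) = f.
Proof. by apply/funext => x; rewrite /cj conjCK. Qed.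
Lemma cj_sh l f : cj (sh l f) = sh l (cj f). Proof. by []. Qed.
Lemma cj_cc c : cj (cc c) = cc c.
Proof. by apply/funext => x; rewrite /cj /cc; apply/eqP; rewrite eq_complex /= oppr0 !eqxx. Qed.
Lemma sh_cc l c : sh l (cc c) = cc c. Proof. by []. Qed.
Lemma cc1 : cc 1 = 1. Proof. by []. Qed.
Lemma ccM c d : cc (c * d) = cc c * cc d.
Proof. by apply/funext => x; rewrite /cc; apply/eqP; rewrite eq_complex /= !mulr0 mul0r subr0 addr0 !eqxx. Qed.
Lemma ccN c : cc (- c) = - cc c.
Proof. by apply/funext => x; rewrite /cc; apply/eqP; rewrite eq_complex /= oppr0 !eqxx. Qed.

Definition b1 f := forall x, `|f x| <= 1.
Definition cb f := exists K : C, forall x, `|f x| <= K.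

Lemma b1_cb f : b1 f -> cb f. Proof. by exists 1. Qed.
Lemma b1M f g : b1 f -> b1 g -> b1 (f * g).
Proof. by move=> Hf Hg x; rewrite normrM mulr_ile1. Qed.
Lemma b1_cj f : b1 f -> b1 (cj f).
Proof. by move=> Hf x; rewrite norm_conjC. Qed.
Lemma b1_sh l f : b1 f -> b1 (sh l f).
Proof. by move=> Hf x; apply: Hf. Qed.
Lemma b1_1 : b1 1. Proof. by move=> x; rewrite normr1. Qed.
Lemma b1_0 : b1 0. Proof. by move=> x; rewrite normr0. Qed.
Lemma b1N f : b1 f -> b1 (- f). Proof. by move=> Hf x; rewrite normrN. Qed.
Lemma b1X f n : b1 f -> b1 (f ^+ n).
Proof. by move=> Hf; elim: n => [|n IH]; rewrite ?exprS; [exact: b1_1|exact: b1M]. Qed.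
Lemma b1_prod (I : Type) (r : seq I) (P : pred I) (F : I -> fn) :
  (forall i, P i -> b1 (F i)) -> b1 (\prod_(i <- r | P i) F i).
Proof. by move=> HF; elim/big_rec: _ => [|i g Pi]; [exact: b1_1|apply: b1M; apply: HF]. Qed.
Lemma cbM f g : cb f -> cb g -> cb (f * g).
Proof. by move=> [K HK] [L HL]; exists (K * L) => x; rewrite normrM ler_pM. Qed.
Lemma cbD f g : cb f -> cb g -> cb (f + g).
Proof. by move=> [K HK] [L HL]; exists (K + L) => x; apply: le_trans (ler_normD _ _) _; exact: lerD. Qed.
Lemma cbN f : cb f -> cb (- f).
Proof. by move=> [K HK]; exists K => x; rewrite normrN. Qed.
Lemma cbB f g : cb f -> cb g -> cb (f - g).
Proof. by move=> Hf Hg; apply: cbD => //; apply: cbN. Qed.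
Lemma cb_cj f : cb f -> cb (cj f).
Proof. by move=> [K HK]; exists K => x; rewrite norm_conjC. Qed.
Lemma cb_sh l f : cb f -> cb (sh l f).
Proof. by move=> [K HK]; exists K => x; apply: HK. Qed.
Lemma cb_cc c : cb (cc c). Proof. by exists `|c%:C%C| => x. Qed.
Lemma cb_sum (I : Type) (r : seq I) (P : pred I) (F : I -> fn) :
  (forall i, cb (F i)) -> cb (\sum_(i <- r | P i) F i).
Proof. by move=> HF; elim/big_rec: _ => [|i g Pi]; [exact: b1_cb b1_0|apply: cbD; apply: HF]. Qed.

End Fun.
#[global] Hint Resolve b1M b1_cj b1_sh b1_1 b1_0 b1N b1X : bfn.
#[global] Hint Resolve b1_cb cbM cbD cbN cbB cb_cj cb_sh cb_cc cb_sum : bfn.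
Ltac bfn := auto 20 with bfn.

Section Expect.
Variables (R : realType) (mu : mean R point).
Local Notation C := R[i].
Local Notation fn := (fn R).
Implicit Types (f g h : fn) (l : int).

Definition ex f : R := mu (fun x => re (f x)).
Definition nn f : R := ex (f * cj f).
Lemma nnE f : nn f = ex (f * cj f). Proof. by []. Qed.

Lemma bdd_re f : cb f -> bdd (fun x => re (f x)).
Proof. by move=> [K HK]; exists (re K) => x; apply: re_norm. Qed.
Hint Resolve bdd_re : core.

Lemma exD f g : cb f -> cb g -> ex (f + g) = ex f + ex g.
Proof. by move=> Hf Hg; rewrite /ex -meanD; auto; apply: eq_mean => x; rewrite -reD. Qed.
Lemma exN f : cb f -> ex (- f) = - ex f.
Proof. by move=> Hf; rewrite /ex -meanN; auto; apply: eq_mean => x; rewrite -reN. Qed.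
Lemma exB f g : cb f -> cb g -> ex (f - g) = ex f - ex g.
Proof. by move=> Hf Hg; rewrite exD ?exN //; bfn. Qed.
Lemma exZ c f : cb f -> ex (cc c * f) = c * ex f.
Proof. by move=> Hf; rewrite /ex -meanZ; auto; apply: eq_mean => x; rewrite -re_cc. Qed.
Lemma ex0 : ex 0 = 0. Proof. exact: mean_cst. Qed.
Lemma ex_sum (I : Type) (r : seq I) (P : pred I) (F : I -> fn) :
  (forall i, cb (F i)) -> ex (\sum_(i <- r | P i) F i) = \sum_(i <- r | P i) ex (F i).
Proof.
move=> HF; elim: r => [|i r IH]; first by rewrite !big_nil ex0.
by rewrite !big_cons; case: (P i) => //; rewrite exD ?IH //; apply: cb_sum.
Qed.
Lemma ex_cj f : ex (cj f) = ex f.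
Proof. by apply: eq_mean => x; rewrite re_conj. Qed.
Lemma ex_le f g : cb f -> cb g -> (forall x, re (f x) <= re (g x)) -> ex f <= ex g.
Proof. by move=> Hf Hg; apply: mean_le; auto. Qed.
Lemma ex_b1 f : b1 f -> `|ex f| <= 1.
Proof. by move=> Hf; apply: mean_norm => x; apply: re_norm (Hf x). Qed.
Lemma ex_le1 f : b1 f -> ex f <= 1.
Proof. by move=> /ex_b1; apply: le_trans; apply: ler_norm. Qed.

Lemma nn_ge0 f : cb f -> 0 <= nn f.
Proof. by move=> Hf; apply: mean_ge0 => [|x]; [apply: bdd_re; bfn|apply: re_sq_ge0]. Qed.
Lemma nn_le1 f : b1 f -> nn f <= 1.
Proof. by move=> Hf; apply: ex_le1; bfn. Qed.
Lemma nnN f : nn (- f) = nn f.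
Proof. by rewrite /nn cjN mulrNN. Qed.
Lemma nn_cj f : nn (cj f) = nn f.
Proof. by rewrite /nn cjK mulrC. Qed.
Lemma nnD f g : cb f -> cb g -> nn (f + g) = nn f + nn g + 2 * ex (f * cj g).
Proof.
move=> Hf Hg; rewrite /nn cjD mulrDl !mulrDr !exD; try by bfn.
rewrite -(ex_cj (g * cj f)) cjM cjK [cj g * f]mulrC; ring.
Qed.
Lemma nnZ c f : cb f -> nn (cc c * f) = c ^+ 2 * nn f.
Proof.
move=> Hf; rewrite /nn cjM cj_cc mulrACA -ccM exZ ?expr2 //; bfn.
Qed.
Lemma nnB f g : cb f -> cb g -> nn (f - g) = nn f + nn g - 2 * ex (f * cj g).
Proof.
by move=> Hf Hg; rewrite nnD ?nnN ?cjN ?mulrN ?exN; bfn; ring.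
Qed.

Lemma CS f g : cb f -> cb g -> ex (f * g) ^+ 2 <= nn f * nn g.
Proof.
move=> Hf Hg; set c := ex _.
have H t : 0 <= nn f - 2 * t * c + t ^+ 2 * nn g.
  have := @nn_ge0 (f - cc t * cj g) (cbB Hf (cbM (cb_cc _) (cb_cj Hg))).
  rewrite nnB; try by bfn.
  rewrite nnZ ?nn_cj; last by bfn.
  rewrite cjM cj_cc cjK mulrCA exZ -/c; last by bfn.
  by move=> h; apply: le_trans h _; apply: eqW; ring.
have [B0|B0] := eqVneq (nn g) 0.
  rewrite B0 mulr0; have [->|c0] := eqVneq c 0; first by rewrite expr0n.
  have := H ((nn f + 1) / (2 * c)); rewrite B0 mulr0 addr0.
  have -> : 2 * ((nn f + 1) / (2 * c)) * c = nn f + 1 by field.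
  by rewrite opprD addrA subrr sub0r lerNr oppr0 ler10.
have Bp : 0 < nn g by rewrite lt_def B0 nn_ge0.
have := H (c / nn g).
have -> : nn f - 2 * (c / nn g) * c + (c / nn g) ^+ 2 * nn g = (nn f * nn g - c ^+ 2) / nn g.
  by field.
by rewrite ler_pdivlMr // mul0r subr_ge0.
Qed.

Lemma CS1 f g : b1 f -> cb g -> ex (f * g) ^+ 2 <= nn g.
Proof.
move=> Hf Hg; apply: le_trans (CS (b1_cb Hf) Hg) _.
by rewrite -[leRHS]mul1r ler_wpM2r ?nn_ge0 ?nn_le1.
Qed.

(** ** Equality almost everywhere *)

Definition aeq f g := nn (f - g) = 0.
Lemma aeqE f g : aeq f g = (nn (f - g) = 0). Proof. by []. Qed.

Lemma aeq_refl f : aeq f f.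
Proof. by rewrite /aeq subrr /nn mul0r ex0. Qed.
Lemma aeq_sym f g : aeq f g -> aeq g f.
Proof. by rewrite /aeq => <-; rewrite -nnN opprB. Qed.

Lemma null_ex f g : cb f -> cb g -> nn f = 0 -> ex (f * g) = 0.
Proof.
move=> Hf Hg f0; have := CS Hf Hg; rewrite f0 mul0r => h.
by apply/eqP; rewrite -sqrf_eq0 eq_le h sqr_ge0.
Qed.

Lemma nullD f g : cb f -> cb g -> nn f = 0 -> nn g = 0 -> nn (f + g) = 0.
Proof. by move=> Hf Hg f0 g0; rewrite nnD // f0 g0 null_ex //; [ring|bfn]. Qed.

Lemma nullM f g : cb f -> cb g -> nn f = 0 -> nn (f * g) = 0.
Proof.
move=> Hf Hg f0; rewrite /nn cjM -mulrA.
by apply: null_ex => //; bfn.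
Qed.

Lemma aeq_trans g f h : cb f -> cb g -> cb h -> aeq f g -> aeq g h -> aeq f h.
Proof.
move=> Hf Hg Hh fg gh; rewrite /aeq.
have -> : f - h = (f - g) + (g - h) by ring.
by apply: nullD => //; bfn.
Qed.

Lemma aeqM f f' g g' : cb f -> cb f' -> cb g -> cb g' ->
  aeq f f' -> aeq g g' -> aeq (f * g) (f' * g').
Proof.
move=> Hf Hf' Hg Hg' ff gg; rewrite /aeq.
have -> : f * g - f' * g' = (f - f') * g + (g - g') * f' by ring.
by apply: nullD; bfn; apply: nullM; bfn.
Qed.

Lemma aeqMl g f f' : cb f -> cb f' -> cb g -> aeq f f' -> aeq (g * f) (g * f').
Proof. by move=> *; apply: aeqM => //; apply: aeq_refl. Qed.

Lemma aeqMr g f f' : cb f -> cb f' -> cb g -> aeq f f' -> aeq (f * g) (f' * g).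
Proof. by move=> *; apply: aeqM => //; apply: aeq_refl. Qed.

Lemma aeq_cj f g : aeq f g -> aeq (cj f) (cj g).
Proof. by rewrite /aeq -cjB nn_cj. Qed.

Lemma aeqB f f' g g' : cb f -> cb f' -> cb g -> cb g' ->
  aeq f f' -> aeq g g' -> aeq (f - g) (f' - g').
Proof.
move=> Hf Hf' Hg Hg' ff gg; rewrite /aeq.
have -> : f - g - (f' - g') = (f - f') + - (g - g') by ring.
by apply: nullD; bfn; rewrite nnN.
Qed.

Lemma aeq_ex f g h : cb f -> cb g -> cb h -> aeq f g -> ex (f * h) = ex (g * h).
Proof.
move=> Hf Hg Hh fg; apply/eqP; rewrite -subr_eq0 -exB; try by bfn.
by rewrite -mulrBl null_ex //; bfn.
Qed.

Lemma aeq_ex1 f g : cb f -> cb g -> aeq f g -> ex f = ex g.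
Proof. by move=> Hf Hg /(@aeq_ex f g 1) h; rewrite -[f]mulr1 h ?mulr1 //; bfn. Qed.

Lemma ex_sep f g : b1 f -> b1 g -> (forall h, b1 h -> ex (f * h) = ex (g * h)) -> aeq f g.
Proof.
move=> Hf Hg H; rewrite /aeq /nn cjB mulrBr !mulrBl !exB; try by bfn.
by rewrite !H ?subrr //; bfn.
Qed.

(** ** Averages of functions *)

Definition avgF H (F : nat -> fn) : fn := cc (H.+1%:R^-1) * \sum_(i < H.+1) F i.

Lemma eq_avgF H F G : (forall i, F i = G i) -> avgF H F = avgF H G.
Proof. by move=> FG; rewrite /avgF; congr (_ * _); apply: eq_bigr. Qed.
Lemma cb_avgF H F : (forall i, cb (F i)) -> cb (avgF H F).
Proof. by move=> HF; apply: cbM; bfn. Qed.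
Lemma b1_avgF H F : (forall i, b1 (F i)) -> b1 (avgF H F).
Proof.
move=> HF x; rewrite /avgF /cc /= fct_sumE.
rewrite normrM.
have -> : `|(H.+1%:R^-1)%:C%C| = (H.+1%:R^-1 : C).
  by rewrite fmorphV /= normfV rmorph_nat normr_nat.
rewrite mulrC ler_pdivrMr ?ltr0n // mul1r.
apply: le_trans (ler_norm_sum _ _ _) _.
apply: le_trans (_ : \sum_(i < H.+1) 1 <= _); first by apply: ler_sum => i _; apply: HF.
by rewrite sumr_const card_ord.
Qed.
Lemma avgFMl H F g : g * avgF H F = avgF H (fun i => g * F i).
Proof. by rewrite /avgF mulrCA mulr_sumr. Qed.
Lemma avgFMr H F g : avgF H F * g = avgF H (fun i => F i * g).
Proof. by rewrite mulrC avgFMl; apply: eq_avgF => i; rewrite mulrC. Qed.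
Lemma cj_avgF H F : cj (avgF H F) = avgF H (fun i => cj (F i)).
Proof. by rewrite /avgF cjM cj_sum cj_cc. Qed.
Lemma ex_avgF H F : (forall i, cb (F i)) -> ex (avgF H F) = avg R H (fun i => ex (F i)).
Proof.
move=> HF; rewrite /avgF exZ; last by bfn.
by rewrite avgE mulrC ex_sum.
Qed.
Lemma nn_avgF H F : (forall i, cb (F i)) ->
  nn (avgF H F) = avg R H (fun i => avg R H (fun j => ex (F i * cj (F j)))).
Proof.
move=> HF; rewrite /nn avgFMr ex_avgF; last by move=> i; apply: cbM; bfn; apply/cb_cj/cb_avgF.
apply: eq_mean => i; rewrite cj_avgF avgFMl ex_avgF //; bfn.
Qed.
End Expect.
#[global] Hint Resolve b1_avgF cb_avgF aeq_refl : bfn.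

(** * Weak limits, invariant projections and van der Corput's inequality *)

Section Sys.
Variable R : realType.
Local Notation C := R[i].
Local Notation fn := (fn R).

(** A probability space with a measure preserving action of the integers by [sh],
seen through its bounded functions; since [sys_mean] is only finitely additive,
completeness of the unit ball in mean square is required separately. *)
Structure sys := Sys {
  sys_mean :> mean R point;
  sys_inv : forall l (f : fn), cb f -> ex sys_mean (sh l f) = ex sys_mean f;
  sys_complete : forall F : nat -> fn, (forall i, b1 (F i)) ->
    (forall e : R, 0 < e -> exists N, forall i j, (N <= i)%N -> (N <= j)%N ->
      nn sys_mean (F i - F j) <= e) ->
    exists2 f : fn, b1 f & forall e : R, 0 < e -> exists N, forall i, (N <= i)%N ->
      nn sys_mean (F i - f) <= e }.

Variable mu : sys.
Local Notation ex := (ex mu).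
Local Notation nn := (nn mu).
Local Notation aeq := (aeq mu).
Implicit Types (f g u : fn) (M : mean R nat).

Lemma bdd_exb (Y : Type) (F : Y -> fn) : (forall n, b1 (F n)) -> bdd (fun n => ex (F n)).
Proof. by move=> HF; exists 1 => n; apply: ex_b1. Qed.

Lemma cb_scale g : cb g -> exists2 c : R, 0 < c & b1 (cc c * g).
Proof.
move=> [K HK]; have rK : 0 <= re K.
  by have := le_trans (normr_ge0 _) (HK (0%N, 0)); rewrite lecE => /andP[].
exists (1 + re K)^-1; first by rewrite invr_gt0 ltr_wpDr.
move=> x; rewrite normrM.
have -> : `|cc (1 + re K)^-1 x| = ((1 + re K)^-1)%:C%C.
  by rewrite /cc normc_def /= expr0n /= addr0 sqrtr_sqr ger0_norm // invr_ge0 addr_ge0.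
have HK' : `|g x| <= (re K)%:C%C.
  have := HK x; rewrite !normc_def !lecE /= => /andP[/eqP _ ->].
  by rewrite eqxx.
apply: le_trans (ler_wpM2l _ HK') _; first by rewrite lecE /= eqxx invr_ge0 addr_ge0.
rewrite -rmorphM lecE /= eqxx /= mulrC ler_pdivrMr ?mul1r ?lerDr // ltr_wpDr //.
Qed.

Lemma bdd_exM (Y : Type) (F : Y -> fn) g : (forall n, b1 (F n)) -> cb g -> bdd (fun n => ex (F n * g)).
Proof.
move=> HF Hg; have [c c0 bg] := cb_scale Hg.
have -> : (fun n => ex (F n * g)) = (fun n => c^-1 * ex (F n * (cc c * g))).
  apply/funext => n; rewrite mulrCA exZ; last by bfn.
  by rewrite mulrA mulVf ?mul1r // gt_eqF.
by apply: bddM => //; apply: bdd_exb => n; bfn.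
Qed.

Definition clip f : fn := fun x => if `|f x| <= 1 then f x else f x / `|f x|.

Lemma b1_clip f : b1 (clip f).
Proof.
move=> x; rewrite /clip; case: ifP => // h.
have f0 : f x != 0 by apply: contraFneq h => ->; rewrite normr0.
by rewrite normrM normfV normr_id divff // normr_eq0.
Qed.

(** [clip] is the nearest point projection to the unit disc, which is convex. *)
Lemma clip_contract f g x : `|g x| <= 1 ->
  re ((clip f - g) x * (cj (clip f - g)) x) <= re ((f - g) x * (cj (f - g)) x).
Proof.
move=> g1; rewrite /clip /cj !fctE; case: ifPn => // f1.
have f0 : f x != 0 by apply: contraNneq f1 => ->; rewrite normr0.
have [r rE] : exists r : R, `|f x| = r%:C%C by eexists; rewrite normc_def.
have r1 : 1 <= r.
  have : `|f x| >= 1 by move: f1; rewrite rE !lecE /= eqxx /= -ltNge => /ltW.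
  by rewrite rE lecE /= eqxx.
have rp : 0 < r by rewrite (lt_le_trans ltr01).
set u := f x / _.
have u1 : re (u * u^*) = 1.
  have : `|u| ^+ 2 = 1 by rewrite /u normrM normfV normr_id divff ?expr1n // normr_eq0.
  by rewrite normCK => ->.
have -> : f x = r%:C%C * u.
  rewrite /u rE mulrCA divff ?mulr1 //.
  by rewrite eq_complex /= eqxx andbT gt_eqF.
move: g1 u1; rewrite sq_le1 !re_sq.
case: u => a b; case: (g x) => c d /= gl ue.
have abcd : a * c + b * d <= 1.
  have := sqr_ge0 (a - c); have := sqr_ge0 (b - d); rewrite !sqrrB; lra.
rewrite -subr_ge0.
have -> : (r * a - 0 * b - c) ^+ 2 + (r * b + 0 * a - d) ^+ 2 - ((a - c) ^+ 2 + (b - d) ^+ 2)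
  = (r - 1) * ((r + 1) * (a ^+ 2 + b ^+ 2) - 2 * (a * c + b * d)) by ring.
by apply: mulr_ge0; [lra|rewrite ue; lra].
Qed.

Lemma small_lin (a : R) : (forall t, `|t| <= 1 -> 0 <= t ^+ 2 + 2 * t * a) -> a = 0.
Proof.
move=> H; apply/eqP; have [//|a0] := eqVneq a 0.
have a0' : 0 < a ^+ 2 by rewrite exprn_even_gt0.
have d0 : 0 < 1 + a ^+ 2 by rewrite addr_gt0.
have := H (- a / (1 + a ^+ 2)).
have h1 : `|- a / (1 + a ^+ 2)| <= 1.
  rewrite normrM normrN normfV (gtr0_norm d0) ler_pdivrMr // mul1r.
  have := sqr_ge0 (`|a| - 1); rewrite sqrrB real_normK ?num_real // expr1n mulr1.
  have := normr_ge0 a; lra.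
move=> /(_ h1).
have -> : (- a / (1 + a ^+ 2)) ^+ 2 + 2 * (- a / (1 + a ^+ 2)) * a =
   - (a ^+ 2 * (1 + 2 * a ^+ 2)) / (1 + a ^+ 2) ^+ 2.
  by field; rewrite gt_eqF.
rewrite ler_pdivlMr ?exprn_gt0 // mul0r oppr_ge0 leNgt.
by rewrite mulr_gt0 // addr_gt0 // mulr_gt0.
Qed.

(** Bounded sequences of functions have weak limits along means: the weak limit
is the minimiser of the mean square distance to the sequence. *)
Lemma riesz_b1 M (F : nat -> fn) : (forall n, b1 (F n)) ->
  exists2 f, b1 f & forall g, b1 g -> ex (f * g) = M (fun n => ex (F n * g)).
Proof.
move=> HF; pose L f := M (fun n => ex (F n * cj f)).
pose J f := nn f - 2 * L f.
have bL f : cb f -> bdd (fun n => ex (F n * cj f)) by move=> Hf; apply: bdd_exM; bfn.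
have LD f g : cb f -> cb g -> L (f + g) = L f + L g.
  move=> Hf Hg; rewrite /L -meanD; auto; apply: eq_mean => n.
  by rewrite cjD mulrDr exD; bfn.
have LZ c f : cb f -> L (cc c * f) = c * L f.
  move=> Hf; rewrite /L -meanZ; auto; apply: eq_mean => n.
  by rewrite cjM cj_cc mulrCA exZ; bfn.
have LB f g : cb f -> cb g -> L (f - g) = L f - L g.
  move=> Hf Hg; have -> : f - g = f + cc (-1) * g by rewrite ccN cc1 mulN1r.
  by rewrite LD ?LZ ?mulN1r; bfn.
have L2 f : cb f -> L f ^+ 2 <= nn f.
  move=> Hf; apply: le_trans (mean_sqr _ _) _; first by apply: bL.
  apply: mean_le_cst => [|n]; first by apply: bddX; apply: bL.
  by rewrite -(nn_cj _ f); apply: CS1; bfn.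
have Lb1 f : b1 f -> `|L f| <= 1 by move=> Hf; apply: mean_norm => n; apply: ex_b1; bfn.
have Jclip f : cb f -> J (clip f) <= J f.
  move=> Hf; have Hc := b1_cb (b1_clip f).
  have JE g : cb g -> J g = M (fun n => nn (g - F n)) - M (fun n => nn (F n)).
    move=> Hg; rewrite -meanB.
    - have -> : (fun n => nn (g - F n) - nn (F n)) = (fun n => nn g + (-2) * ex (F n * cj g)).
        apply/funext => n; rewrite nnB; bfn.
        rewrite -(ex_cj _ (F n * cj g)) cjM cjK [cj (F n) * g]mulrC; ring.
      rewrite meanD; [|auto|by apply: bddM; auto].
      by rewrite mean_cst meanZ ?mulNr; auto.
    - have -> : (fun n => nn (g - F n)) = (fun n => nn g + nn (F n) - 2 * ex (F n * cj g)).
        apply/funext => n; rewrite nnB; bfn.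
        by rewrite -(ex_cj _ (F n * cj g)) cjM cjK [cj (F n) * g]mulrC.
      apply: bddB; last by apply: bddM; auto.
      by apply: bddD => //; apply: bdd_exb => n; bfn.
    - by apply: bdd_exb => n; bfn.
  rewrite !JE // lerB //; apply: mean_le.
  - have [K HK] := Hc; exists (re ((K + 1) * (K + 1))) => n; apply: mean_norm => x.
    apply: re_norm; rewrite normrM; apply: ler_pM => //.
      by apply: le_trans (ler_normB _ _) _; apply: lerD => //; apply: HF.
    by rewrite norm_conjC; apply: le_trans (ler_normB _ _) _; apply: lerD => //; apply: HF.
  - have [K HK] := Hf; exists (re ((K + 1) * (K + 1))) => n; apply: mean_norm => x.
    apply: re_norm; rewrite normrM; apply: ler_pM => //.
      by apply: le_trans (ler_normB _ _) _; apply: lerD => //; apply: HF.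
    by rewrite norm_conjC; apply: le_trans (ler_normB _ _) _; apply: lerD => //; apply: HF.
  - move=> n; apply: ex_le; bfn.
    by move=> x; apply: clip_contract; apply: HF.
pose S := [set J f | f in [set f | b1 f]].
have S0 : has_inf S.
  split; first by exists (J 0), 0 => //; exact: b1_0.
  exists (-2) => _ [f /= Hf <-]; rewrite /J.
  have := nn_ge0 mu (b1_cb Hf); have := Lb1 f Hf; rewrite ler_norml => /andP[_]; lra.
have infS f : b1 f -> inf S <= J f by move=> Hf; apply: ge_inf; [case: S0|exists f].
have ch i : {f | b1 f /\ J f <= inf S + i.+1%:R^-1}.
  apply: cid; have /inf_adherent := S0 => /(_ i.+1%:R^-1).
  by rewrite invr_gt0 => /(_ (sz_gt0 R i)) [_ [f Hf <-] /ltW]; exists f.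
pose G i := sval (ch i).
have GB i : b1 (G i) by case: (svalP (ch i)).
have GJ i : J (G i) <= inf S + i.+1%:R^-1 by case: (svalP (ch i)).
have par f g : b1 f -> b1 g -> nn (f - g) <= 2 * (J f - inf S) + 2 * (J g - inf S).
  move=> Hf Hg; have Hm : b1 (cc (2^-1) * (f + g)).
    have -> : cc (2^-1) * (f + g) = avgF 1 (fun i => if i is 0%N then f else g).
      by rewrite /avgF !big_ord_recr big_ord0 /= add0r.
    by apply: b1_avgF; case.
  have := infS _ Hm; rewrite /J nnZ ?LZ ?LD; try by bfn.
  rewrite nnB ?nnD; bfn; lra.
have [||f Hf fl] := sys_complete (s := mu) (F := G) => //.
  move=> e e0; have [N HN] := inv_small 1 (divr_gt0 e0 (ltr0n _ 4)).
  exists N => i j Ni Nj; apply: le_trans (par _ _ (GB i) (GB j)) _.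
  have := GJ i; have := GJ j; have := HN _ Ni; have := HN _ Nj; rewrite !div1r.
  move: (i.+1%:R^-1) (j.+1%:R^-1) (J _) (J _) (inf S) => *; lra.
exists f => //.
have Jf : J f <= inf S.
  apply/ler_addgt0Pr => e e0; pose d := Num.min (e / 8) 1.
  have d0 : 0 < d by rewrite lt_min ltr01 divr_gt0.
  have d1 : d <= 1 by rewrite ge_min lexx orbT.
  have de : d <= e / 8 by rewrite ge_min lexx.
  have [N1 HN1] := fl _ (exprn_gt0 2 d0).
  have [N2 HN2] := inv_small 1 d0.
  pose i := maxn N1 N2.
  have := HN1 i (leq_maxl _ _); have := HN2 i (leq_maxr _ _); rewrite div1r => hi2 hi1.
  pose h := f - G i.
  have Hh : cb h by rewrite /h; bfn.
  have nh : nn h <= d ^+ 2 by rewrite /h -nnN opprB.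
  have fE : f = G i + h by rewrite /h; ring.
  clearbody h.
  have sq (a : R) : a ^+ 2 <= nn h -> `|a| <= d.
    move=> ah; rewrite -ler_sqr ?nnegrE ?normr_ge0 ?(ltW d0) // -normrX ger0_norm ?sqr_ge0 //.
    exact: le_trans ah nh.
  have := sq _ (L2 h Hh); have := sq (ex (G i * cj h)).
  rewrite -{1}(nn_cj _ h) => /(_ (CS1 _ (GB i) (cb_cj Hh))).
  rewrite !ler_norml => /andP[_ a1] /andP[a2 _].
  have dd : d ^+ 2 <= d by rewrite expr2 ler_piMr // ltW.
  have e8 : d * 8 <= e by rewrite -ler_pdivlMr.
  have ari (A B E LG Lh s q e' : R) : A - 2 * LG <= s + q -> B <= d ^+ 2 -> E <= d -> - d <= Lh ->
    q <= d -> d * 8 <= e' -> A + B + 2 * E - 2 * (LG + Lh) <= s + e'.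
    by clear -d0 dd; move: (d ^+ 2) dd d0 => d2; clearbody d => dd d0 *; lra.
  rewrite fE /J nnD ?LD; bfn.
  exact: ari (GJ i) nh a1 a2 hi2 e8.
move=> g Hg.
suff : ex (f * g) - M (fun n => ex (F n * g)) = 0 by move/eqP; rewrite subr_eq0 => /eqP.
apply: small_lin => t t1.
have cg : cb g by bfn. have cf : cb f by bfn.
have := le_trans Jf (le_trans (infS _ (b1_clip (f + cc t * cj g))) (Jclip _ _)).
have Hc : cb (f + cc t * cj g) by bfn.
move=> /(_ Hc); rewrite /J nnD ?nnZ ?LD ?LZ; try by bfn.
rewrite cjM cj_cc cjK mulrCA exZ; last by bfn.
have -> : L (cj g) = M (fun n => ex (F n * g)) by apply: eq_mean => n; rewrite cjK.
have : t ^+ 2 * nn (cj g) <= t ^+ 2 by rewrite ler_piMr ?sqr_ge0 ?nn_le1; bfn.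
lra.
Qed.

Lemma riesz M (F : nat -> fn) : (forall n, b1 (F n)) ->
  exists2 f, b1 f & forall g, cb g -> ex (f * g) = M (fun n => ex (F n * g)).
Proof.
move=> HF; have [f Hf fE] := riesz_b1 M HF; exists f => // g Hg.
have [c c0 bg] := cb_scale Hg.
have c0' : c != 0 by rewrite gt_eqF.
apply: (mulfI c0'); rewrite -exZ; last by bfn.
rewrite mulrCA fE // -meanZ; last by apply: bdd_exM.
by apply: eq_mean => n; rewrite mulrCA exZ //; bfn.
Qed.

(** ** Stationary sequences *)
Definition stat (v : nat -> fn) := (forall n, b1 (v n)) /\
  forall n n' h, ex (v (n + h)%N * cj (v (n' + h)%N)) = ex (v n * cj (v n')).

Definition nu_seq (v : nat -> fn) : R := ces R (fun k => ex (v k * cj (v 0%N))).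

Lemma ex_sym f g : ex (f * cj g) = ex (g * cj f).
Proof. by rewrite -ex_cj cjM cjK mulrC. Qed.

(** Correlations of a stationary sequence with its weak limit along one invariant
mean are computed by every other one, so that all these weak limits agree. *)
Lemma mean_ergodic (v : nat -> fn) : stat v -> exists2 rho, b1 rho &
  [/\ forall M, invm M -> forall g, cb g -> M (fun n => ex (v n * g)) = ex (rho * g),
      forall n, ex (v n * cj rho) = nn rho,
      nn rho = nu_seq v & forall K, nn rho <= nn (avgF K v)].
Proof.
move=> [vb vs].
have key M r : invm M -> b1 r -> (forall g, cb g -> ex (r * g) = M (fun n => ex (v n * g))) ->
    forall n, ex (v n * cj r) = M (fun k => ex (v k * cj (v 0%N))).
  move=> iM Hr rE n; rewrite ex_sym rE; last by bfn.
  rewrite -(@invm_add R M (fun k => ex (v k * cj (v n))) n iM); last by apply: bdd_exb => k; bfn.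
  by apply: eq_mean => k; rewrite -[X in cj (v X)]add0n vs.
have nnr M r : invm M -> b1 r -> (forall g, cb g -> ex (r * g) = M (fun n => ex (v n * g))) ->
    nn r = M (fun k => ex (v k * cj (v 0%N))).
  move=> iM Hr rE; rewrite !nnE rE; last by bfn.
  by under eq_mean => n do rewrite (key _ _ iM Hr rE); rewrite mean_cst.
have [r Hr rE] := riesz (ces R) vb.
have ic : invm (ces R) by apply: ces_inv.
exists r => //; split.
- move=> M iM g Hg; have [s Hs sE] := riesz M vb.
  rewrite -sE //; apply/esym/aeq_ex; bfn; rewrite !aeqE.
  rewrite nnB ?(nnr _ _ ic Hr rE); try by bfn.
  have e1 : ex (r * cj s) = M (fun k => ex (v k * cj (v 0%N))).
    rewrite rE; last by bfn.
    by under eq_mean => n do rewrite (key _ _ iM Hs sE); rewrite mean_cst.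
  have e2 : ex (r * cj s) = ces R (fun k => ex (v k * cj (v 0%N))).
    rewrite ex_sym sE; last by bfn.
    by under eq_mean => n do rewrite (key _ _ ic Hr rE); rewrite mean_cst.
  rewrite (nnr _ _ iM Hs sE) e2 -e1 e2; ring.
- by move=> n; rewrite (key _ _ ic Hr rE) (nnr _ _ ic Hr rE).
- exact: nnr.
- move=> K; have cK : cb (avgF K v) by bfn.
  have := nn_ge0 mu (cbB cK (b1_cb Hr)); rewrite nnB //; last by bfn.
  rewrite avgFMr ex_avgF; last by move=> i; bfn.
  under eq_mean => n do rewrite (key _ _ ic Hr rE) -(nnr _ _ ic Hr rE).
  rewrite mean_cst; lra.
Qed.

Definition ti (W : nat) f := aeq (sh W%:Z f) f.
Lemma tiE W f : ti W f = aeq (sh W%:Z f) f. Proof. by []. Qed.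
Definition nu (W : nat) f : R := nu_seq (fun n => sh (W * n)%N%:Z f).
Lemma nuE W f : nu W f = nu_seq (fun n => sh (W * n)%N%:Z f). Proof. by []. Qed.

Lemma aeq_sh l f g : cb f -> cb g -> aeq f g -> aeq (sh l f) (sh l g).
Proof.
move=> Hf Hg; rewrite !aeqE !nnE -shB cj_sh -shM sys_inv //; bfn.
Qed.

Lemma stat_sh W f : b1 f -> stat (fun n => sh (W * n)%N%:Z f).
Proof.
move=> Hf; split=> [n|n n' h]; first by bfn.
rewrite !mulnDr !PoszD [(_ + (W * h)%N%:Z)]addrC [((W * n')%N%:Z + _)]addrC -!shsh cj_sh -shM sys_inv //.
bfn.
Qed.

Lemma proj W f : b1 f -> exists2 rho, b1 rho &
  [/\ forall M, invm M -> forall g, cb g -> M (fun n => ex (sh (W * n)%N%:Z f * g)) = ex (rho * g),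
      ti W rho, nn rho = nu W f & forall K, nn rho <= nn (avgF K (fun n => sh (W * n)%N%:Z f))].
Proof.
move=> Hf; have [r Hr [r1 _ r3 r4]] := mean_ergodic (stat_sh W Hf).
exists r => //; split=> //; apply: ex_sep; bfn => g Hg.
have ic : invm (ces R) by apply: ces_inv.
rewrite -[ex (r * g)](r1 _ ic); last by bfn.
transitivity (ex (r * sh (- W%:Z) g)).
  by rewrite -[LHS](@sys_inv mu (- W%:Z)) ?shM ?shK; bfn.
rewrite -(r1 _ ic); last by bfn.
rewrite -[RHS](@invm_add R _ _ 1 ic); last by apply: bdd_exb => n; bfn.
apply: eq_mean => n; rewrite -[LHS](@sys_inv mu W%:Z); last by bfn.
by rewrite shM shNK shsh addn1 mulnS PoszD.
Qed.

Lemma nu_ge0 W f : b1 f -> 0 <= nu W f.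
Proof. by move=> Hf; have [r Hr [_ _ <- _]] := proj W Hf; apply: nn_ge0; bfn. Qed.
Lemma nu_le1 W f : b1 f -> nu W f <= 1.
Proof. by move=> Hf; have [r Hr [_ _ <- _]] := proj W Hf; apply: nn_le1. Qed.
Lemma nu_avg W f K : b1 f -> nu W f <= nn (avgF K (fun n => sh (W * n)%N%:Z f)).
Proof. by move=> Hf; have [r Hr [_ _ <- ]] := proj W Hf; apply. Qed.

Lemma nu_inv M W f u : invm M -> b1 f -> b1 u ->
  M (fun n => ex (sh (W * n)%N%:Z f * u)) ^+ 2 <= nu W f.
Proof.
move=> iM Hf Hu; have [r Hr [r1 _ <- _]] := proj W Hf.
by rewrite r1; bfn; rewrite mulrC; apply: CS1; bfn.
Qed.

Lemma ti_mul W f n : cb f -> ti W f -> aeq (sh (W * n)%N%:Z f) f.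
Proof.
move=> Hf Wf; elim: n => [|n IH]; first by rewrite muln0 sh0; bfn.
rewrite mulnS PoszD addrC -shsh.
by apply: aeq_trans (aeq_sh _ _ _ Wf) IH; bfn.
Qed.

Lemma nu_ti W f w : b1 f -> b1 w -> ti W w -> ex (f * w) ^+ 2 <= nu W f.
Proof.
move=> Hf Hw tw; apply: le_trans (nu_inv W (@ces_inv R) Hf Hw).
apply: eqW; congr (_ ^+ 2); rewrite -[LHS](mean_cst (ces R)); apply: eq_mean => n.
rewrite -[LHS](@sys_inv mu (W * n)%N%:Z) ?shM; last by bfn.
rewrite [in LHS]mulrC [in RHS]mulrC; apply: aeq_ex; bfn; apply: ti_mul; bfn.
Qed.

Lemma ti_dvd V W f : (V %| W)%N -> cb f -> ti V f -> ti W f.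
Proof. by move=> /dvdnP[k ->] Hf Vf; rewrite mulnC; apply: ti_mul. Qed.

(** The invariant functions of period [V] are among those of period [W]. *)
Lemma nu_dvd V W f : (V %| W)%N -> b1 f -> nu V f <= nu W f.
Proof.
move=> VW Hf; have [r Hr [r1 r2 r3 _]] := proj V Hf.
have [->|p] := eqVneq (nu V f) 0; first exact: nu_ge0.
have nr : ex (f * cj r) = nu V f.
  rewrite -r3 !nnE -(r1 _ (@ces_inv R)); last by bfn.
  rewrite -[LHS](mean_cst (ces R)); apply: eq_mean => n.
  rewrite -[LHS](@sys_inv mu (V * n)%N%:Z) ?shM; last by bfn.
  rewrite [in LHS]mulrC [in RHS]mulrC; apply: aeq_ex; bfn.
  by rewrite -cj_sh; apply: aeq_cj; apply: ti_mul; bfn.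
have [s Hs [s1 _ s3 _]] := proj W Hf.
have e : ex (s * cj r) = nu V f.
  rewrite -(s1 _ (@ces_inv R)); last by bfn.
  rewrite -nr -[RHS](mean_cst (ces R)); apply: eq_mean => n.
  rewrite -[RHS](@sys_inv mu (W * n)%N%:Z) ?shM; last by bfn.
  rewrite [in LHS]mulrC [in RHS]mulrC; apply/esym/aeq_ex; bfn.
  rewrite -cj_sh; apply: aeq_cj; apply: ti_mul; bfn; apply: ti_dvd VW _ r2; bfn.
have := CS mu (b1_cb Hs) (cb_cj (b1_cb Hr)); rewrite nn_cj e s3 r3 expr2.
have p0 : 0 < nu V f by rewrite lt_def p nu_ge0.
by rewrite ler_pM2r.
Qed.

(** ** van der Corput's inequality *)
Definition gam M (v : nat -> fn) (h : nat) : R := M (fun n => ex (v (n + h)%N * cj (v n))).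

Lemma gam_le1 M v h : (forall n, b1 (v n)) -> gam M v h <= 1.
Proof.
by move=> vb; apply: mean_le_cst => [|n]; [apply: bdd_exb => n|apply: ex_le1]; bfn.
Qed.

(** Averaging first over a short window that starts at [n] does not change the mean
over [n]; the Cauchy--Schwarz inequality then removes [u], and expanding the
square of the window leaves correlations. *)
Lemma vdc M v u H : invm M -> b1 u -> (forall n, b1 (v n)) ->
  M (fun n => ex (u * v n)) ^+ 2 <=
  avg R H (fun h => avg R H (fun h' => gam M v `|h - h'|)).
Proof.
move=> iM Hu vb.
have bv n m : b1 (v (n + m)%N) by [].
have -> : M (fun n => ex (u * v n)) = M (fun n => ex (u * avgF H (fun h => v (n + h)%N))).
  transitivity (avg R H (fun h => M (fun n => ex (u * v (n + h)%N)))).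
    rewrite -[LHS](mean_cst (avg R H)); apply: eq_mean => h.
    by rewrite -[LHS](invm_add h iM) //; apply: bdd_exb => n; bfn.
  rewrite -mean_avg; last by move=> h; apply: bdd_exb => n; bfn.
  by apply: eq_mean => n; rewrite avgFMl ex_avgF // => h; bfn.
apply: le_trans (mean_sqr _ _) _; first by apply: bdd_exb => n; bfn.
apply: le_trans (_ : M (fun n => nn (avgF H (fun h => v (n + h)%N))) <= _).
  apply: mean_le => [||n]; [apply: bddX; apply: bdd_exb => n; bfn|apply: bdd_exb => n; bfn|].
  by apply: CS1; bfn.
have gE h h' : M (fun n => ex (v (n + h)%N * cj (v (n + h')%N))) = gam M v `|h - h'|.
  wlog hh : h h' / (h' <= h)%N.
    move=> W; have [/W//|/ltnW/W e] := leqP h' h.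
    by rewrite distnC -e; apply: eq_mean => n; rewrite ex_sym.
  rewrite distnEl // /gam -[RHS](invm_add h' iM); last by apply: bdd_exb => n; bfn.
  by apply: eq_mean => n; rewrite -addnA subnKC.
apply: eqW.
transitivity (M (fun n => avg R H (fun h => avg R H (fun h' => ex (v (n + h)%N * cj (v (n + h')%N)))))).
  by apply: eq_mean => n; rewrite nn_avgF // => h; bfn.
rewrite mean_avg; last first.
  by move=> h; apply: bdd_avg => h'; apply: bdd_exb => n; bfn.
apply: eq_mean => h; rewrite mean_avg; last by move=> h'; apply: bdd_exb => n; bfn.
by apply: eq_mean => h'.
Qed.

(** In a long window the exceptional differences form a small proportion. *)
Lemma vdc_pick (e : R) K : 0 < e -> exists H, forall M u v (bad : seq nat),
  invm M -> b1 u -> (forall n, b1 (v n)) -> (size bad <= K)%N ->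
  e <= M (fun n => ex (u * v n)) ->
  exists h, [/\ (h <= H)%N, h \notin bad & e ^+ 2 / 2 <= gam M v h].
Proof.
move=> e0; have e2 : 0 < e ^+ 2 / 8 by rewrite divr_gt0 // exprn_gt0.
have [H HH] := inv_small K%:R e2; exists H => M u v bad iM Hu vb sb eM.
apply: contrapT => no.
have gl h : (h <= H)%N -> h \notin bad -> gam M v h <= e ^+ 2 / 2.
  by move=> hH hb; rewrite leNgt; apply/negP => /ltW ?; apply: no; exists h.
have : e ^+ 2 <= avg R H (fun h => avg R H (fun h' => gam M v `|h - h'|)).
  by apply: le_trans (vdc H iM Hu vb); rewrite lerXn2r ?nnegrE ?(le_trans _ eM) // ltW.
apply/negP; rewrite -ltNge.
pose a h : R := (h \in bad)%:R.
apply: le_lt_trans (_ : avg R H (fun h => avg R H (fun h' => a `|h - h'|%N + e ^+ 2 / 2)) < _).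
  apply: avg_le => h hH; apply: avg_le => h' hH'; rewrite /a.
  have [_|nb] := boolP (_ \in bad); last by rewrite add0r gl //; lia.
  by apply: le_trans (gam_le1 _ _ vb) _; rewrite lerDl divr_ge0 ?sqr_ge0.
under eq_mean => h do rewrite avgD mean_cst.
rewrite avgD mean_cst.
have : avg R H (fun h => avg R H (fun h' => a `|h - h'|%N)) <= 2 * avg R H a.
  by apply: avg_fejer => n; rewrite /a ler0n.
have : avg R H a <= K%:R / H.+1%:R.
  rewrite avgE ler_pM2r ?invr_gt0 // -natr_sum ler_nat.
  apply: leq_trans _ sb.
  have -> : (\sum_(i < H.+1) (nat_of_ord i \in bad) = size [seq i <- iota 0 H.+1 | i \in bad])%N.
    rewrite size_filter -sum1_count [RHS]big_mkcond -(big_mkord xpredT (fun i => nat_of_bool (i \in bad))).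
    rewrite /index_iota subn0.
  by apply: eq_bigr => i _; case: (i \in bad).
  by apply: uniq_leq_size => [|i]; [apply/filter_uniq/iota_uniq|rewrite mem_filter => /andP[]].
have := HH H (leqnn _).
by move: (e ^+ 2) e2 (avg _ _ _) (K%:R / _) (avg _ _ _) => x e2 p q r *; lra.
Qed.

End Sys.
#[global] Hint Resolve bdd_exb : bfn.

(** * Uniformity seminorms *)

Section Norms.
Variables (R : realType) (mu : sys R).
Local Notation C := R[i].
Local Notation fn := (fn R).
Local Notation ex := (ex mu).
Local Notation nn := (nn mu).
Local Notation aeq := (aeq mu).
Local Notation nu := (nu mu).
Local Notation ces := (ces R).
Implicit Types (f g u : fn) (M : mean R nat).

Definition D (h : int) f : fn := f * sh h (cj f).

Lemma b1_D h f : b1 f -> b1 (D h f). Proof. by rewrite /D => Hf; bfn. Qed.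
Hint Resolve b1_D : bfn.
Lemma eq_sh k l f : k = l -> sh k f = sh l f. Proof. by move->. Qed.
Lemma D_sh h l f : D h (sh l f) = sh l (D h f).
Proof. by rewrite /D shM cj_sh !shsh addrC. Qed.
Lemma D_cj h f : D h (cj f) = cj (D h f).
Proof. by rewrite /D cjM cj_sh. Qed.
Lemma DM h f g : D h (f * g) = D h f * D h g.
Proof. by rewrite /D cjM shM; ring. Qed.
Lemma D_opp h f : D (- h) f = sh (- h) (cj (D h f)).
Proof. by rewrite /D cjM cj_sh shM shK cjK mulrC. Qed.
Lemma DD h k f : D h (D k f) = D k (D h f).
Proof. by rewrite /D !cjM !cj_sh !cjK !shM !shsh [k + h]addrC; ring. Qed.

Lemma nu_sh W l f : b1 f -> nu W (sh l f) = nu W f.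
Proof.
move=> Hf; apply: eq_mean => k.
rewrite !shsh !(addrC _ l) -[LHS](@sys_inv _ mu (- l)); last by bfn.
by rewrite shM -!shsh cj_sh !shK cj_sh.
Qed.

Lemma nu_cj W f : b1 f -> nu W (cj f) = nu W f.
Proof. by move=> Hf; apply: eq_mean => k; rewrite -[LHS]ex_cj cjM -!cj_sh !cjK. Qed.

(** The power [2 ^ s.+1] of the Gowers--Host--Kra seminorm of order [s.+1]. *)
Fixpoint N (s : nat) f : R :=
  if s is s'.+1 then ces (fun h => N s' (D h%:Z f)) else nu 1 f.

Lemma N_01 s f : b1 f -> 0 <= N s f <= 1.
Proof.
elim: s f => [|s IH] f Hf /=; first by rewrite nu_ge0 ?nu_le1.
have b : bdd (fun h : nat => N s (D h%:Z f)).
  by exists 1 => h; have /andP[a b] := IH (D h%:Z f) (b1_D _ Hf); rewrite ger0_norm.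
by rewrite mean_ge0 ?mean_le_cst // => h; have /andP[] := IH (D h%:Z f) (b1_D _ Hf).
Qed.
Lemma N_ge0 s f : b1 f -> 0 <= N s f.
Proof. by move=> /(N_01 s)/andP[]. Qed.
Lemma N_le1 s f : b1 f -> N s f <= 1.
Proof. by move=> /(N_01 s)/andP[]. Qed.
Lemma bdd_N s (Y : Type) (F : Y -> fn) : (forall y, b1 (F y)) -> bdd (fun y => N s (F y)).
Proof. by move=> HF; exists 1 => y; have /andP[a b] := N_01 s (HF y); rewrite ger0_norm. Qed.
Hint Resolve bdd_N : bfn.
Lemma bdd_nu W (Y : Type) (F : Y -> fn) : (forall y, b1 (F y)) -> bdd (fun y => nu W (F y)).
Proof. by move=> HF; exists 1 => y; rewrite ger0_norm ?nu_ge0 ?nu_le1. Qed.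
Hint Resolve bdd_nu : bfn.

Lemma N_sh s l f : b1 f -> N s (sh l f) = N s f.
Proof.
elim: s f => [|s IH] f Hf /=; first exact: nu_sh.
by apply: eq_mean => h; rewrite D_sh IH //; bfn.
Qed.
Lemma N_cj s f : b1 f -> N s (cj f) = N s f.
Proof.
elim: s f => [|s IH] f Hf /=; first exact: nu_cj.
by apply: eq_mean => h; rewrite D_cj IH //; bfn.
Qed.
Lemma N_abs s h f : b1 f -> N s (D h f) = N s (D `|h|%N%:Z f).
Proof.
move=> Hf; case: h => n //; rewrite NegzE D_opp N_sh ?N_cj //; bfn.
Qed.

Lemma ti1 W : ti mu W 1. Proof. exact: aeq_refl. Qed.

Lemma ex_nu W f : b1 f -> ex f ^+ 2 <= nu W f.
Proof. by move=> Hf; rewrite -[X in ex X]mulr1; apply: nu_ti; bfn; apply: ti1. Qed.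

Lemma N_mono s f : b1 f -> N s f ^+ 2 <= N s.+1 f.
Proof.
elim: s f => [|s IH] f Hf.
  rewrite [N 0 f]/= {1}nuE /nu_seq; apply: le_trans (mean_sqr _ _) _.
    by apply: bdd_exb => n; bfn.
  rewrite /=; apply: mean_le; [by apply: bddX; apply: bdd_exb => n; bfn|by apply: bdd_nu => n; bfn|].
  move=> n; apply: le_trans (ex_nu 1 (b1_D n%:Z Hf)).
  by rewrite mul1n sh0 -[X in X ^+ 2 <= _]ex_cj cjM cjK mulrC cj_sh.
rewrite [N s.+2 f]/=; apply: le_trans (mean_sqr _ _) _; first by apply: bdd_N => n; bfn.
apply: mean_le; [by apply: bddX; apply: bdd_N => n; bfn|by apply: (bdd_N s.+1) => n; bfn|].
by move=> n; apply: IH; bfn.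
Qed.

Lemma N_le_mono s k f : b1 f -> N s f ^+ (2 ^ k) <= N (s + k) f.
Proof.
move=> Hf; elim: k => [|k IH]; first by rewrite addn0.
rewrite expnSr exprM addnS; apply: le_trans (N_mono _ Hf).
by rewrite lerXn2r // nnegrE ?exprn_ge0 ?N_ge0.
Qed.

Lemma avg_dil (b : nat -> R) W H : (forall l, 0 <= b l) ->
  avg R (H %/ W.+1) (fun i => b (W.+1 * i)%N) <= W.+1%:R * avg R H b.
Proof.
move=> b0; set L := (H %/ W.+1)%N; rewrite !avgE ler_pdivrMr //.
have s0 : 0 <= \sum_(i < H.+1) b i by apply: sumr_ge0.
apply: le_trans (_ : \sum_(i < H.+1) b i <= _); last first.
  move: (\sum_(i < H.+1) b i) s0 => S s0.
  have -> : W.+1%:R * (S / H.+1%:R) * L.+1%:R = S * ((W.+1 * L.+1)%:R / H.+1%:R) by rewrite natrM; ring.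
  by rewrite ler_peMr // ler_pdivlMr // mul1r ler_nat mulnC; exact: ltn_ceil.
have HL : (forall i : 'I_L.+1, W.+1 * i < H.+1)%N.
  move=> i; rewrite ltnS mulnC; apply: leq_trans (leq_trunc_div H W.+1).
  by rewrite leq_mul2r -ltnS ltn_ord orbT.
have -> : \sum_(i < L.+1) b (W.+1 * i)%N = \sum_(j in [set Ordinal (HL i) | i : 'I_L.+1]%SET) b j.
  rewrite big_imset //= => i j _ _ /(congr1 val) /= /eqP; rewrite eqn_mul2l /= => /eqP ij.
  exact/val_inj.
by rewrite [leRHS](bigID (mem [set Ordinal (HL i) | i : 'I_L.+1]%SET)) /= lerDl sumr_ge0.
Qed.

Lemma ces_dil (b : nat -> R) W c : bdd b -> (forall l, 0 <= b l) ->
  (forall H, c <= avg R H (fun i => b (W.+1 * i)%N)) -> c <= W.+1%:R * ces b.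
Proof.
move=> bb b0 cH; rewrite cesE -meanZ; last exact: bdd_avgH.
apply: mean_ge_cst => [|H]; first by apply: bddM => //; apply: bdd_avgH.
exact: le_trans (cH _) (avg_dil W H b0).
Qed.

(** Dominate [nu] by finite averages of the shifts of [D h g]; the average over
[h] of their correlations at distance [W.+1 * i] is, after exchanging the roles of
the two differences, the invariant correlation of [D (W.+1 * i) g]. Those with index
a multiple of [W.+1] form a proportion [1 / W.+1] of all of them. *)
Lemma ces_nu W g : b1 g -> ces (fun h => nu W.+1 (D h%:Z g)) / 2 <= W.+1%:R * N 1 g.
Proof.
move=> Hg; apply: ces_dil => [|l|L]; [by apply: bdd_nu => h; bfn|by apply: nu_ge0; bfn|].
pose a i := nu 1 (D (W.+1 * i)%N%:Z g).
rewrite ler_pdivrMr // mulrC; apply: le_trans (avg_fejer _ (a := a) _); last by move=> n; apply: nu_ge0; bfn.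
pose v (h i : nat) := sh (W.+1 * i)%N%:Z (D h%:Z g).
apply: le_trans (_ : ces (fun h => avg R L (fun i => avg R L (fun j => ex (v h i * cj (v h j))))) <= _).
  apply: mean_le; [by apply: bdd_nu => h; bfn|by apply: bdd_avg => i; apply: bdd_avg => j; apply: bdd_exb => h; rewrite /v; bfn|].
  move=> h; rewrite -nn_avgF; last by move=> i; rewrite /v; bfn.
  by apply: nu_avg; bfn.
rewrite mean_avg; last by move=> i; apply: bdd_avg => j; apply: bdd_exb => h; rewrite /v; bfn.
apply: avg_le => i _; rewrite mean_avg; last by move=> j; apply: bdd_exb => h; rewrite /v; bfn.
apply: avg_le => j _; rewrite /a.
have bv (k l : nat) : b1 (sh (W.+1 * k)%N%:Z g * cj (sh (W.+1 * l)%N%:Z g)) by bfn.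
have e1 : ces (fun h => ex (v h i * cj (v h j))) = nu 1 (sh (W.+1 * i)%N%:Z g * cj (sh (W.+1 * j)%N%:Z g)).
  rewrite -nu_cj //; apply: eq_mean => h; congr ex.
  rewrite mul1n muln0 sh0 cjK /v /D ?(shM, cjM, cj_sh, cjK, shsh).
  rewrite [h%:Z + _]addrC [h%:Z + (W.+1 * j)%N%:Z]addrC; ring.
rewrite e1 {e1}.
wlog ij : i j / (j <= i)%N.
  move=> H; have [/H//|/ltnW/H] := leqP j i; rewrite distnC => h.
  by rewrite -nu_cj // cjM cjK mulrC.
rewrite distnEl //.
have -> : sh (W.+1 * i)%N%:Z g * cj (sh (W.+1 * j)%N%:Z g) =
   sh (W.+1 * j)%N%:Z (cj (D (W.+1 * (i - j))%N%:Z g)).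
  by rewrite /D ?(shM, cjM, cj_sh, cjK, shsh) -PoszD -mulnDr subnKC // mulrC.
by rewrite nu_sh ?nu_cj //; bfn.
Qed.

(** ** Linear averages *)
(** The order of the seminorm and the bound may depend on all that [Q] fixes, but not
on the means and functions over which [Q] quantifies. *)
Definition detect (Q : fn -> Prop) :=
  exists s, exists2 d : R, 0 < d & forall f, b1 f -> Q f -> d <= N s f.

Lemma detect_imp (Q Q' : fn -> Prop) : (forall f, b1 f -> Q f -> Q' f) -> detect Q' -> detect Q.
Proof. by move=> QQ [s [d d0 H]]; exists s, d => // f Hf Qf; apply: H => //; apply: QQ. Qed.

Lemma detect_or (Q Q' : fn -> Prop) : detect Q -> detect Q' -> detect (fun f => Q f \/ Q' f).
Proof.
move=> [s [d d0 H]] [s' [d' d0' H']]; exists (s + s')%N.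
exists (Num.min (d ^+ (2 ^ s')) (d' ^+ (2 ^ s))); first by rewrite lt_min !exprn_gt0.
move=> f Hf [/(H f Hf)|/(H' f Hf)] h; rewrite ge_min; apply/orP; [left|right; rewrite addnC].
  by apply: le_trans (N_le_mono _ _ Hf); apply: lerXn2r; rewrite ?nnegrE ?N_ge0 ?(ltW d0) ?(ltW d0').
by apply: le_trans (N_le_mono _ _ Hf); apply: lerXn2r; rewrite ?nnegrE ?N_ge0 ?(ltW d0) ?(ltW d0').
Qed.

Lemma detect_fin (Q : nat -> fn -> Prop) (G : nat -> Prop) H :
  (forall h, G h -> detect (Q h)) -> detect (fun f => exists h, [/\ (h <= H)%N, G h & Q h f]).
Proof.
move=> HQ; have dG h : detect (fun f => G h /\ Q h f).
  have [g|ng] := pselect (G h); first by apply: detect_imp (HQ _ g) => f _ [].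
  by exists 0%N, 1 => // f _ [].
elim: H => [|H IH].
  by apply: detect_imp (dG 0%N) => f _ [h []]; rewrite leqn0 => /eqP ->.
apply: detect_imp (detect_or IH (dG H.+1)) => f _ [h []].
rewrite leq_eqVlt => /orP[/eqP->|hH] g q; [by right|left].
by exists h; split.
Qed.

Definition lprod (L : seq (int * fn)) (n : nat) : fn :=
  \prod_(a <- L) sh (a.1 * n%:Z) a.2.

Definition all_b1 (T : Type) (L : seq (T * fn)) := forall a, List.In a L -> b1 a.2.

Lemma all_b1_cons (T : Type) (a : T * fn) L : all_b1 (a :: L) <-> b1 a.2 /\ all_b1 L.
Proof.
split=> [H|[H1 H2] b [<-//|]]; last exact: H2.
by split=> [|b Lb]; apply: H; [left|right].
Qed.

Lemma b1_prodL (T : Type) (L : seq (T * fn)) (F : T -> int) :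
  all_b1 L -> b1 (\prod_(a <- L) sh (F a.1) a.2).
Proof.
elim: L => [|a L IH]; first by rewrite big_nil; bfn.
by move=> /all_b1_cons[a1 /IH b]; rewrite big_cons; bfn.
Qed.

(** If every difference with a large correlation is detected by the seminorm of
order [s], van der Corput's inequality says that [N s (D (c * h) f)] is large
for many [h], hence the seminorm of the next order is not small. *)
Lemma step_linear (e : R) (c : int) (Q : nat -> fn -> Prop) : 0 < e -> c != 0 ->
  detect (fun f => exists2 h : nat, True & Q h f) ->
  detect (fun f => exists M v u, [/\ invm M, b1 u, forall n, b1 (v n), e <= M (fun n => ex (u * v n)) &
     forall h, e ^+ 2 / 2 <= gam mu M v h -> Q h (D (c * h%:Z) f)]).
Proof.
move=> e0 c0 [s [d d0 H]]; exists s.+1.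
have e2 : 0 < e ^+ 2 by rewrite exprn_gt0.
have cc : (`|c|%N.-1.+1 = `|c|)%N by rewrite prednK // absz_gt0.
exists (d * e ^+ 2 / 4 / `|c|%N%:R).
  by rewrite !divr_gt0 ?mulr_gt0 // ltr0n absz_gt0.
move=> f Hf [M [v [u [iM Hu vb eM Hh]]]].
rewrite ler_pdivrMr ?ltr0n ?absz_gt0 // [leRHS]mulrC -cc [N _ _]/=.
apply: ces_dil => [|l|K]; [by apply: bdd_N => h; bfn|by apply: N_ge0; bfn|].
pose a i := N s (D (`|c|%N.-1.+1 * i)%N%:Z f).
have a0 i : 0 <= a i by apply: N_ge0; bfn.
suff : d * e ^+ 2 / 2 <= avg R K (fun h => avg R K (fun h' => a `|h - h'|%N)).
  by have := avg_fejer K a0; rewrite -/a; move: (avg _ _ _) (avg _ _ _) (d * e ^+ 2) => x y z *; lra.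
have : e ^+ 2 <= avg R K (fun h => avg R K (fun h' => gam mu M v `|h - h'|)).
  by apply: le_trans (vdc mu K iM Hu vb); rewrite lerXn2r ?nnegrE ?(le_trans _ eM) // ltW.
have key i : d * gam mu M v i + (- (d * e ^+ 2 / 2)) <= a i.
  have [ge|lt] := leP (e ^+ 2 / 2) (gam mu M v i).
    have : d <= a i.
      rewrite /a cc; have -> : (`|c|%N * i)%N%:Z = (absz (c * i%:Z)%R)%:Z by rewrite abszM.
      by rewrite -N_abs //; apply: H; [bfn|exists i => //; apply: Hh].
    have := gam_le1 mu M i vb; move: (gam _ _ _ _) ge => g ge g1 da.
    have : d * g <= d by rewrite ler_piMr // ltW.
    have : 0 < d * e ^+ 2 by rewrite mulr_gt0.
    lra.
  apply: le_trans (a0 i).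
  rewrite subr_le0 -mulrA ler_pM2l // ltW //.
have : avg R K (fun h => avg R K (fun h' => d * gam mu M v `|h - h'| + (- (d * e ^+ 2 / 2)))) <=
    avg R K (fun h => avg R K (fun h' => a `|h - h'|%N)).
  by apply: avg_le => h _; apply: avg_le => h' _.
under [X in X <= _ -> _]eq_mean => h do rewrite avgD mean_cst avgZ.
rewrite avgD mean_cst avgZ; move: (avg _ _ _) (avg _ _ _) => x y xy xe.
have : d * e ^+ 2 <= d * y by rewrite ler_pM2l.
by move: xy; clear; lra.
Qed.

Definition lin_av (e : R) (cs : seq int) (c : int) f :=
  exists M u L, [/\ invm M, b1 u, all_b1 L, map fst L = cs &
    e <= M (fun n => ex (u * (lprod L n * sh (c * n%:Z) f)))].

(** Induction on the number of other coefficients: translating by one of them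
makes it disappear in a van der Corput step. *)
Lemma lin cs c (e : R) : 0 < e -> c != 0 -> c \notin cs -> detect (lin_av e cs c).
Proof.
have [n] := ubnP (size cs); elim: n cs c e => // n IH cs c e sz e0 c0 cN.
have e2 : 0 < e ^+ 2 / 2 by rewrite divr_gt0 // exprn_gt0.
case: cs sz cN => [|c1 cs] sz cN.
  pose Q (h : nat) f := e ^+ 2 / 2 <= ex f.
  have dQ : detect (fun f => exists2 h : nat, True & Q h f).
    exists 0%N, ((e ^+ 2 / 2) ^+ 2) => [|f Hf [h0 _ Qf]]; first by rewrite exprn_gt0.
    apply: le_trans (ex_nu 1 Hf); rewrite lerXn2r ?nnegrE ?(le_trans _ Qf) // ltW //.
  apply: detect_imp (step_linear e0 c0 dQ) => f Hf [M [u [L [iM Hu _ /eqP]]]].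
  rewrite -size_eq0 size_map size_eq0 => /eqP -> eM.
  exists M, (fun n => sh (c * n%:Z) f), u; split; bfn.
    by apply: le_trans eM _; apply: eqW; apply: eq_mean => k; rewrite /lprod big_nil mul1r.
  move=> h; rewrite /Q /gam => /le_trans; apply; apply: eqW.
  rewrite -[RHS](mean_cst M); apply: eq_mean => k.
  rewrite PoszD mulrDr -shsh cj_sh -shM sys_inv; last by bfn.
  by rewrite -ex_cj cjM cjK mulrC cj_sh /D.
have cc1 : c - c1 != 0 by rewrite subr_eq0; apply: contraNneq cN => ->; rewrite mem_head.
pose cs' := [seq x - c1 | x <- cs].
have cN' : c - c1 \notin cs'.
  apply/mapP => -[x xcs /(addIr _) cx]; move: cN; rewrite cx inE xcs orbT.
  by [].
have sz' : (size cs' < n)%N by rewrite size_map.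
pose Q (h : nat) f := lin_av (e ^+ 2 / 2) cs' (c - c1) (cj f).
have dQ : detect (fun f => exists2 h : nat, True & Q h f).
  have [s [d d0 H]] := IH cs' (c - c1) _ sz' e2 cc1 cN'.
  by exists s, d => // f Hf [h0 _ Qf]; rewrite -N_cj //; apply: H => //; bfn.
apply: detect_imp (step_linear e0 c0 dQ) => f Hf [M [u [L [iM Hu Lb Lc eM]]]].
case: L Lb Lc eM => // -[c1' g1] L /all_b1_cons[/= g1b Lb] [-> Lc] eM.
exists M, (fun n => lprod ((c1, g1) :: L) n * sh (c * n%:Z) f), u; split=> //.
  move=> k; apply: b1M; bfn; apply: (@b1_prodL _ ((c1, g1) :: L) (fun c => c * k%:Z)).
  by apply/all_b1_cons.
move=> h gh; exists M, (sh (c1 * h%:Z) g1 * cj g1).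
exists [seq (a.1 - c1, sh (a.1 * h%:Z) a.2 * cj a.2) | a <- L]; split=> //; bfn.
- elim: L Lb {Lc eM gh} => // a L IHL /all_b1_cons[ab /IHL Lb].
  by rewrite map_cons; apply/all_b1_cons; split => //=; bfn.
- by rewrite /cs' -Lc -!map_comp; apply: eq_map.
apply: le_trans gh _; apply: eqW; apply: eq_mean => k.
rewrite -[LHS](@sys_inv _ mu (- (c1 * k%:Z))); last first.
  have Lk m : cb (lprod ((c1, g1) :: L) m).
    apply/b1_cb/(@b1_prodL _ ((c1, g1) :: L) (fun c => c * m%:Z)).
    by apply/all_b1_cons.
  by bfn.
congr ex; rewrite /lprod !big_cons /= !cjM !shM !cj_sh !shsh.
have -> : - (c1 * k%:Z) + c1 * (k + h)%N%:Z = c1 * h%:Z by rewrite PoszD; ring.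
rewrite addNr sh0.
have -> : - (c1 * k%:Z) + c * (k + h)%N%:Z = (c - c1) * k%:Z + c * h%:Z by rewrite PoszD; ring.
have -> : - (c1 * k%:Z) + c * k%:Z = (c - c1) * k%:Z by ring.
rewrite big_map /D.
have -> : \prod_(a <- L) sh ((a.1 - c1) * k%:Z) (sh (a.1 * h%:Z) a.2 * cj a.2) =
   sh (- (c1 * k%:Z)) (\prod_(a <- L) sh (a.1 * (k + h)%N%:Z) a.2) *
   sh (- (c1 * k%:Z)) (cj (\prod_(a <- L) sh (a.1 * k%:Z) a.2)).
  rewrite cj_prod !sh_prod -big_split /=; apply: eq_bigr => a _.
  rewrite cj_sh shM !shsh; congr (_ * _); apply: eq_sh; rewrite ?PoszD; ring.
rewrite cjK; ring.
Qed.

End Norms.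
#[global] Hint Resolve b1_D bdd_N bdd_nu : bfn.

(** * Polynomial averages are controlled by uniformity seminorms *)

Section Poly.
Variable R : realType.
Implicit Types p q t : {poly R}.

Definition ipoly p := forall m : int, p.[m%:~R] \is a Num.int.
Definition ev p (n : nat) : int := Num.floor p.[n%:R].
Definition tr (h : nat) p := p \Po ('X + h%:R%:P).

Lemma ev_inj p n : ipoly p -> (ev p n)%:~R = p.[n%:R].
Proof. by move=> ip; apply/floorK/(ip n%:Z). Qed.
Lemma ev_eq p n (z : int) : p.[n%:R] = z%:~R -> ev p n = z.
Proof. by rewrite /ev => ->; rewrite intrKfloor. Qed.
Lemma ipolyB p q : ipoly p -> ipoly q -> ipoly (p - q).
Proof. by move=> ip iq m; rewrite !hornerE rpredB ?ip ?iq. Qed.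
Lemma ipolyN p : ipoly p -> ipoly (- p).
Proof. by move=> ip m; rewrite !hornerE rpredN ip. Qed.
Lemma ipoly_tr h p : ipoly p -> ipoly (tr h p).
Proof. by move=> ip m; rewrite /tr horner_comp !hornerE; have := ip (m + h%:Z); rewrite rmorphD. Qed.
Lemma evB p q n : ipoly p -> ipoly q -> ev (p - q) n = ev p n - ev q n.
Proof. by move=> ip iq; apply: ev_eq; rewrite !hornerE rmorphB /= !ev_inj. Qed.
Lemma evN p n : ipoly p -> ev (- p) n = - ev p n.
Proof. by move=> ip; apply: ev_eq; rewrite !hornerE rmorphN /= ev_inj. Qed.
Lemma ev_tr h p n : ev (tr h p) n = ev p (n + h).
Proof. by rewrite /ev /tr horner_comp !hornerE natrD. Qed.
Lemma ev_const p n : (size p <= 1)%N -> ev p n = ev p 0.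
Proof. by move=> /size1_polyC ->; rewrite /ev !hornerC. Qed.
Lemma ev_linear p n : ipoly p -> (size p <= 2)%N -> ev p n = (ev p 1 - ev p 0) * n%:Z + ev p 0.
Proof.
move=> ip sp; apply: ev_eq; rewrite rmorphD rmorphM rmorphB /= !ev_inj //.
have h x : p.[x] = p`_0 + p`_1 * x.
  rewrite (@horner_coef_wide _ 2) // !big_ord_recr big_ord0 /= expr0 mulr1 add0r.
  by rewrite expr1.
rewrite !h; ring.
Qed.

Lemma coef_exp_XaddC (c : R) n j : (('X + c%:P) ^+ n)`_j = c ^+ (n - j) *+ 'C(n, j).
Proof.
rewrite addrC exprDn coef_sum; under eq_bigr => i _ do rewrite coefMn -polyC_exp coefCM coefXn.
have [jn|nj] := leqP j n; last first.
  rewrite bin_small // mulr0n big1 // => i _.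
  by rewrite gtn_eqF ?mulr0 ?mul0rn // (leq_trans _ nj) // ltn_ord.
have jn' : (j < n.+1)%N by [].
rewrite (bigD1 (Ordinal jn')) //= eqxx mulr1 big1 ?addr0 // => i /eqP ij.
rewrite (negbTE (_ : j != i)) ?mulr0 ?mul0rn //; apply/eqP => e; apply: ij; exact/val_inj.
Qed.

Lemma coef_tr h p j : (tr h p)`_j = \sum_(i < size p) p`_i * (h%:R ^+ (i - j) *+ 'C(i, j)).
Proof.
rewrite /tr comp_polyE coef_sum; apply: eq_bigr => i _.
by rewrite coefZ coef_exp_XaddC.
Qed.

Lemma coef_tr_wide h p m j : (size p <= m)%N ->
  (tr h p)`_j = \sum_(i < m) p`_i * (h%:R ^+ (i - j) *+ 'C(i, j)).
Proof.
move=> sp; rewrite coef_tr (big_ord_widen m (fun i => p`_i * (h%:R ^+ (i - j) *+ 'C(i, j))) sp).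
rewrite big_mkcond; apply: eq_bigr => i _; case: ifPn => //; rewrite -leqNgt => /leq_sizeP/(_ _ (leqnn _)) ->.
by rewrite mul0r.
Qed.

Lemma coef_tr_top h p d : (size p <= d.+1)%N -> (tr h p)`_d = p`_d.
Proof.
move=> sp; rewrite (coef_tr_wide _ _ sp) big_ord_recr /= subnn binn expr0 mulr1.
rewrite big1 ?add0r // => i _; by rewrite bin_small ?mulr0n ?mulr0.
Qed.

Lemma coef_tr_sub h p d : (size p <= d.+2)%N -> (tr h p)`_d = p`_d + p`_d.+1 * (h%:R *+ d.+1).
Proof.
move=> sp; rewrite (coef_tr_wide _ _ sp) !big_ord_recr /= subnn binn expr0 mulr1 subSnn expr1.
rewrite binSn big1 ?add0r // => i _; by rewrite bin_small ?mulr0n ?mulr0.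
Qed.

Lemma size_tr h p : size (tr h p) = size p.
Proof. by rewrite /tr size_comp_poly2 // size_XaddC. Qed.
Lemma lead_tr h p : lead_coef (tr h p) = lead_coef p.
Proof.
rewrite /lead_coef size_tr; case E: (size p) => [|d]; last by rewrite coef_tr_top ?E.
have /eqP := E; rewrite size_poly_eq0 => /eqP ->.
by rewrite /tr comp_poly0.
Qed.
Lemma trB h p q : tr h (p - q) = tr h p - tr h q.
Proof. exact: comp_polyB. Qed.

Lemma size_cancel p q : (1 < size p)%N -> size p = size q -> lead_coef p = lead_coef q ->
  (size (p - q)%R < size p)%N.
Proof.
move=> sp spq lpq; rewrite -[X in (_ < X)%N](ltn_predK sp) ltnS.
apply/leq_sizeP => j; rewrite leq_eqVlt => /orP[/eqP<-|jl].
  by rewrite coefB; move: lpq; rewrite /lead_coef -spq => ->; rewrite subrr.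
have h : (size p <= j)%N by move: jl; rewrite (ltn_predK sp).
by rewrite coefB !nth_default ?subrr // -spq.
Qed.

Definition nc p := (1 < size p)%N.

(** The coefficient below the leading one moves with the translation. *)
Lemma bad_uniq t p h1 h2 : (2 < size t)%N ->
  ~~ nc (tr h1 t - p) -> ~~ nc (tr h2 t - p) -> h1 = h2.
Proof.
rewrite /nc -!leqNgt => st s1 s2.
have s12 : (size (tr h1 t - tr h2 t)%R <= 1)%N.
  have -> : tr h1 t - tr h2 t = (tr h1 t - p) - (tr h2 t - p) by rewrite opprB addrA subrK.
  by apply: leq_trans (size_polyD _ _) _; rewrite size_polyN geq_max s1 s2.
case E: (size t) st => [|[|[|d]]] // _.
have := leq_sizeP _ _ s12 d.+1 isT.
rewrite coefB !coef_tr_sub ?E // opprD addrACA subrr add0r -mulrBr => /eqP.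
rewrite mulf_eq0 -mulrnBl mulrn_eq0 /= subr_eq0 eqr_nat => /orP[|/eqP//].
have := lead_coef_eq0 t; rewrite /lead_coef E /= => ->.
by rewrite -size_poly_eq0 E.
Qed.

Definition bad_shift t p : nat := xget 0%N [set h | ~~ nc (tr h t - p)].

Lemma bad_shiftP t p h : (2 < size t)%N -> h != bad_shift t p -> nc (tr h t - p).
Proof.
move=> st hb; apply: contraT => nb.
have : [set h | ~~ nc (tr h t - p)] (bad_shift t p) by apply: (xgetI 0%N nb).
by move=> /= nb'; move: hb; rewrite (bad_uniq st nb nb') eqxx.
Qed.

(** The complexity of a family: how many leading coefficients occur in each
positive degree. *)
Definition cls (F : seq {poly R}) (e : nat) : seq R :=
  undup [seq lead_coef q | q <- F & size q == e.+2].

Lemma cls_mem (F : seq {poly R}) e c : reflect (exists2 q, q \in F & size q = e.+2 /\ lead_coef q = c) (c \in cls F e).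
Proof.
rewrite mem_undup; apply: (iffP mapP) => [[q]|[q qF [sq lq]]].
  by rewrite mem_filter => /andP[/eqP sq qF] ->; exists q.
by exists q; rewrite ?mem_filter ?sq ?eqxx.
Qed.

Definition wt (F : seq {poly R}) (e : nat) : nat := size (cls F e).

(** Induction along the order in which the value at the largest changed index
decreases. *)
Lemma lex_ind (T : Type) (w : T -> nat -> nat) (D : nat) (P : T -> Prop) :
  (forall x, (forall y, (exists e, [/\ (e < D)%N, (w y e < w x e)%N &
     forall e', (e < e')%N -> (w y e' <= w x e')%N]) -> P y) -> P x) ->
  forall x, P x.
Proof.
elim: D P => [|D IH] P HP x; first by apply: HP => y [e []].
have [n] := ubnP (w x D); elim: n x => // n IHn x wx.
apply: (IH (fun x => (w x D < n.+1)%N -> P x)) wx => {}x Hx wx.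
apply: HP => y [e [eD ye yle]].
move: eD; rewrite ltnS leq_eqVlt => /orP[/eqP eD|eD].
  by apply: IHn; move: ye wx; rewrite eD; lia.
apply: Hx; last by have := yle D eD; lia.
by exists e; split.
Qed.

End Poly.

Section PET.
Variables (R : realType) (mu : sys R).
Local Notation fn := (fn R).
Local Notation ex := (ex mu).
Local Notation N := (N mu).
Local Notation detect := (detect mu).
Implicit Types (f g u : fn) (M : mean R nat) (p q t : {poly R}).

Definition pprod (L : seq ({poly R} * fn)) (n : nat) : fn := \prod_(a <- L) sh (ev a.1 n) a.2.

Lemma b1_pprod L n : all_b1 L -> b1 (pprod L n).
Proof. exact: (@b1_prodL R _ L (fun p => ev p n)). Qed.

Definition pol_av (e : R) (qs : seq {poly R}) t f :=
  exists M u L, [/\ invm M, b1 u, all_b1 L, map fst L = qs &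
    e <= M (fun n => ex (u * (pprod L n * sh (ev t n) f)))].

Definition good (qs : seq {poly R}) t :=
  [/\ ipoly t, nc t & forall q, q \in qs -> ipoly q /\ nc (t - q)].

Lemma all_b1_map (T T' : Type) (L : seq (T * fn)) (F : T -> T') (G : T -> fn -> fn) :
  (forall a g, b1 g -> b1 (G a g)) -> all_b1 L -> all_b1 [seq (F a.1, G a.1 a.2) | a <- L].
Proof.
move=> HG; elim: L => [|a L IH]; first by move=> _ a [].
move=> /all_b1_cons[a1 /IH La].
by rewrite map_cons; apply/all_b1_cons; split=> //=; apply: HG.
Qed.

Lemma all_b1_cat (T : Type) (L L' : seq (T * fn)) : all_b1 L -> all_b1 L' -> all_b1 (L ++ L').
Proof. by move=> HL HL' a /(@List.in_app_or _ _ _ _)[/HL|/HL']. Qed.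

(** The two copies of a product that van der Corput's inequality multiplies live at
[n + h] and at [n]; the measure being invariant, everything may be translated by
[- q n]. *)
Definition nextqs h q qs t : seq {poly R} :=
  [seq tr h p - q | p <- qs] ++ [seq p - q | p <- qs] ++ [:: t - q].

(** By van der Corput's inequality some difference [h] of bounded size makes the
differenced average large, and only boundedly many [h] make the new target
collide with another polynomial; [vdc_pick] avoids those. *)
Lemma pet_step (e : R) qs t q : 0 < e -> (2 < size t)%N -> ipoly t -> ipoly q ->
  (forall p, p \in qs -> ipoly p) ->
  (forall h, (forall p, p \in t :: qs -> nc (tr h t - p)) ->
     detect (pol_av (e ^+ 2 / 2) (nextqs h q qs t) (tr h t - q))) ->
  detect (pol_av e qs t).
Proof.
move=> e0 st it iq iqs H.
have [K HK] := vdc_pick mu (size (t :: qs)) e0.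
pose G h := forall p, p \in t :: qs -> nc (tr h t - p).
pose Q h := pol_av (e ^+ 2 / 2) (nextqs h q qs t) (tr h t - q).
apply: detect_imp (detect_fin K (H : forall h, G h -> detect (Q h))).
move=> f Hf [M [u [L [iM Hu Lb Lq eM]]]].
pose v n := pprod L n * sh (ev t n) f.
have vb n : b1 (v n) by rewrite /v; apply: b1M; bfn; apply: b1_pprod.
pose bad := [seq bad_shift t p | p <- t :: qs].
have [|h [hK hb gh]] := HK M u v bad iM Hu vb _ eM; first by rewrite size_map.
exists h; split=> //.
  move=> p pF; apply: bad_shiftP => //; apply: contraNneq hb => ->.
  exact: map_f.
exists M, 1, ([seq (tr h a.1 - q, a.2) | a <- L] ++ [seq (a.1 - q, cj a.2) | a <- L] ++ [:: (t - q, cj f)]).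
have iL a : List.In a L -> ipoly a.1.
  move=> aL; apply: iqs; rewrite -Lq; elim: (L) aL => // b L' IH [->|/IH aL]; rewrite inE ?eqxx //.
  by rewrite aL orbT.
split=> //; bfn.
- apply: all_b1_cat; first exact: (all_b1_map (F := fun p => tr h p - q) (G := fun _ g => g)).
  apply: all_b1_cat; first by apply: (all_b1_map (F := fun p => p - q) (G := fun _ g => cj g)) => // a g; bfn.
  by apply/all_b1_cons; split => //=; bfn.
- by rewrite !map_cat -!map_comp -Lq /nextqs -!map_comp.
apply: le_trans gh _; apply: eqW; apply: eq_mean => n.
rewrite mul1r -[LHS](@sys_inv _ mu (- ev q n)); last first.
  by have := vb n; have := vb (n + h)%N; bfn.
congr ex; rewrite /pprod !big_cat big_seq1 /= !big_map /= /v !cjM !shM !cj_sh.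
have -> : sh (- ev q n) (pprod L (n + h)%N) = \prod_(a <- L) sh (ev (tr h a.1 - q) n) a.2.
  rewrite /pprod sh_prod; elim: (L) iL => [|a L' IH] iL; first by rewrite !big_nil.
  rewrite !big_cons IH; last by move=> b bL; apply: iL; right.
  congr (_ * _); rewrite shsh; apply: eq_sh; rewrite evB ?ev_tr 1?[RHS]addrC //.
  by apply: ipoly_tr; apply: iL; left.
have -> : sh (- ev q n) (cj (pprod L n)) = \prod_(a <- L) sh (ev (a.1 - q) n) (cj a.2).
  rewrite /pprod cj_prod sh_prod; elim: (L) iL => [|a L' IH] iL; first by rewrite !big_nil.
  rewrite !big_cons IH; last by move=> b bL; apply: iL; right.
  congr (_ * _); rewrite cj_sh shsh; apply: eq_sh; rewrite evB 1?[RHS]addrC //.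
  by apply: iL; left.
rewrite !shsh.
have -> : - ev q n + ev t (n + h) = ev (tr h t - q) n.
  by rewrite evB ?ev_tr 1?addrC //; apply: ipoly_tr.
have -> : - ev q n + ev t n = ev (t - q) n by rewrite evB // addrC.
ring.
Qed.

(** Constant polynomials are absorbed by the weight. *)
Lemma pet_filter (e : R) qs t : detect (pol_av e [seq q <- qs | nc q] t) -> detect (pol_av e qs t).
Proof.
apply: detect_imp => f Hf [M [u [L [iM Hu Lb Lq eM]]]].
pose L1 := seq.filter (fun a => nc a.1) L; pose L0 := seq.filter (fun a => ~~ nc a.1) L.
have sub P : all_b1 (seq.filter P L).
  move=> a aL; apply: Lb; elim: (L) aL => // b L' IH /=; case: ifP => _ //=.
    by move=> [->|/IH]; [left|right].
  by move=> /IH; right.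
exists M, (u * pprod L0 0), L1; split=> //.
- by apply: b1M => //; apply/b1_pprod/sub.
- exact: sub.
- by rewrite /L1 -Lq filter_map; congr map.
apply: le_trans eM _; apply: eqW; apply: eq_mean => n; congr ex.
rewrite -mulrA; congr (_ * _); rewrite mulrA; congr (_ * _).
have -> : pprod L0 0 = pprod L0 n.
  rewrite /L0 /pprod; elim: (L) => [|a L' IH] /=; first by rewrite !big_nil.
  by case: ifP => // na; rewrite !big_cons IH; congr (_ * _); apply: eq_sh; rewrite [RHS]ev_const // leqNgt.
rewrite /L0 /L1 /pprod !big_filter [LHS](bigID (fun a => nc a.1)) mulrC.
by [].
Qed.

Lemma wt_filter qs t e : wt (t :: [seq q <- qs | nc q]) e = wt (t :: qs) e.
Proof.
have E : [seq q : {poly R} <- [seq q <- qs | nc q] | size q == e.+2] = [seq q : {poly R} <- qs | size q == e.+2].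
  by rewrite -filter_predI; apply: eq_filter => x /=; rewrite /nc; case: eqP => // ->.
by rewrite /wt /cls /= E.
Qed.

Lemma lin_case (e : R) qs t : 0 < e -> good qs t -> (size t <= 2)%N ->
  (forall q, q \in qs -> (size q <= 2)%N) -> detect (pol_av e qs t).
Proof.
move=> e0 [it nct gq] st sq.
pose sl q := ev q 1 - ev q 0.
have slE q n : ipoly q -> (size q <= 2)%N -> ev q n = sl q * n%:Z + ev q 0 by move=> iq s; exact: ev_linear.
have sl_nc q : ipoly q -> (size q <= 2)%N -> nc q -> sl q != 0.
  move=> iq s2; rewrite /nc; apply: contraTneq => s0; rewrite -leqNgt.
  have h x : q.[x] = q`_0 + q`_1 * x.
    by rewrite (@horner_coef_wide _ 2) // !big_ord_recr big_ord0 /= expr0 mulr1 add0r expr1.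
  have : (sl q)%:~R = 0 :> R by rewrite s0.
  rewrite /sl rmorphB /= !ev_inj // !h mulr0 mulr1 addr0 addrAC subrr add0r => q1.
  apply/leq_sizeP => -[//|[_|j _]] //; by rewrite nth_default // (leq_trans s2).
have := @lin R mu [seq sl q | q <- qs] (sl t) e e0 (sl_nc _ it st nct).
have tN : sl t \notin [seq sl q | q <- qs].
  apply/mapP => -[q qqs slq]; have [iq ncq] := gq q qqs.
  have s2 : (size (t - q)%R <= 2)%N.
    by apply: leq_trans (size_polyD _ _) _; rewrite size_polyN geq_max st sq.
  have := sl_nc _ (ipolyB it iq) s2 ncq.
  by rewrite /sl !evB // opprB addrACA -opprD; move: slq; rewrite /sl; lia.
move=> /(_ tN) [s [d d0 H]]; exists s, d => // f Hf [M [u [L [iM Hu Lb Lq eM]]]].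
rewrite -(N_sh mu s (ev t 0)) //; apply: H; first by bfn.
exists M, u, [seq (sl a.1, sh (ev a.1 0) a.2) | a <- L]; split=> //.
- by apply: (all_b1_map (F := sl) (G := fun p g => sh (ev p 0) g)) => // a g; bfn.
- by rewrite -map_comp -Lq -map_comp.
apply: le_trans eM _; apply: eqW; apply: eq_mean => n; congr ex.
congr (_ * (_ * _)); last by rewrite shsh -slE.
rewrite /pprod /lprod big_map /=.
have {}Lq a : List.In a L -> a.1 \in qs.
  move=> aL; rewrite -Lq; elim: (L) aL => // b L' IH [->|/IH aL]; rewrite inE ?eqxx //.
  by rewrite aL orbT.
elim: (L) Lq => [|a L' IH] Lq; first by rewrite !big_nil.
rewrite !big_cons IH; last by move=> b Lb'; apply: Lq; right.
have aq : a.1 \in qs by apply: Lq; left.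
by rewrite shsh -slE ?sq //; case: (gq _ aq).
Qed.

(** Polynomials of larger degree than [q] keep their leading coefficients; those of
the same degree have theirs shifted by the one of [q], so that one of them, the one
of [q] itself, disappears. *)
Lemma wt_next h q qs t E : q \in t :: qs -> size q = E.+2 ->
  (forall p, p \in t :: qs -> (size q <= size p)%N) ->
  (wt ((tr h t - q)%R :: nextqs h q qs t) E < wt (t :: qs) E)%N /\
  forall e', (E < e')%N -> (wt ((tr h t - q)%R :: nextqs h q qs t) e' <= wt (t :: qs) e')%N.
Proof.
move=> qF sq qmin.
have next p' : p' \in (tr h t - q)%R :: nextqs h q qs t ->
    exists2 p, p \in t :: qs & (p' = tr h p - q \/ p' = p - q).
  rewrite inE /nextqs !mem_cat inE => /orP[/eqP->|/or3P[/mapP[p pq ->]|/mapP[p pq ->]|/eqP->]].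
  - by exists t; [rewrite mem_head|left].
  - by exists p; [rewrite inE pq orbT|left].
  - by exists p; [rewrite inE pq orbT|right].
  - by exists t; [rewrite mem_head|right].
have key p' : p' \in (tr h t - q)%R :: nextqs h q qs t ->
    exists2 p, p \in t :: qs & exists2 p1 : {poly R}, size p1 = size p /\ lead_coef p1 = lead_coef p & p' = p1 - q.
  move=> /next[p pF [->|->]]; exists p => //; last by exists p.
  by exists (tr h p) => //; rewrite size_tr lead_tr.
split; last first.
  move=> e' Ee; apply: uniq_leq_size; first exact: undup_uniq.
  move=> c /cls_mem[p' /key[p pF [p1 [s1 l1] ->]] [s2 l2]].
  have big : (size q < size p1)%N.
    rewrite ltnNge; apply/negP => le.
    have := leq_trans (size_polyD p1 (- q)) _; move=> /(_ (size q)).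
    rewrite size_polyN geq_max le leqnn => /(_ isT); rewrite s2 sq; lia.
  apply/cls_mem; exists p => //; split.
    by rewrite -s1 -s2 size_polyDl // size_polyN.
  by rewrite -l1 -l2 lead_coefDl // size_polyN.
have cq : lead_coef q \in cls (t :: qs) E by apply/cls_mem; exists q.
rewrite /wt -[X in (_ < X)%N](prednK (_ : 0 < _)%N); last by case: (cls _ _) cq.
rewrite ltnS -(size_rem cq) -(size_map (fun c => c - lead_coef q) (rem (lead_coef q) (cls (t :: qs) E))).
apply: uniq_leq_size; first exact: undup_uniq.
move=> c /cls_mem[p' /key[p pF [p1 [s1 l1] ->]] [s2 l2]].
have le1 : (size q <= size p1)%N by rewrite s1 qmin.
have s12 : size p1 = size q.
  apply/eqP; rewrite eqn_leq le1 andbT leqNgt; apply/negP => lt.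
  by have := size_polyDl (p := p1) (q := - q); rewrite size_polyN => /(_ lt); rewrite s2 -sq => e; move: lt; rewrite -e ltnn.
have cE : c = lead_coef p1 - lead_coef q.
  by rewrite -l2 /lead_coef s2 coefB s12 sq.
apply/mapP; exists (lead_coef p1) => //.
rewrite mem_rem_uniq ?undup_uniq // inE; apply/andP; split.
  apply/eqP => e; move: cE; rewrite e subrr -l2 => /eqP; rewrite lead_coef_eq0 -size_poly_eq0 s2 //.
by apply/cls_mem; exists p => //; rewrite -s1 s12 sq l1.
Qed.

Lemma size_sub_lt p q : (size q < size p)%N -> size (p - q) = size p.
Proof. by move=> h; rewrite size_polyDl // size_polyN. Qed.
Lemma size_sub_le p q m : (size p <= m)%N -> (size q <= m)%N -> (size (p - q)%R <= m)%N.
Proof. by move=> hp hq; apply: leq_trans (size_polyD _ _) _; rewrite size_polyN geq_max hp. Qed.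

Lemma nextqs_mem h q qs t p' : p' \in nextqs h q qs t ->
  [\/ exists2 p, p \in qs & p' = tr h p - q, exists2 p, p \in qs & p' = p - q | p' = t - q].
Proof.
rewrite /nextqs !mem_cat inE => /or3P[/mapP[p pq ->]|/mapP[p pq ->]|/eqP->].
- by apply: Or31; exists p.
- by apply: Or32; exists p.
- exact: Or33.
Qed.

(** Induction on the complexity of the family. In each step [q] has minimal degree;
it is moreover chosen to be different from the target in degree or leading
coefficient whenever possible, so that the target keeps the maximal degree. *)
Lemma pet_max qs t (e : R) : 0 < e -> good qs t -> (forall q, q \in qs -> (size q <= size t)%N) ->
  detect (pol_av e qs t).
Proof.
pose P (x : seq {poly R} * {poly R}) := forall D, (size x.2 <= D)%N -> True.
have [D] := ubnP (size t).
pose W (x : seq {poly R} * {poly R}) := wt (x.2 :: x.1).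
pose Q (x : seq {poly R} * {poly R}) := forall e : R, (size x.2 < D)%N -> 0 < e -> good x.1 x.2 ->
   (forall q, q \in x.1 -> (size q <= size x.2)%N) -> detect (pol_av e x.1 x.2).
suff H x : Q x by move=> sD e0 g m; exact: (H (qs, t)).
elim/(@lex_ind _ W D): x => -[{}qs {}t] IH {}e /= sD e0 g0 m0.
apply: pet_filter.
pose qs1 := [seq q <- qs | nc q].
have sub q : q \in qs1 -> q \in qs by rewrite mem_filter => /andP[].
have ncq q : q \in qs1 -> nc q by rewrite mem_filter => /andP[].
have [it nct gq] : good qs1 t by case: g0 => it nct gq; split=> // q /sub/gq.
have mx q : q \in qs1 -> (size q <= size t)%N by move=> /sub/m0.
have {}IH y : (exists E, [/\ (E < D)%N, (W y E < wt (t :: qs1) E)%N & forall e', (E < e')%N -> (W y e' <= wt (t :: qs1) e')%N]) -> Q y.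
  move=> [E [h1 h2 h3]]; apply: IH; exists E; split=> //.
    by move: h2; rewrite /qs1 wt_filter.
  by move=> e' /h3; rewrite /qs1 wt_filter.
rewrite -/qs1; clearbody qs1; clear sub g0 m0 qs; rename qs1 into qs.
have [st|st] := leqP (size t) 2.
  by apply: lin_case => // q /mx h; apply: leq_trans h st.
have iqs p : p \in qs -> ipoly p by move=> /gq[].
have e2 : 0 < e ^+ 2 / 2 by rewrite divr_gt0 // exprn_gt0.
have iF p : p \in t :: qs -> ipoly p by rewrite inE => /orP[/eqP->|/iqs].
have ncF p : p \in t :: qs -> nc p by rewrite inE => /orP[/eqP->|/ncq].
(* it is enough to find [q] of minimal degree after whose subtraction the target
   still has maximal degree *)
suff [q qF [qmin qmax]] : exists2 q, q \in t :: qs & (forall p, p \in t :: qs -> (size q <= size p)%N) /\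
    forall h, (forall p, p \in t :: qs -> nc (tr h t - p)) -> forall p', p' \in nextqs h q qs t -> (size p' <= size (tr h t - q)%R)%N.
  apply: (pet_step e0 st it (iF _ qF) iqs) => h Hh.
  have [E sq] : exists E, size q = E.+2.
    by have := ncF _ qF; rewrite /nc; case: (size q) => [|[|E]] // _; exists E.
  have [w1 w2] := wt_next h qF sq qmin.
  have sqt : (size q <= size t)%N by apply: qmin; rewrite mem_head.
  apply: (IH (nextqs h q qs t, tr h t - q)) => //=.
  - exists E; split=> //; rewrite sq in sqt.
    exact: leq_trans (leq_trans (leqnSn _) sqt) (ltnW sD).
  - by apply: leq_ltn_trans (size_sub_le _ _) sD; rewrite ?size_tr.
  - split; [by apply: ipolyB; [apply: ipoly_tr|apply: iF]|exact: Hh|].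
    have iq := iF _ qF.
    move=> p' /nextqs_mem[[p pq ->]|[p pq ->]|->].
    + split; first by apply: ipolyB => //; apply: ipoly_tr; apply: iqs.
      have -> : tr h t - q - (tr h p - q) = tr h (t - p) by rewrite trB; ring.
      by rewrite /nc size_tr; case: (gq p pq).
    + split; first by apply: ipolyB => //; apply: iqs.
      have -> : tr h t - q - (p - q) = tr h t - p by ring.
      by apply: Hh; rewrite inE pq orbT.
    + split; first exact: ipolyB.
      have -> : tr h t - q - (t - q) = tr h t - t by ring.
      by apply: Hh; rewrite mem_head.
  - exact: qmax.
have [/hasP[p0 p0q p0t]|/hasPn small] := boolP (has (fun p => (size p < size t)%N) qs).
  have [q0 qq qm] : exists2 q1 : {poly R}, q1 \in qs & forall p : {poly R}, p \in qs -> (size q1 <= size p)%N.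
    have ex0 : exists n, has (fun p => size p == n) qs by exists (size p0); apply/hasP; exists p0.
    case: (ex_minnP ex0) => n /hasP[q1 qq /eqP sq] mn.
    by exists q1 => // p pq; rewrite sq; apply: mn; apply/hasP; exists p.
  have qt : (size q0 < size t)%N by apply: leq_ltn_trans (qm _ p0q) p0t.
  exists q0; first by rewrite inE qq orbT.
  split=> [p|h _ p']; first by rewrite inE => /orP[/eqP->|/qm//]; apply: ltnW.
  rewrite [X in (_ <= X)%N]size_sub_lt ?size_tr //.
  by move=> /nextqs_mem[[p pq ->]|[p pq ->]|->]; apply: size_sub_le; rewrite ?size_tr; by [|exact: mx|exact: ltnW].
have eqs p : p \in t :: qs -> size p = size t.
  rewrite inE => /orP[/eqP->//|pq]; apply/eqP; rewrite eqn_leq mx //=.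
  by rewrite leqNgt; apply: small.
have [/hasP[q qq lq]|/hasPn same] := boolP (has (fun p => lead_coef p != lead_coef t) qs).
  have qF : q \in t :: qs by rewrite inE qq orbT.
  exists q => //; split=> [p pF|h _ p']; first by rewrite (eqs q) ?(eqs p).
  have sE : size (tr h t - q)%R = size t.
    apply/eqP; rewrite eqn_leq size_sub_le ?size_tr ?(mx _ qq) //=.
    rewrite -[X in (X <= _)%N](ltn_predK nct) ltnNge; apply/negP => /leq_sizeP/(_ _ (leqnn _)).
    rewrite coefB coef_tr_top ?(ltn_predK nct) // => /eqP; rewrite subr_eq0 -/(lead_coef t).
    by rewrite -(eqs _ qF) -/(lead_coef q) eq_sym (negbTE lq).
  rewrite sE => /nextqs_mem[[p pq ->]|[p pq ->]|->]; apply: size_sub_le; rewrite ?size_tr; by [|exact: mx].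
exists t; first by rewrite mem_head.
split=> [p /eqs -> //|h Hh p'].
have same' p : p \in t :: qs -> lead_coef p = lead_coef t.
  by rewrite inE => /orP[/eqP->//|/same]; rewrite negbK => /eqP.
have h0 : h%:R != 0 :> R.
  rewrite pnatr_eq0; apply/eqP => h0; have := Hh t (mem_head _ _).
  by rewrite h0 /tr addr0 comp_polyXr subrr /nc size_poly0.
have [d sd] : exists d, size t = d.+3 by case: (size t) st => [|[|[|d]]] // _; exists d.
have sE : (d.+1 < size (tr h t - t)%R)%N.
  rewrite ltnNge; apply/negP => /leq_sizeP/(_ _ (leqnn _)).
  rewrite coefB coef_tr_sub ?sd // addrAC subrr add0r => /eqP.
  rewrite mulf_eq0 mulrn_eq0 /= (negbTE h0) orbF.
  have := lead_coef_eq0 t; rewrite /lead_coef sd /= => ->.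
  by rewrite -size_poly_eq0 sd.
have lt p1 : size p1 = size t -> lead_coef p1 = lead_coef t -> (size (p1 - t)%R <= size (tr h t - t)%R)%N.
  move=> s1 l1; apply: leq_trans _ sE.
  have := size_cancel (p := p1) (q := t); rewrite s1 => /(_ nct erefl l1); rewrite sd; lia.
move=> /nextqs_mem[[p pq ->]|[p pq ->]|->]; last by rewrite subrr size_poly0.
  have pF : p \in t :: qs by rewrite inE pq orbT.
  by apply: lt; rewrite ?size_tr ?lead_tr ?(eqs _ pF) ?(same' _ pF).
have pF : p \in t :: qs by rewrite inE pq orbT.
by apply: lt; rewrite ?(eqs _ pF) ?(same' _ pF).
Qed.

(** If another polynomial has larger degree than the target, translating everything
by the largest one makes the target one of the largest. *)
Theorem pet qs t (e : R) : 0 < e -> good qs t -> detect (pol_av e qs t).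
Proof.
move=> e0 g; have [/hasP[p0 p0q p0t]|/hasPn small] := boolP (has (fun p => (size t < size p)%N) qs); last first.
  by apply: pet_max => // q /small; rewrite -leqNgt.
case: g => it nct gq.
have [q qq qm] : exists2 q1 : {poly R}, q1 \in qs & forall p : {poly R}, p \in qs -> (size p <= size q1)%N.
  elim: (qs) p0 p0q {p0t} => // p qs' IH p0 _.
  case: qs' IH => [|p1 qs'] IH; first by exists p; rewrite ?mem_head // => r; rewrite inE => /eqP->.
  have [q qq qm] := IH p1 (mem_head _ _).
  have [pq|qp] := leqP (size p) (size q).
    by exists q => [|r]; rewrite inE ?qq ?orbT // => /orP[/eqP->|/qm].
  exists p => [|r]; rewrite inE ?eqxx // => /orP[/eqP->//|/qm h].
  exact: leq_trans h (ltnW qp).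
have qt : (size t < size q)%N by apply: leq_trans p0t (qm _ p0q).
have [iq ncq] := gq q qq.
pose qs' := - q :: [seq p - q | p <- qs].
have stq : size (t - q)%R = size q.
  by rewrite -size_polyN opprB size_sub_lt.
have g' : good qs' (t - q).
  split=> [|//|p']; first exact: ipolyB.
  rewrite inE => /orP[/eqP->|/mapP[p pq ->]].
    by split; [exact: ipolyN|rewrite opprK subrK].
  have [ip ncp] := gq p pq; split; first exact: ipolyB.
  by have -> : t - q - (p - q) = t - p by ring.
apply: detect_imp (pet_max e0 g' _); last first.
  move=> p'; rewrite stq inE => /orP[/eqP->|/mapP[p pq ->]]; first by rewrite size_polyN.
  by apply: size_sub_le => //; apply: qm.
move=> f Hf [M [u [L [iM Hu Lb Lq eM]]]].
exists M, 1, ((- q, u) :: [seq (a.1 - q, a.2) | a <- L]); split=> //; bfn.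
- apply/all_b1_cons; split=> //; exact: (all_b1_map (F := fun p => p - q) (G := fun _ g => g)).
- by rewrite /= -map_comp /qs' -Lq -map_comp.
apply: le_trans eM _; apply: eqW; apply: eq_mean => n.
rewrite -[LHS](@sys_inv _ mu (- ev q n)); last first.
  by have := b1_pprod n Lb; bfn.
congr ex; rewrite mul1r /pprod big_cons big_map /= !shM shsh evN //.
rewrite mulrA; congr (_ * _ * _); last by apply: eq_sh; rewrite evB // addrC.
have iL a : List.In a L -> ipoly a.1.
  move=> aL; suff /gq[] : a.1 \in qs by [].
  rewrite -Lq; elim: (L) aL => // b L' IH [->|/IH aL]; rewrite inE ?eqxx //.
  by rewrite aL orbT.
rewrite sh_prod; elim: (L) iL => [|a L' IH] iL; first by rewrite !big_nil.
rewrite !big_cons IH; last by move=> b Lb'; apply: iL; right.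
congr (_ * _); rewrite shsh; apply: eq_sh; rewrite evB 1?addrC //.
by apply: iL; left.
Qed.

End PET.

(** * Eigenfunctions and polynomial phases *)

Section Phases.
Variables (R : realType) (mu : sys R).
Local Notation C := R[i].
Local Notation fn := (fn R).
Local Notation ex := (ex mu).
Local Notation nn := (nn mu).
Local Notation aeq := (aeq mu).
Local Notation ti := (ti mu).
Local Notation nu := (nu mu).
Local Notation N := (N mu).
Implicit Types (f g u w lam : fn) (M : mean R nat) (z : int).

Definition uni lam := forall x, `|lam x| = 1.
Definition pw lam z : fn := fun x => lam x ^ z.

Lemma uni_neq0 lam x : uni lam -> lam x != 0.
Proof. by move=> /(_ x) h; rewrite -normr_eq0 h oner_eq0. Qed.
Lemma uni_b1 lam : uni lam -> b1 lam.
Proof. by move=> h x; rewrite h. Qed.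
Lemma uni_pw lam z : uni lam -> uni (pw lam z).
Proof.
move=> h x; rewrite /pw; case: z => n; first by rewrite -exprnP normrX h expr1n.
by rewrite NegzE -exprnN normfV normrX h expr1n invr1.
Qed.
Lemma pwD lam y z : uni lam -> pw lam (y + z) = pw lam y * pw lam z.
Proof. by move=> h; apply/funext => x; rewrite /pw expfzDr // uni_neq0. Qed.
Lemma pw0 lam : pw lam 0 = 1. Proof. by []. Qed.
Lemma pw1 lam : pw lam 1 = lam. Proof. by []. Qed.
Lemma pwM lam y z : uni lam -> pw lam (y * z) = pw (pw lam y) z.
Proof. by move=> h; apply/funext => x; rewrite /pw exprz_exp. Qed.
Lemma pwMl lam lam' z : pw (lam * lam') z = pw lam z * pw lam' z.
Proof. by apply/funext => x; rewrite /pw expfzMl. Qed.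
Lemma pw_prod (I : Type) (r : seq I) (F : I -> fn) z :
  pw (\prod_(i <- r) F i) z = \prod_(i <- r) pw (F i) z.
Proof.
elim: r => [|i r IH]; last by rewrite !big_cons -IH pwMl.
by rewrite !big_nil; apply/funext => x; rewrite /pw exp1rz.
Qed.
Lemma uniM lam lam' : uni lam -> uni lam' -> uni (lam * lam').
Proof. by move=> h h' x; rewrite normrM h h' mulr1. Qed.
Lemma uni1 : uni 1. Proof. by move=> x; rewrite normr1. Qed.
Lemma uni_prod (I : Type) (r : seq I) (F : I -> fn) : (forall i, uni (F i)) -> uni (\prod_(i <- r) F i).
Proof. by move=> h; elim/big_rec: _ => [|i g _]; [exact: uni1|apply: uniM]. Qed.
Lemma uni_cj lam : uni lam -> uni (cj lam).
Proof. by move=> h x; rewrite norm_conjC. Qed.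
Lemma uni_sh l lam : uni lam -> uni (sh l lam).
Proof. by move=> h x; apply: h. Qed.
Lemma uni_cjV lam : uni lam -> lam * cj lam = 1.
Proof. by move=> h; apply/funext => x; rewrite /cj !fctE -normCK h expr1n. Qed.
Lemma pwN lam z : uni lam -> pw lam (- z) = cj (pw lam z).
Proof.
move=> h; have h' := uni_pw z h.
rewrite -[LHS]mulr1 -(uni_cjV h') mulrA -pwD // addNr pw0 mul1r //.
Qed.
Hint Resolve uni_b1 uni_pw uniM uni1 uni_prod uni_cj uni_sh : bfn.

(** [lam] is one where [w] does not vanish. *)
Definition fixw lam w := aeq (lam * w) w.

Lemma fixw1 w : fixw 1 w. Proof. by rewrite /fixw mul1r; apply: aeq_refl. Qed.
Lemma fixwM lam lam' w : b1 lam -> b1 lam' -> b1 w -> fixw lam w -> fixw lam' w -> fixw (lam * lam') w.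
Proof.
move=> h h' hw f f'; rewrite /fixw -mulrA.
by apply: aeq_trans (aeqMl _ _ _ f') f; bfn.
Qed.
Lemma fixw_cj lam w : uni lam -> b1 w -> fixw lam w -> fixw (cj lam) w.
Proof.
move=> h hw f; rewrite /fixw; apply: aeq_sym.
have -> : w = cj lam * (lam * w) by rewrite mulrA [cj _ * _]mulrC uni_cjV // mul1r.
rewrite [X in aeq _ (cj lam * X)]mulrA [cj lam * lam]mulrC uni_cjV // mul1r.
by apply: aeqMl; bfn.
Qed.
Lemma fixw_pw lam w z : uni lam -> b1 w -> fixw lam w -> fixw (pw lam z) w.
Proof.
move=> h hw f; have nat n : fixw (pw lam (Posz n)) w.
  elim: n => [|n IH]; first by rewrite pw0; apply: fixw1.
  by rewrite -addn1 PoszD pwD // pw1; apply: fixwM => //; bfn.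
case: z => n //; rewrite NegzE pwN //; apply: fixw_cj => //; bfn.
Qed.
Lemma fixw_ex lam w g : b1 lam -> b1 w -> cb g -> fixw lam w -> ex (lam * w * g) = ex (w * g).
Proof. by move=> *; apply: aeq_ex; bfn. Qed.

(** ** Eigenfunctions *)
Definition eigl lam f := b1 f /\ aeq (sh 1 f) (lam * f).
Definition eig f := exists lam, [/\ uni lam, ti 1 lam & eigl lam f].

Lemma aeqMM (f f' g g' : fn) : b1 f -> b1 f' -> b1 g -> b1 g' ->
  aeq f f' -> aeq g g' -> aeq (f * g) (f' * g').
Proof. by move=> *; apply: aeqM; bfn. Qed.

Lemma tiM W f g : b1 f -> b1 g -> ti W f -> ti W g -> ti W (f * g).
Proof. by move=> *; rewrite !tiE shM; apply: aeqMM; bfn. Qed.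
Lemma ti_cj W f : ti W f -> ti W (cj f).
Proof. by move=> h; rewrite !tiE -cj_sh; apply: aeq_cj. Qed.
Lemma ti_sh W l f : b1 f -> ti W f -> ti W (sh l f).
Proof. by move=> Hf h; rewrite !tiE shsh addrC -shsh; apply: aeq_sh; bfn. Qed.
Lemma ti_pw lam z W : uni lam -> ti W lam -> ti W (pw lam z).
Proof.
move=> h t; have nat n : ti W (pw lam (Posz n)).
  elim: n => [|n IH]; first by rewrite pw0; apply: ti1.
  by rewrite -addn1 PoszD pwD // pw1; apply: tiM; bfn.
by case: z => n //; rewrite NegzE pwN //; apply: ti_cj.
Qed.

Lemma eig_b1 f : eig f -> b1 f.
Proof. by move=> [lam [_ _ []]]. Qed.
Lemma eigM f g : eig f -> eig g -> eig (f * g).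
Proof.
move=> [l [ul tl [Hf ef]]] [l' [ul' tl' [Hg eg]]]; exists (l * l'); split.
- by bfn.
- by apply: tiM; bfn.
- split; first by bfn.
  by rewrite shM mulrACA; apply: aeqMM; bfn.
Qed.
Lemma eig_cj f : eig f -> eig (cj f).
Proof.
move=> [l [ul tl [Hf ef]]]; exists (cj l); split; [by bfn|exact: ti_cj|split; first by bfn].
by rewrite -cj_sh -cjM; apply: aeq_cj.
Qed.
Lemma eig_sh k f : eig f -> eig (sh k f).
Proof.
move=> [l [ul tl [Hf ef]]]; exists (sh k l); split; [by bfn|by apply: ti_sh; bfn|split; first by bfn].
by rewrite -shM shsh addrC -shsh; apply: aeq_sh; bfn.
Qed.
Lemma eig_D h f : eig f -> eig (D h f).
Proof. by move=> e; apply: eigM => //; apply/eig_sh/eig_cj. Qed.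
Lemma eig_ti f : b1 f -> ti 1 f -> eig f.
Proof.
move=> Hf tf; exists 1; split; [exact: uni1|exact: ti1|split=> //].
by rewrite mul1r.
Qed.
Lemma eig0 : eig 0.
Proof. by apply: eig_ti; [bfn|apply: aeq_refl]. Qed.
(** As [lam] is invariant, iterating the equation of an eigenfunction multiplies by
powers of [lam]. *)
Lemma eigl_sh lam f z : uni lam -> ti 1 lam -> eigl lam f -> aeq (sh z f) (pw lam z * f).
Proof.
move=> ul tl [Hf ef].
have nat n : aeq (sh (Posz n) f) (pw lam (Posz n) * f).
  elim: n => [|n IH]; first by rewrite sh0 pw0 mul1r; apply: aeq_refl.
  rewrite -addn1 PoszD addrC -shsh addrC.
  have h1 : aeq (sh 1 (sh n f)) (sh 1 (pw lam n * f)) by apply: aeq_sh; bfn.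
  have h2 : aeq (sh 1 (pw lam n * f)) (pw lam n * (lam * f)).
    by rewrite shM; apply: aeqMM; bfn; apply: ti_pw.
  by rewrite pwD // pw1 -mulrA; apply: aeq_trans h1 h2; bfn.
case: z => n //; rewrite NegzE; set m := n.+1.
have h1 : aeq f (pw lam m * sh (- m%:Z) f).
  have h : aeq (sh (- m%:Z) (sh m f)) (sh (- m%:Z) (pw lam m * f)) by apply: aeq_sh; bfn.
  rewrite shK in h; apply: aeq_trans h _; bfn.
  rewrite shM; apply: aeqMr; bfn; apply: aeq_sym.
  have t : aeq (sh m (pw lam m)) (pw lam m).
    by have := ti_mul m (b1_cb (uni_b1 (uni_pw m ul))) (ti_pw m ul tl); rewrite mul1n.
  by have := aeq_sh (- m%:Z) _ _ t; rewrite shK; apply; bfn.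
have h2 : aeq (cj (pw lam m) * f) (cj (pw lam m) * (pw lam m * sh (- m%:Z) f)) by apply: aeqMl; bfn.
rewrite pwN //; apply: aeq_sym; move: h2.
by rewrite mulrA [cj _ * pw _ _]mulrC uni_cjV ?mul1r //; bfn.
Qed.

(** The projection commutes with the shift and with the multiplication by the
invariant eigenvalue. *)
Lemma eig_proj W lam f rho : uni lam -> ti 1 lam -> eigl lam f -> b1 rho ->
  (forall M, invm M -> forall g, cb g -> M (fun n => ex (sh (W * n)%N%:Z f * g)) = ex (rho * g)) ->
  eigl lam rho.
Proof.
move=> ul tl [Hf ef] Hr rE; split=> //; apply: ex_sep; bfn => g Hg.
have ic : invm (ces R) by apply: ces_inv.
rewrite -[LHS](@sys_inv _ mu (-1)) ?shM ?shK; last by bfn.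
rewrite -[RHS]/(ex (lam * rho * g)) [lam * rho]mulrC -mulrA -!(rE _ ic); try by bfn.
apply: eq_mean => n; rewrite -[LHS](@sys_inv _ mu 1); last by bfn.
rewrite shM shNK shsh addrC -shsh mulrA; apply: aeq_ex; bfn.
have h1 : aeq (sh (W * n)%N (sh 1 f)) (sh (W * n)%N (lam * f)) by apply: aeq_sh; bfn.
apply: aeq_trans h1 _; bfn; rewrite shM [sh _ lam * _]mulrC; apply: aeqMl; bfn.
by have := ti_mul (W * n) (b1_cb (uni_b1 ul)) tl; rewrite mul1n.
Qed.

Lemma eiglZB lam f g : uni lam -> eigl lam f -> eigl lam g -> eigl lam (cc (2^-1) * (f - g)).
Proof.
move=> ul [Hf ef] [Hg eg]; split.
  have -> : cc (2^-1) * (f - g) = avgF 1 (fun i => if i is 0%N then f else - g).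
    by rewrite /avgF !big_ord_recr big_ord0 /= add0r.
  by apply: b1_avgF => -[|_] //; bfn.
have -> : lam * (cc 2^-1 * (f - g)) = cc 2^-1 * (lam * f - lam * g) by ring.
rewrite shM sh_cc shB; apply: aeqMl; bfn.
by apply: aeqB; bfn.
Qed.

(** ** Polynomial phases *)
Section Weyl.
Variable k : nat.
Implicit Types (P : 'I_k -> {poly R}) (lm : 'I_k -> fn).

Definition pv lm (v : 'I_k -> int) : fn := \prod_j pw (lm j) (v j).
Definition phase lm P n : fn := pv lm (fun j => ev (P j) n).

Lemma uni_pv lm v : (forall j, uni (lm j)) -> uni (pv lm v).
Proof. by move=> h; apply: uni_prod => j; bfn. Qed.
Hint Resolve uni_pv : bfn.
Lemma pvD lm v v' : (forall j, uni (lm j)) -> pv lm (fun j => v j + v' j) = pv lm v * pv lm v'.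
Proof. by move=> h; rewrite /pv -big_split; apply: eq_bigr => j _; rewrite pwD. Qed.
Lemma pvN lm v : (forall j, uni (lm j)) -> pv lm (fun j => - v j) = cj (pv lm v).
Proof. by move=> h; rewrite /pv cj_prod; apply: eq_bigr => j _; rewrite pwN. Qed.
Lemma pv_pw lm v z : (forall j, uni (lm j)) -> pv lm (fun j => v j * z) = pw (pv lm v) z.
Proof. by move=> h; rewrite /pv pw_prod; apply: eq_bigr => j _; rewrite pwM. Qed.
Lemma eq_pv lm v v' : (forall j, v j = v' j) -> pv lm v = pv lm v'.
Proof. by move=> h; apply: eq_bigr => j _; rewrite h. Qed.

Definition topc (p : {poly R}) (d : nat) : int := Num.floor (d`!%:R * p`_d).

Lemma topcE p d : ipoly p -> (size p <= d.+1)%N -> (topc p d)%:~R = d`!%:R * p`_d.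
Proof.
move=> ip sp; apply: floorK; elim: d p ip sp => [|d IH] p ip sp.
  have := ip 0; rewrite (size1_polyC sp) hornerC coefC eqxx => h.
  by rewrite fact0 mul1r.
have := IH (tr 1 p - p) (ipolyB (ipoly_tr 1 ip) ip).
have s : (size (tr 1 p - p)%R <= d.+1)%N.
  apply/leq_sizeP => j; rewrite leq_eqVlt => /orP[/eqP<-|dj]; first by rewrite coefB coef_tr_top ?subrr.
  by rewrite coefB !nth_default ?subrr ?size_tr //; apply: leq_trans sp _.
move=> /(_ s); rewrite coefB coef_tr_sub // addrAC subrr add0r.
have -> // : d`!%:R * (p`_d.+1 * (1 *+ d.+1)) = d.+1`!%:R * p`_d.+1.
by rewrite factS natrM; ring.
Qed.

Lemma size_dif h (p : {poly R}) d : (size p <= d.+2)%N -> (size (tr h p - p)%R <= d.+1)%N.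
Proof.
move=> sp; apply/leq_sizeP => j; rewrite leq_eqVlt => /orP[/eqP<-|dj].
  by rewrite coefB coef_tr_top ?subrr.
by rewrite coefB !nth_default ?subrr ?size_tr //; apply: leq_trans sp _.
Qed.

Lemma topc_dif h p d : ipoly p -> (size p <= d.+2)%N -> topc (tr h p - p) d = topc p d.+1 * h%:Z.
Proof.
move=> ip sp; apply: (intr_inj (R := R)); rewrite rmorphM /=.
rewrite !topcE //; [|exact: ipolyB (ipoly_tr h ip) ip|exact: size_dif].
rewrite coefB coef_tr_sub // addrAC subrr add0r factS natrM -mulr_natl.
have -> : (h%:Z)%:~R = h%:R :> R by [].
ring.
Qed.

(** [kill z u]: the part of [u] on which the phase [z] is trivial vanishes. *)
Definition kill (z : fn) u := forall M, invm M -> forall g, b1 g -> M (fun n => ex (u * g * pw z n%:Z)) = 0.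

Lemma kill_dvd (th : fn) V W u : uni th -> b1 u -> (V %| W)%N -> (0 < W)%N ->
  kill (pw th W%:Z) u -> kill (pw th V%:Z) u.
Proof.
move=> uth Hu /dvdnP[[|m] ->] // _ K M iM g Hg.
have b : bdd (fun n : nat => ex (u * g * pw (pw th V) n%:Z)) by apply: bdd_exb => n; bfn.
rewrite (mean_dil iM m b) -[RHS](mean_cst (avg R m)); apply: eq_mean => i.
rewrite -[RHS](K _ (dil_inv iM (inord i : 'I_m.+1)) (g * pw (pw th V) i)); last by bfn.
apply: eq_mean => n; congr ex; rewrite -!mulrA; congr (_ * (_ * _)).
rewrite PoszD pwD; last by bfn.
rewrite mulrC; congr (_ * _); rewrite -!pwM //; congr (pw th _).
by rewrite !PoszM; ring.
Qed.

(** Weyl differencing: only the part of the weight where a bounded power of the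
leading coefficient is trivial can correlate with a polynomial phase. *)
Lemma weyl_top d P (e : R) : 0 < e -> (forall j, ipoly (P j)) -> (forall j, size (P j) <= d.+2)%N ->
  exists2 W : nat, (0 < W)%N & forall M lm u, invm M -> (forall j, uni (lm j)) -> b1 u ->
    kill (pw (pv lm (fun j => topc (P j) d.+1)) W%:Z) u -> M (fun n => ex (u * phase lm P n)) < e.
Proof.
elim: d P e => [|d IH] P e e0 iP sP.
  exists 1%N => // M lm u iM ul Hu K.
  have <- // : 0 = M (fun n => ex (u * phase lm P n)).
  rewrite -(K M iM (pv lm (fun j => ev (P j) 0))); last by apply/uni_b1/uni_pv.
  apply: eq_mean => n; congr ex; rewrite -mulrA; congr (_ * _).
  rewrite pw1 -pv_pw // -pvD //; apply: eq_pv => j.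
  rewrite [RHS]ev_linear // addrC; congr (_ * _ + _).
  apply: (intr_inj (R := R)); rewrite topcE // rmorphB /= !ev_inj //.
  have h x : (P j).[x] = (P j)`_0 + (P j)`_1 * x.
    by rewrite (@horner_coef_wide _ 2) // !big_ord_recr big_ord0 /= expr0 mulr1 add0r expr1.
  by rewrite !h factS fact0; ring.
have [H HH] := vdc_pick mu 1 e0.
have e2 : 0 < e ^+ 2 / 2 by rewrite divr_gt0 // exprn_gt0.
pose Ph h j := tr h (P j) - P j.
have iPh h j : ipoly (Ph h j) by apply: ipolyB => //; apply: ipoly_tr.
have sPh h j : (size (Ph h j) <= d.+2)%N by apply: size_dif.
have ch h : {W : nat | (0 < W)%N /\ forall M lm u, invm M -> (forall j, uni (lm j)) -> b1 u ->
    kill (pw (pv lm (fun j => topc (Ph h j) d.+1)) W%:Z) u -> M (fun n => ex (u * phase lm (Ph h) n)) < e ^+ 2 / 2}.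
  by apply: cid; have [W W0 HW] := IH (Ph h) _ e2 (iPh h) (sPh h); exists W.
pose Wh h := sval (ch h).
have Wh0 h : (0 < Wh h)%N by case: (svalP (ch h)).
have HWh h := (svalP (ch h)).2.
pose W := (\prod_(h < H.+1) (h.+1 * Wh h.+1))%N.
exists W; first by apply: prodn_gt0 => h; rewrite muln_gt0 Wh0.
move=> M lm u iM ul Hu K; rewrite ltNge; apply/negP => eM.
have eM' : e <= M (fun n => ex (1 * (u * phase lm P n))).
  by apply: le_trans eM _; apply: eqW; apply: eq_mean => n; rewrite mul1r.
have ub n : b1 (u * phase lm P n) by rewrite /phase; bfn.
have [||h [hH hb gh]] := HH M 1 (fun n => u * phase lm P n) [:: 0%N] iM _ ub _ eM'; [by bfn|by []|].
rewrite inE in hb; case: h hH hb gh => // h hH _ gh.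
have : M (fun n => ex ((u * cj u) * phase lm (Ph h.+1) n)) < e ^+ 2 / 2.
  apply: HWh => //; first by bfn.
  have -> : pv lm (fun j => topc (Ph h.+1 j) d.+1) = pw (pv lm (fun j => topc (P j) d.+2)) h.+1%:Z.
    by rewrite -pv_pw //; apply: eq_pv => j; rewrite topc_dif.
  rewrite -pwM; last by bfn.
  have hH' : (h < H.+1)%N by apply: leq_trans hH _.
  have dv : (h.+1 * Wh h.+1 %| W)%N by rewrite /W (bigD1 (Ordinal hH')) //= dvdn_mulr.
  have W0 : (0 < W)%N by apply: prodn_gt0 => i; rewrite muln_gt0 Wh0.
  have K' : kill (pw (pv lm (fun j => topc (P j) d.+2)) W%:Z) (u * cj u).
    move=> M' iM' g Hg; rewrite -[RHS](K M' iM' (cj u * g)); last by bfn.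
    by apply: eq_mean => n; congr ex; ring.
  by rewrite -PoszM; apply: kill_dvd dv W0 K'; bfn.
rewrite ltNge => /negP; apply; apply: le_trans gh _; apply: eqW; apply: eq_mean => n; congr ex.
rewrite cjM mulrACA; congr (_ * _); rewrite /phase -pvN // -pvD //; apply: eq_pv => j.
by rewrite /Ph evB ?ev_tr //; apply: ipoly_tr.
Qed.

Lemma mean_ex_ge (a : nat -> R) M c : bdd a -> 0 < c -> c <= M a -> exists n, c / 2 <= a n.
Proof.
move=> ba c0 cM; apply: contrapT => no.
have : M a <= c / 2.
  by apply: mean_le_cst => // n; rewrite leNgt; apply/negP => /ltW h; apply: no; exists n.
lra.
Qed.

(** The means of the powers of [z] at a point are [1] where [z] is one and [0]
elsewhere, so that [rho] is the indicator of the set where [z] is one. *)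
Lemma trivial_set (z : fn) : uni z -> exists2 rho, b1 rho & fixw z rho /\
  forall M, invm M -> forall g, cb g -> M (fun n => ex (pw z n%:Z * g)) = ex (rho * g).
Proof.
move=> uz; have sz : stat mu (fun n => pw z n%:Z).
  split=> [n|n n' h]; first by bfn.
  rewrite !PoszD !pwD // cjM mulrACA uni_cjV ?mulr1 //; bfn.
have [r Hr [r1 _ _ _]] := mean_ergodic sz; exists r => //; split=> //.
have ic : invm (ces R) by apply: ces_inv.
apply: ex_sep; bfn => g Hg.
rewrite -!(r1 _ ic) ?[z * r]mulrC -?mulrA -?(r1 _ ic); try by bfn.
rewrite -[RHS](invm_add 1 ic); last by apply: bdd_exb => n; bfn.
by apply: eq_mean => n; rewrite PoszD pwD // pw1 mulrA.
Qed.

(** The eigenvalues are functions, so that the top coefficient of the phase is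
trivial only on part of the space. The part of [u] where no bounded power of it
is trivial has a small average by [weyl_top]; on the rest, a progression removes
the top coefficient and the induction hypothesis applies. *)
Theorem weyl d P (e : R) : 0 < e -> (forall j, ipoly (P j)) -> (forall j, size (P j) <= d.+1)%N ->
  exists K : nat, forall M lm u, invm M -> (forall j, uni (lm j)) -> b1 u ->
    e <= M (fun n => ex (u * phase lm P n)) ->
    exists a b w g, [/\ (0 < a <= K)%N, (b <= K)%N, b1 w, b1 g &
      e / 2 ^+ d.+1 <= ex (u * w * g) /\
      forall n, fixw (pv lm (fun j => ev (P j) (a * n + b) - ev (P j) b)) w].
Proof.
elim: d P e => [|d IH] P e e0 iP sP.
  exists 1%N => M lm u iM ul Hu eM.
  have [n hn] := mean_ex_ge (bdd_exb mu (F := fun n => u * phase lm P n) (fun n => b1M Hu (uni_b1 (uni_pv _ ul)))) e0 eM.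
  exists 1%N, 0%N, 1, (phase lm P n); split=> //; [by bfn|by rewrite /phase; bfn|].
  split=> [|m]; first by rewrite mulr1.
  rewrite /pv big1; first exact: fixw1.
  by move=> j _; rewrite !(ev_const _ (sP j)) subrr.
have e4 : 0 < e / 4 by rewrite divr_gt0.
have [W W0 HW] := weyl_top e4 iP sP.
pose a0 := (W * d.+1`!)%N.
have a00 : (0 < a0)%N by rewrite muln_gt0 W0 fact_gt0.
pose c j := (P j)`_d.+1 * a0%:R ^+ d.+1.
pose m1 := (W ^ d * d.+1`! ^ d)%N.
have cE j : c j = (topc (P j) d.+1 * (W%:Z * m1%:Z))%:~R.
  rewrite !intrM topcE // /c /a0 natrM exprMn.
  have -> : (W%:Z)%:~R = W%:R :> R by [].
  have -> : (m1%:Z)%:~R = W%:R ^+ d * d.+1`!%:R ^+ d :> R by rewrite -[LHS]/(m1%:R) /m1 natrM !natrX.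
  by rewrite !exprS; ring.
clearbody a0 m1.
pose P' b j := (P j) \Po (a0%:R *: 'X + b%:R%:P) - c j *: 'X^(d.+1).
have evP' b j n : ev (P j) (n * a0 + b) = ev (P' b j) n + topc (P j) d.+1 * (W%:Z * m1%:Z) * (n ^ d.+1)%N%:Z.
  suff ip' : (P' b j).[n%:R] = (ev (P j) (n * a0 + b) - topc (P j) d.+1 * (W%:Z * m1%:Z) * (n ^ d.+1)%N%:Z)%:~R.
    by rewrite (ev_eq ip') subrK.
  rewrite intrB [(_ * _ * (n ^ _)%N%:Z)%:~R]intrM -cE ev_inj // /P' !hornerE horner_comp !hornerE.
  have -> : ((n ^ d.+1)%N%:Z)%:~R = n%:R ^+ d.+1 :> R by rewrite -natrX.
  by rewrite natrD natrM [n%:R * a0%:R]mulrC.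
have iP' b j : ipoly (P' b j).
  move=> m; rewrite /P' !hornerE horner_comp !hornerE cE rpredB //.
    by have := iP j (a0%:Z * m + b%:Z); rewrite rmorphD rmorphM.
  by rewrite rpredM ?intr_int // rpredX ?intr_int.
have sP' b j : (size (P' b j) <= d.+1)%N.
  have szl : (size (a0%:R *: 'X + b%:R%:P : {poly R})%R <= 2)%N.
    apply: leq_trans (size_polyD _ _) _; rewrite geq_max (leq_trans (size_polyC_leq1 _)) // andbT.
    by apply: leq_trans (size_scale_leq _ _) _; rewrite size_polyX.
  apply/leq_sizeP => i; rewrite leq_eqVlt => /orP[/eqP<-|di]; last first.
    rewrite coefB coefZ coefXn gtn_eqF // mulr0 subr0 nth_default //.
    apply: leq_trans (size_comp_poly_leq _ _) _.
    have h1 : ((size (P j)).-1 <= d.+1)%N by rewrite -subn1 leq_subLR add1n.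
    apply: leq_trans _ di; rewrite ltnS -[X in (_ <= X)%N]muln1.
    by apply: leq_mul => //; rewrite -subn1 leq_subLR addn1.
  clear i; rewrite coefB coefZ coefXn eqxx mulr1 comp_polyE coef_sum.
  have co l : (l <= d.+1)%N -> ((a0%:R *: 'X + b%:R%:P) ^+ l : {poly R})`_d.+1 = (l == d.+1)%:R * a0%:R ^+ l.
    move=> ld; have -> : a0%:R *: 'X + b%:R%:P = a0%:R *: ('X + (b%:R / a0%:R)%:P) :> {poly R}.
      rewrite scalerDr -[a0%:R *: (_ / _)%:P]mul_polyC -polyCM mulrCA divff ?mulr1 //.
      by rewrite pnatr_eq0 -lt0n.
    rewrite exprZn coefZ coef_exp_XaddC.
    have [->|ne] := eqVneq l d.+1; first by rewrite subnn binn expr0 mulr1 mul1r.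
    by rewrite bin_small ?mulr0n ?mulr0 ?mul0r // ltn_neqAle ne.
  rewrite (eq_bigr (fun i : 'I_(size (P j)) => (P j)`_i * ((nat_of_ord i == d.+1)%:R * a0%:R ^+ i))); last first.
    by move=> i _; rewrite coefZ co // -ltnS; apply: leq_trans (ltn_ord i) (sP j).
  have [sz|sz] := ltnP d.+1 (size (P j)).
    rewrite (bigD1 (Ordinal sz)) //= eqxx mul1r big1 ?addr0 ?subrr // => i /eqP ne.
    have [ie|_] := eqVneq (nat_of_ord i) d.+1; last by rewrite mul0r mulr0.
    by case: ne; apply/val_inj.
  rewrite /c nth_default // mul0r subr0 big1 // => i _.
  by rewrite ltn_eqF ?mul0r ?mulr0 //; apply: leq_trans (ltn_ord i) sz.
have e2 : 0 < e / 2 by rewrite divr_gt0.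
have ch b := cid (IH (P' b) _ e2 (iP' b) (sP' b)).
pose Kb b := sval (ch b).
have HKb b := svalP (ch b).
exists (\sum_(b < a0) (a0 * Kb b + b) + a0)%N => M lm u iM ul Hu eM.
pose th := pv lm (fun j => topc (P j) d.+1).
have uth : uni th by apply: uni_pv.
have uz := uni_pw W%:Z uth.
have [rho Hr [zr rE]] := trivial_set uz.
have phb n : b1 (phase lm P n) by apply/uni_b1/uni_pv.
have small : M (fun n => ex (cc (2^-1) * (u - u * rho) * phase lm P n)) < e / 4.
  have b : b1 (cc (2^-1) * (u - u * rho)).
    have -> : cc (2^-1) * (u - u * rho) = avgF 1 (fun i => if i is 0%N then u else - (u * rho)).
      by rewrite /avgF !big_ord_recr big_ord0 /= add0r.
    by apply: b1_avgF => -[|_] //; bfn.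
  apply: HW => //; rewrite -/th => M' iM' g Hg.
  have -> : (fun n => ex (cc 2^-1 * (u - u * rho) * g * pw (pw th W) n%:Z)) =
     (fun n => 2^-1 * (ex (pw (pw th W) n%:Z * (u * g)) - ex (rho * (u * g)))).
    apply/funext => n.
    have -> : cc 2^-1 * (u - u * rho) * g * pw (pw th W) n%:Z =
      cc 2^-1 * (pw (pw th W) n%:Z * (u * g) - pw (pw th W) n%:Z * rho * (u * g)) by ring.
    rewrite exZ ?exB; try by bfn.
    by rewrite [X in _ - X]fixw_ex //; bfn; apply: fixw_pw.
  have bz : bdd (fun n : nat => ex (pw (pw th W) n%:Z * (u * g))) by apply: bdd_exb => n; bfn.
  rewrite meanZ; last by apply: bddB.
  by rewrite meanB // mean_cst rE ?subrr ?mulr0 //; bfn.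
have big : e / 2 <= M (fun n => ex (u * rho * phase lm P n)).
  move: small eM.
  have -> : (fun n => ex (cc 2^-1 * (u - u * rho) * phase lm P n)) =
     (fun n => 2^-1 * (ex (u * phase lm P n) - ex (u * rho * phase lm P n))).
    apply/funext => n; rewrite -mulrA exZ; last by have := phb n; bfn.
    by rewrite mulrBl exB //; have := phb n; bfn.
  have b1' : bdd (fun n => ex (u * phase lm P n)) by apply: bdd_exb => n; have := phb n; bfn.
  have b2' : bdd (fun n => ex (u * rho * phase lm P n)) by apply: bdd_exb => n; have := phb n; bfn.
  rewrite meanZ ?meanB //; last exact: bddB.
  lra.
have bb : bdd (fun n => ex (u * rho * phase lm P n)) by apply: bdd_exb => n; have := phb n; bfn.
have [b ba [M' iM']] := dil_exists iM a0.-1 bb big; rewrite prednK // => {}big.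
rewrite -ltnS prednK // in ba.
have zm n : fixw (pw th (W%:Z * m1%:Z * n%:Z)) rho.
  rewrite -mulrA pwM //; exact: fixw_pw.
have [|a' [b' [w [g [/andP[a'0 a'K] b'K Hw Hg [eg fx]]]]]] := HKb b M' lm (u * rho) iM' ul (b1M Hu Hr) _.
  apply: le_trans big _; apply: eqW; apply: eq_mean => n.
  have -> : phase lm P (n * a0 + b) = phase lm (P' b) n * pw th (W%:Z * m1%:Z * (n ^ d.+1)%N%:Z).
    rewrite /phase /th -pv_pw // -pvD //; apply: eq_pv => j; rewrite evP'; ring.
  have pb : b1 (phase lm (P' b) n) by apply/uni_b1/uni_pv.
  have := @fixw_ex _ rho (u * phase lm (P' b) n) _ Hr _ (zm (n ^ d.+1)%N).
  have -> : u * rho * phase lm (P' b) n = rho * (u * phase lm (P' b) n) by ring.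
  move=> <-; [|by bfn|by bfn]; congr ex; ring.
exists (a0 * a')%N, (a0 * b' + b)%N, (rho * w), g.
have Kle : (a0 * Kb b + b <= \sum_(b < a0) (a0 * Kb b + b))%N.
  by rewrite (bigD1 (Ordinal ba)) //= leq_addr.
split; [| |by bfn|by []|].
- rewrite muln_gt0 a00 a'0 /=; apply: leq_trans _ (leq_addr _ _); apply: leq_trans _ Kle.
  by apply: leq_trans (leq_addr _ _); rewrite leq_mul2l a'K orbT.
- apply: leq_trans _ (leq_addr _ _); apply: leq_trans _ Kle.
  by rewrite leq_add2r leq_mul2l b'K orbT.
split.
  apply: le_trans (_ : e / 2 / 2 ^+ d.+1 <= _); first by rewrite exprS invfM mulrA.
  by rewrite mulrA.
move=> n.
pose mm := ((a' * n + b') ^ d.+1 - b' ^ d.+1)%N.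
have -> : pv lm (fun j => ev (P j) (a0 * a' * n + (a0 * b' + b)) - ev (P j) (a0 * b' + b)) =
  pw th (W%:Z * m1%:Z * mm%:Z) * pv lm (fun j => ev (P' b j) (a' * n + b') - ev (P' b j) b').
  rewrite /th -pv_pw // -pvD //; apply: eq_pv => j.
  have -> : (a0 * a' * n + (a0 * b' + b) = (a' * n + b') * a0 + b)%N by ring.
  rewrite [(a0 * b')%N]mulnC !evP' /mm -subzn ?leq_exp2r ?leq_addl //; ring.
have up : b1 (pv lm (fun j => ev (P' b j) (a' * n + b') - ev (P' b j) b')) by apply/uni_b1/uni_pv.
rewrite /fixw mulrACA; apply: aeqMM; bfn; [exact: zm|exact: fx].
Qed.

End Weyl.
End Phases.
#[global] Hint Resolve uni_b1 uni_pw uniM uni1 uni_cj uni_sh : bfn.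

(** * Averages over eigenfunctions, and single polynomials *)

Section Lattice.
Variable R : realType.

Lemma common_den (I : finType) (x : I -> rat) : exists2 D : nat, (0 < D)%N & forall i, exists z : int, D%:R * x i = z%:~R.
Proof.
suff [D D0 HD] : exists2 D : nat, (0 < D)%N & forall i, i \in enum I -> exists z : int, D%:R * x i = z%:~R.
  by exists D => // i; apply: HD; rewrite mem_enum.
elim: (enum I) => [|i s [D D0 HD]]; first by exists 1%N.
exists (D * `|denq (x i)|)%N; first by rewrite muln_gt0 D0 absz_gt0 denq_neq0.
have dE : (`|denq (x i)|)%:R = (denq (x i))%:~R :> rat by rewrite -[in RHS](gez0_abs (ltW (denq_gt0 (x i)))).
move=> j; rewrite inE => /orP[/eqP->|/HD[z hz]].
  exists (D%:Z * numq (x i)); rewrite natrM intrM dE -mulrA; congr (_ * _).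
  by rewrite -[X in _ * X = _](divq_num_den (x i)) mulrC divfK // intr_eq0 denq_neq0.
exists (z * denq (x i)); rewrite natrM dE intrM -hz; ring.
Qed.

Definition rindep (k : nat) (p : 'I_k -> {poly R}) :=
  forall c : 'I_k -> int, (exists i, c i != 0) -> forall a : R, \sum_(i < k) (c i)%:~R *: p i <> a%:P.

Variables (k : nat) (p : 'I_k -> {poly R}).
Hypotheses (ip : forall i, ipoly (p i)) (pI : rindep p).

Lemma rindep_nc i : nc (p i).
Proof.
rewrite /nc ltnNge; apply/negP => /size1_polyC e.
apply: (pI (c := fun j => (j == i)%:R)) (p i)`_0 _; first by exists i; rewrite eqxx.
rewrite (bigD1 i) //= eqxx -e scale1r big1 ?addr0 // => j /negbTE ->.
by rewrite scale0r.
Qed.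

Lemma rindep_ncB i j : i != j -> nc (p i - p j).
Proof.
move=> ij; rewrite /nc ltnNge; apply/negP => /size1_polyC e.
apply: (pI (c := fun l => (l == i)%:R - (l == j)%:R)) (p i - p j)`_0 _.
  by exists i; rewrite eqxx (negbTE ij).
have ji : j != i by rewrite eq_sym.
rewrite (bigD1 i) //= (bigD1 j) //= !eqxx (negbTE ij) (negbTE ji) -e.
rewrite subr0 sub0r scale1r scaleN1r big1 ?addr0 // => l /andP[/negbTE -> /negbTE ->].
by rewrite subrr scale0r.
Qed.

(** A rational relation between the values along a progression would hold between
the polynomials up to a constant, as there are more values than coefficients. So
the matrix of the values has full row rank; clearing the denominators of a right
inverse gives [s]. *)
Lemma lattice (a b : nat) : (0 < a)%N -> exists2 D : nat, (0 < D)%N & forall j, exists s : seq (nat * int),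
  forall i, \sum_(n <- s) (ev (p i) (a * n.1 + b) - ev (p i) b) * n.2 = D%:Z * (i == j)%:R.
Proof.
move=> a0; pose S := (\max_(i < k) size (p i))%N.
pose q i (n : nat) := ev (p i) (a * n + b) - ev (p i) b.
pose A : 'M[rat]_(k, S.+1) := \matrix_(i, n) (q i n)%:~R.
have /row_freeP[B AB] : row_free A.
  rewrite -kermx_eq0; apply/negPn/negP => /rowV0Pn[v /sub_kermxP vA v0].
  have [D D0 HD] := common_den (fun i => v 0 i).
  have [c cE] := choice HD.
  have c0 : exists i, c i != 0.
    have [i vi] : exists i, v 0 i != 0.
      apply: contrapT => no; case/negP: v0; apply/eqP/rowP => i; rewrite mxE.
      by apply/eqP; apply: contrapT => vi; apply: no; exists i; apply/negP.
    exists i; rewrite -(intr_eq0 rat) -cE mulf_neq0 // pnatr_eq0 -lt0n //.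
  pose g := \sum_(i < k) (c i)%:~R *: p i.
  have gE n : (n < S.+1)%N -> g.[(a * n + b)%:R] = g.[b%:R].
    move=> nS; apply/eqP; rewrite -subr_eq0 /g !horner_sum -sumrB.
    have : \sum_i c i * q i n = 0.
      apply: (intr_inj (R := rat)); rewrite rmorph_sum /=.
      have := congr1 (fun m : 'rV_ _ => D%:R * m 0 (Ordinal nS)) vA; rewrite !mxE mulr0 mulr_sumr => vE.
      apply: etrans vE.
      by apply: eq_bigr => i _; rewrite mxE intrM -cE mulrA.
    move=> /(congr1 (intmul (1 : R))); rewrite rmorph_sum /= => e; apply/eqP; apply: etrans e; apply: eq_bigr => i _.
    by rewrite !hornerZ intrM /q intrB !ev_inj // mulrBr.
  apply: (pI c0) g.[b%:R] _; apply/eqP; rewrite -subr_eq0; apply/eqP.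
  rewrite -/g; set h := g - _.
  pose rs := [seq (a * n + b)%:R : R | n <- iota 0 S.+1].
  apply: (@roots_geq_poly_eq0 _ h rs).
  - apply/allP => x /mapP[n]; rewrite mem_iota add0n => /andP[_ nS] ->.
    by rewrite /root /h !hornerE gE // subrr.
  - rewrite map_inj_uniq ?iota_uniq // => m n /eqP; rewrite eqr_nat eqn_add2r eqn_mul2l.
    by rewrite gtn_eqF //= => /eqP.
  rewrite size_map size_iota; apply: leq_trans (size_polyD _ _) _.
  rewrite size_polyN geq_max (leq_trans (size_polyC_leq1 _)) // andbT.
  apply: leq_trans (size_sum _ _ _) _; apply/bigmax_leqP => i _.
  apply: leq_trans (size_scale_leq _ _) _; apply: leq_trans _ (leqnSn _).
  exact: (leq_bigmax_cond (F := fun i => size (p i))).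
have [D D0 HD] := common_den (fun x : 'I_S.+1 * 'I_k => B x.1 x.2).
have [c cE] := choice HD.
exists D => // j; exists [seq (nat_of_ord n, c (n, j)) | n <- enum 'I_S.+1] => i.
rewrite big_map big_enum /=; apply: (intr_inj (R := rat)).
rewrite rmorph_sum intrM /=.
have := congr1 (fun m : 'M_ _ => D%:R * m i j) AB; rewrite !mxE mulr_sumr => e.
transitivity (D%:R * (i == j)%:R : rat); last by congr (_ * _); case: (i == j).
rewrite -e; apply: eq_bigr => n _; rewrite mxE intrM -(cE (n, j)) /= /q; ring.
Qed.

(** By induction on the degree, the leading coefficient being an integer divided by a
factorial because the iterated differences are integers. *)
Lemma int_coefs (q : {poly R}) : ipoly q -> exists2 D : nat, (0 < D)%N & forall i, (D%:R * q`_i) \is a Num.int.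
Proof.
have [n] := ubnP (size q); elim: n q => // n IH q sq iq.
case E: (size q) => [|d].
  by exists 1%N => // i; rewrite nth_default ?mulr0 ?E // rpred0.
have tE : (topc q d)%:~R = d`!%:R * q`_d by apply: topcE; rewrite ?E.
pose q' := d`!%:R *: q - (topc q d)%:~R *: 'X^d.
have [|m|D D0 HD] := IH q'.
- rewrite (@leq_trans d.+1) //; last by rewrite -E -ltnS.
  rewrite ltnS; apply/leq_sizeP => j; rewrite leq_eqVlt => /orP[/eqP<-|dj].
    by rewrite /q' coefB !coefZ coefXn eqxx mulr1 tE subrr.
  by rewrite /q' coefB !coefZ coefXn gtn_eqF // mulr0 subr0 nth_default ?mulr0 ?E.
- by rewrite /q' !hornerE rpredB // rpredM ?rpred_nat ?intr_int ?rpredX ?intr_int.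
exists (D * d`!)%N; first by rewrite muln_gt0 D0 fact_gt0.
move=> i; have := HD i; rewrite /q' coefB !coefZ coefXn mulrBr => h.
rewrite natrM -mulrA -[X in X \is a _](subrK (D%:R * ((topc q d)%:~R * (i == d)%:R))).
by rewrite rpredD // !rpredM ?rpred_nat ?intr_int.
Qed.

(** Rational coefficients with denominator [D] make the values along progressions of
step [D * W] congruent modulo [W]. *)
Lemma divis (q : {poly R}) : ipoly q -> exists2 D : nat, (0 < D)%N & forall W n b : nat,
  exists z : int, ev q (D * W * n + b) - ev q b = z * W%:Z.
Proof.
move=> iq; have [D D0 HD] := int_coefs iq; exists D => // W n b.
have [c cE] : exists c : nat -> int, forall i, D%:R * q`_i = (c i)%:~R.
  by exists (fun i => Num.floor (D%:R * q`_i)) => i; rewrite floorK.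
have hh (x y i : nat) : exists z : int, ((x + y)%N%:Z ^+ i - y%:Z ^+ i = z * x%:Z).
  exists (\sum_(l < i) (x + y)%N%:Z ^+ (i.-1 - l) * y%:Z ^+ l).
  by rewrite subrXX [in X in X * _ = _]PoszD addrK mulrC; congr (_ * _); case: (i) => [|i']; rewrite ?big_ord0 //; apply: eq_bigr => l _; rewrite subSS.
have [z zE] := choice (hh (D * W * n)%N b).
exists (\sum_(i < size q) c i * (z i * n%:Z)).
apply: (intr_inj (R := R)); rewrite intrB !ev_inj // !horner_coef -sumrB intrM rmorph_sum /= mulr_suml.
have D0' : D%:R != 0 :> R by rewrite pnatr_eq0 -lt0n.
apply: (mulfI D0'); rewrite !mulr_sumr; apply: eq_bigr => i _.
rewrite -mulrBr [LHS]mulrA. rewrite cE !intrM.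
have := congr1 (intmul (1 : R)) (zE i); rewrite intrB !rmorphXn /= intrM => e.
have nE (x : nat) : (x%:Z)%:~R = x%:R :> R by [].
rewrite !nE in e *; rewrite e !natrM; ring.
Qed.

End Lattice.

Section Eigen0.
Variables (R : realType) (mu : sys R).
Local Notation fn := (fn R).
Local Notation ex := (ex mu).
Local Notation nn := (nn mu).
Local Notation aeq := (aeq mu).
Local Notation ti := (ti mu).
Local Notation nu := (nu mu).
Local Notation eig := (eig mu).
Implicit Types (f g u w lam : fn) (M : mean R nat) (z : int).
Variables (k : nat) (p : 'I_k -> {poly R}).
Hypotheses (ip : forall i, ipoly (p i)) (pI : rindep p).

Definition av M f0 (f : 'I_k -> fn) : R := M (fun n => ex (f0 * \prod_j sh (ev (p j) n) (f j))).

Lemma fixw_sum (lm : 'I_k -> fn) (q : 'I_k -> nat -> int) (s : seq (nat * int)) w :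
  (forall j, uni (lm j)) -> b1 w -> (forall n, fixw mu (pv lm (fun j => q j n)) w) ->
  fixw mu (pv lm (fun i => \sum_(n <- s) q i n.1 * n.2)) w.
Proof.
move=> ul Hw H; elim: s => [|[n z] s IH].
  by rewrite /pv big1; [exact: fixw1|move=> j _; rewrite big_nil].
rewrite (_ : pv lm _ = pw (pv lm (fun j => q j n)) z * pv lm (fun i => \sum_(n <- s) q i n.1 * n.2)); last first.
  by rewrite -pv_pw // -pvD //; apply: eq_pv => j; rewrite big_cons.
by apply: fixwM => //; try (by apply/uni_b1; auto using uni_pv, uni_pw); apply: fixw_pw => //; apply: uni_pv.
Qed.

(** By [weyl] there is a weight [w] on which all the phases are constant along some
progression of bounded step; as the polynomials are independent, [lattice] makes a
bounded power of each single eigenvalue trivial on [w], so that each eigenfunction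
has on [w] a bounded period. *)
Lemma eigen_av (e : R) : 0 < e -> exists2 W : nat, (0 < W)%N & exists2 eta : R, 0 < eta &
  forall M f0 (f : 'I_k -> fn), invm M -> b1 f0 -> (forall j, eig (f j)) -> e <= av M f0 f -> forall j, eta <= nu W (f j).
Proof.
move=> e0; pose d := (\max_(j < k) size (p j))%N.
have sp j : (size (p j) <= d.+1)%N.
  by apply: leq_trans _ (leqnSn _); apply: (leq_bigmax_cond (F := fun j => size (p j))).
have [K HK] := weyl mu e0 ip sp.
have ch (ab : nat * nat) : {D : nat | (0 < D)%N /\ ((0 < ab.1)%N -> forall j, exists s : seq (nat * int),
  forall i, \sum_(n <- s) (ev (p i) (ab.1 * n.1 + ab.2) - ev (p i) ab.2) * n.2 = D%:Z * (i == j)%:R)}.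
  apply: cid; case: (posnP ab.1) => [->|a0]; first by exists 1%N.
  by have [D D0 HD] := lattice ip pI ab.2 a0; exists D.
pose Dn ab := sval (ch ab).
have Dn0 ab : (0 < Dn ab)%N by case: (svalP (ch ab)).
have HDn ab := (svalP (ch ab)).2.
pose W := (\prod_(a < K.+1) \prod_(b < K.+1) Dn (nat_of_ord a, nat_of_ord b))%N.
have W0 : (0 < W)%N by apply: prodn_gt0 => a; apply: prodn_gt0.
exists W => //; exists ((e / 2 ^+ d.+1) ^+ 2); first by rewrite exprn_gt0 // divr_gt0 // exprn_gt0.
move=> M f0 f iM Hf0 ef eM j.
have [lm lmP] := choice ef.
have ul i : uni (lm i) by case: (lmP i).
have bf i : b1 (f i) by apply: eig_b1.
pose u := f0 * \prod_i f i.
have bP : b1 (\prod_i f i) by apply: b1_prod.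
have Hu : b1 u by rewrite /u; bfn.
have [|a [b [w [g [/andP[a0 aK] bK Hw Hg [eg fx]]]]]] := HK M lm u iM ul Hu.
  apply: le_trans eM _; apply: eqW; apply: eq_mean => n; rewrite /u -mulrA.
  have bA (l : seq 'I_k) : b1 (\prod_(i <- l) sh (ev (p i) n) (f i)) by apply: b1_prod => i _; bfn.
  have bB (l : seq 'I_k) : b1 (\prod_(i <- l) (pw (lm i) (ev (p i) n) * f i)).
    by apply: b1_prod => i _; bfn.
  rewrite mulrC [in RHS]mulrC.
  have -> : (\prod_i f i) * phase lm p n = \prod_i (pw (lm i) (ev (p i) n) * f i).
    by rewrite /phase /pv -big_split; apply: eq_bigr => i _; rewrite mulrC.
  apply: aeq_ex; bfn.
  elim: (index_enum _) => [|i l IH]; first by rewrite !big_nil; bfn.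
  rewrite !big_cons; apply: aeqMM; bfn.
  by have [_ tl el] := lmP i; apply: eigl_sh.
have fj : fixw mu (pw (lm j) W%:Z) w.
  have aK' : (a < K.+1)%N by []. have bK' : (b < K.+1)%N by [].
  have /dvdnP[m ->] : (Dn (a, b) %| W)%N.
    by rewrite /W (bigD1 (Ordinal aK')) //= (bigD1 (Ordinal bK')) //= -mulnA dvdn_mulr.
  rewrite mulnC PoszM pwM //; apply: fixw_pw; bfn.
  have [s sE] := HDn (a, b) a0 j.
  have := fixw_sum s ul Hw fx.
  rewrite (_ : pv lm _ = pw (lm j) (Dn (a, b))%:Z) //.
  rewrite (_ : pv lm _ = pv lm (fun i => (Dn (a, b))%:Z * (i == j)%:R)); last by apply: eq_pv => i; rewrite -sE.
  rewrite /pv (bigD1 j) //= eqxx mulr1 big1 ?mulr1 // => i /negbTE ->.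
  by rewrite mulr0.
pose g' := f0 * (\prod_(i | i != j) f i) * w * g.
have bP' : b1 (\prod_(i | i != j) f i) by apply: b1_prod.
have Hg' : b1 g' by rewrite /g'; bfn.
have hh := nu_inv mu W (@ces_inv R) (bf j) Hg'.
apply: le_trans hh.
have -> : ces R (fun n => ex (sh (W * n)%N (f j) * g')) = ex (u * w * g).
  rewrite -[RHS](mean_cst (ces R)); apply: eq_mean => n.
  have [_ tl el] := lmP j.
  have h1 : aeq (sh (W * n)%N (f j)) (pw (lm j) (W * n)%N * f j) by apply: eigl_sh.
  rewrite (aeq_ex _ _ _ h1); bfn.
  rewrite PoszM pwM //.
  have -> : pw (pw (lm j) W) n * f j * g' = pw (pw (lm j) W) n * w * (f j * (f0 * (\prod_(i | i != j) f i) * g)).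
    by rewrite /g'; ring.
  rewrite fixw_ex //; bfn; last by apply: fixw_pw; bfn.
  congr ex; rewrite /u [\prod_i f i](bigD1 j) //=; ring.
by rewrite lerXn2r ?nnegrE ?(le_trans _ eg) // ltW // divr_gt0 // exprn_gt0.
Qed.

(** ** Averages along a single polynomial *)
Lemma nu_lin (c : int) M u f : invm M -> b1 u -> b1 f -> M (fun n => ex (u * sh (c * n%:Z) f)) ^+ 2 <= nu `|c|%N f.
Proof.
move=> iM Hu Hf.
have st : stat mu (fun n => sh (c * n%:Z) f).
  split=> [n|n n' h]; first by bfn.
  rewrite !PoszD !mulrDr ![_ + c * h%:Z]addrC -!shsh cj_sh -shM sys_inv //; bfn.
have [r Hr [r1 _ r3 _]] := mean_ergodic st.
have -> : M (fun n => ex (u * sh (c * n%:Z) f)) = ex (r * u).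
  by rewrite -(r1 _ iM); bfn; apply: eq_mean => n; rewrite mulrC.
have <- : nn r = nu `|c|%N f.
  rewrite r3; apply: eq_mean => n; rewrite muln0 mulr0 !sh0.
  case: c {st r1 r3} => m; first by rewrite -PoszM.
  have -> : Negz m * n%:Z = - (m.+1 * n)%N%:Z by rewrite NegzE PoszM mulNr.
  rewrite -[LHS](@sys_inv _ mu (m.+1 * n)%N%:Z) ?shM ?shNK; last by bfn.
  by rewrite -ex_cj cjM mulrC -!cj_sh cjK.
by rewrite mulrC; apply: CS1; bfn.
Qed.

(** Van der Corput's inequality lowers the degree. In degree one the average is
governed by the projection to the functions of period the slope. *)
Lemma single (q : {poly R}) (e : R) : 0 < e -> ipoly q -> nc q -> exists2 W : nat, (0 < W)%N & exists2 eta : R, 0 < eta &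
  forall M u f, invm M -> b1 u -> b1 f -> e <= M (fun n => ex (u * sh (ev q n) f)) -> eta <= nu W f.
Proof.
have [d] := ubnP (size q); elim: d q e => // d IH q e sq e0 iq ncq.
have [sq2|sq2] := leqP (size q) 2.
  pose c := ev q 1 - ev q 0.
  have qE n : ev q n = c * n%:Z + ev q 0 by apply: ev_linear.
  have c0 : c != 0.
    apply: contraTneq ncq => c0; rewrite /nc -leqNgt.
    have h x : q.[x] = q`_0 + q`_1 * x.
      by rewrite (@horner_coef_wide _ 2) // !big_ord_recr big_ord0 /= expr0 mulr1 add0r expr1.
    have : c%:~R = 0 :> R by rewrite c0.
    rewrite /c intrB !ev_inj // !h mulr0 mulr1 addr0 addrAC subrr add0r => q1.
    by apply/leq_sizeP => -[//|[_|j _]] //; rewrite nth_default // (leq_trans sq2).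
  exists `|c|%N; first by rewrite absz_gt0.
  exists (e ^+ 2); first by rewrite exprn_gt0.
  move=> M u f iM Hu Hf eM; rewrite -(nu_sh mu `|c|%N (ev q 0)) //.
  apply: le_trans (nu_lin c iM Hu (b1_sh _ Hf)).
  have -> : (fun n => ex (u * sh (c * n%:Z) (sh (ev q 0) f))) = (fun n => ex (u * sh (ev q n) f)).
    by apply/funext => n; rewrite shsh -qE.
  by rewrite lerXn2r ?nnegrE ?(le_trans _ eM) // ltW.
have [H HH] := vdc_pick mu 1 e0.
have e2 : 0 < e ^+ 2 / 2 by rewrite divr_gt0 // exprn_gt0.
pose qh h := tr h q - q.
have [s sE] : exists s, size q = s.+3 by case: (size q) sq2 => [|[|[|s]]] // _; exists s.
have iqh h : ipoly (qh h) by apply: ipolyB => //; apply: ipoly_tr.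
have sqh h : (size (qh h) < d)%N.
  by apply: leq_ltn_trans (size_dif h (_ : size q <= s.+3)%N) _; [rewrite sE|move: sq; rewrite sE ltnS].
have nqh h : (0 < h)%N -> nc (qh h).
  move=> h0; rewrite /nc ltnNge; apply/negP => /leq_sizeP/(_ s.+1 isT).
  rewrite coefB coef_tr_sub ?sE // addrAC subrr add0r => /eqP.
  rewrite mulf_eq0 mulrn_eq0 /= pnatr_eq0 (gtn_eqF h0) orbF.
  have := lead_coef_eq0 q; rewrite /lead_coef sE /= => ->.
  by rewrite -size_poly_eq0 sE.
have ch h : {x : nat * R | [/\ (0 < x.1)%N, 0 < x.2 & (0 < h)%N -> forall M u f, invm M -> b1 u -> b1 f ->
    e ^+ 2 / 2 <= M (fun n => ex (u * sh (ev (qh h) n) f)) -> x.2 <= nu x.1 f]}.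
  apply: cid; case: (posnP h) => [->|h0]; first by exists (1%N, 1).
  by have [W W0 [eta eta0 HW]] := IH (qh h) _ (sqh h) e2 (iqh h) (nqh h h0); exists (W, eta).
pose W := (\prod_(h < H.+1) (sval (ch h)).1)%N.
pose eta := \big[Num.min/1]_(h < H.+1) (sval (ch h)).2.
exists W; first by apply: prodn_gt0 => h; case: (svalP (ch h)).
exists eta.
  rewrite /eta; elim/big_ind: _ => // [x y x0 y0|h _]; first by rewrite lt_min x0.
  by case: (svalP (ch h)).
move=> M u f iM Hu Hf eM.
have [||h [hH hb gh]] := HH M u (fun n => sh (ev q n) f) [:: 0%N] iM Hu _ _ eM; [by move=> n; bfn|by []|].
have h0 : (0 < h)%N by rewrite lt0n; move: hb; rewrite inE.
have [w0 x0 /(_ h0) Hh] := svalP (ch h).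
have hH' : (h < H.+1)%N by [].
apply: (@le_trans _ _ (sval (ch h)).2).
  by rewrite /eta (bigD1 (Ordinal hH')) //= ge_min lexx.
apply: (@le_trans _ _ (nu (sval (ch h)).1 f)); last first.
  by apply: nu_dvd => //; rewrite /W (bigD1 (Ordinal hH')) //= dvdn_mulr.
apply: (Hh M (cj f) f) => //; bfn; apply: le_trans gh _; apply: eqW; apply: eq_mean => n.
rewrite -[LHS](@sys_inv _ mu (- ev q n)); last by bfn.
rewrite shM cj_sh !shsh addNr sh0 mulrC; congr (ex (_ * _)); apply: eq_sh.
by rewrite /qh evB ?ev_tr 1?addrC //; apply: ipoly_tr.
Qed.

End Eigen0.

(** * Lowering the degree *)

Section ListMeans.
Variable R : realType.

Section Bind.
Variables (Y Z T : Type).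
Definition at_fun (y : Y) (f : Y -> R) : R := f y.
Fact at_spec y : {m : mean R Y | forall a, m a = a y}.
Proof. by exists (@Mean R Y (at_fun y) (fun f g c _ _ => erefl) (fun f _ h => h y) erefl). Qed.
Definition atm y : mean R Y := sval (at_spec y).
Lemma atmE y a : atm y a = a y. Proof. exact: (svalP (at_spec y)). Qed.

Variables (m1 : mean R Y) (m2 : Y -> mean R Z) (k : Y -> Z -> T).
Definition bind_fun (f : T -> R) : R := m1 (fun y => m2 y (fun z => f (k y z))).
Lemma bdd_bind f : bdd f -> bdd (fun y => m2 y (fun z => f (k y z))).
Proof. by move=> [K fK]; exists K => y; apply: mean_norm. Qed.
Fact bind_meanP f g c : bdd f -> bdd g -> bind_fun (fun y => f y + c * g y) = bind_fun f + c * bind_fun g.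
Proof.
move=> Hf Hg; rewrite /bind_fun -meanP; try exact: bdd_bind.
by apply: eq_mean => y; rewrite meanP //; apply: bdd_comp.
Qed.
Fact bind_ge0 f : bdd f -> (forall y, 0 <= f y) -> 0 <= bind_fun f.
Proof.
move=> Hf f0; apply: mean_ge0 => [|y]; first exact: bdd_bind.
by apply: mean_ge0 => //; apply: bdd_comp.
Qed.
Fact bind1 : bind_fun (fun=> 1) = 1.
Proof. by rewrite /bind_fun; under eq_mean do rewrite mean1; rewrite mean1. Qed.
Fact bind_spec : {m : mean R T | forall a, m a = m1 (fun y => m2 y (fun z => a (k y z)))}.
Proof. by exists (Mean bind_meanP bind_ge0 bind1). Qed.
Definition bindm : mean R T := sval bind_spec.
Lemma bindE a : bindm a = m1 (fun y => m2 y (fun z => a (k y z))).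
Proof. exact: (svalP bind_spec). Qed.
End Bind.

(** The differences are averaged over finite boxes [FE Hs], because only finite
averages commute with every other mean; the sizes of the boxes tend to infinity
one after the other in [IL]. *)
Fixpoint FE (Hs : seq nat) : mean R (seq nat) :=
  if Hs is H :: Hs' then bindm (avg R H) (fun=> FE Hs') cons else atm [::].
Fixpoint IL (r : nat) : mean R (seq nat) :=
  if r is r'.+1 then bindm (LIM R) (fun=> IL r') cons else atm [::].

Lemma FE0 a : FE [::] a = a [::]. Proof. exact: atmE. Qed.
Lemma FES H Hs a : FE (H :: Hs) a = avg R H (fun h => FE Hs (fun l => a (h :: l))).
Proof. exact: bindE. Qed.
Lemma IL0 a : IL 0 a = a [::]. Proof. exact: atmE. Qed.
Lemma ILS r a : IL r.+1 a = LIM R (fun H => IL r (fun Hs => a (H :: Hs))).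
Proof. exact: bindE. Qed.

Lemma FE_exists Hs (a : seq nat -> R) c : c <= FE Hs a -> exists l, c <= a l.
Proof.
elim: Hs a => [|H Hs IH] a; first by rewrite FE0; exists [::].
by rewrite FES => /avg_exists[h _ /IH[l hl]]; exists (h :: l).
Qed.

Lemma FE_swap (Y : Type) (m : mean R Y) Hs (a : Y -> seq nat -> R) K : (forall y l, `|a y l| <= K) ->
  m (fun y => FE Hs (a y)) = FE Hs (fun l => m (fun y => a y l)).
Proof.
elim: Hs a => [|H Hs IH] a aK.
  by rewrite FE0; apply: eq_mean => y; rewrite FE0.
rewrite FES; under eq_mean do rewrite FES.
rewrite mean_avg; first by apply: eq_mean => h; apply: IH.
by move=> h; apply: (@bdd_mean R _ _ _ _ K).
Qed.

Lemma IL_le r (a b : seq nat -> R) : bdd a -> bdd b -> (forall Hs, size Hs = r -> a Hs <= b Hs) -> IL r a <= IL r b.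
Proof.
elim: r a b => [|r IH] a b Ha Hb ab; first by rewrite !IL0 ab.
rewrite !ILS; apply: mean_le => [||H].
- by case: Ha => K aK; apply: (@bdd_mean R _ _ _ _ K).
- by case: Hb => K aK; apply: (@bdd_mean R _ _ _ _ K).
apply: IH => [||Hs s]; [exact: bdd_comp|exact: bdd_comp|by apply: ab; rewrite /= s].
Qed.

End ListMeans.
Arguments FE : simpl never.
Arguments IL : simpl never.

Section Boxes.
Variables (R : realType) (mu : sys R).
Local Notation fn := (fn R).
Local Notation ex := (ex mu).
Local Notation nn := (nn mu).
Local Notation aeq := (aeq mu).
Local Notation ti := (ti mu).
Local Notation nu := (nu mu).
Local Notation N := (N mu).
Local Notation ces := (ces R).
Local Notation eig := (eig mu).
Local Notation FE := (FE R).
Local Notation IL := (IL R).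
Implicit Types (f g u w lam : fn) (M : mean R nat) (z : int) (l : seq nat) (Hs : seq nat).

Fixpoint Ds (s : seq int) f : fn := if s is z :: s' then Ds s' (D z f) else f.

Lemma b1_Ds s f : b1 f -> b1 (Ds s f).
Proof. by elim: s f => //= z s IH f Hf; apply: IH; bfn. Qed.
Hint Resolve b1_Ds : bfn.
Lemma DsM s f g : Ds s (f * g) = Ds s f * Ds s g.
Proof. by elim: s f g => //= z s IH f g; rewrite DM IH. Qed.
Lemma Ds_sh s k f : Ds s (sh k f) = sh k (Ds s f).
Proof. by elim: s f => //= z s IH f; rewrite D_sh IH. Qed.
Lemma Ds_cj s f : Ds s (cj f) = cj (Ds s f).
Proof. by elim: s f => //= z s IH f; rewrite D_cj IH. Qed.
Lemma Ds_D s z f : Ds s (D z f) = D z (Ds s f).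
Proof. by elim: s f => //= y s IH f; rewrite DD IH. Qed.
Lemma Ds1 s : Ds s 1 = 1.
Proof. by elim: s => //= y s IH; rewrite /D cj1 sh1 mulr1. Qed.
Lemma Ds_prod (I : Type) (r : seq I) (P : pred I) (F : I -> fn) s :
  Ds s (\prod_(i <- r | P i) F i) = \prod_(i <- r | P i) Ds s (F i).
Proof. by apply: (big_morph (Ds s)) => [f g|]; [exact: DsM|exact: Ds1]. Qed.
Lemma eig_Ds s f : eig f -> eig (Ds s f).
Proof. by elim: s f => //= z s IH f Hf; apply: IH; apply: eig_D. Qed.

Definition Dl l f := Ds [seq h%:Z | h <- l] f.

Fixpoint dif l l' : seq int :=
  if l is h :: t then (h%:Z - (head 0%N l')%:Z) :: dif t (behead l') else [::].
(** The product over the vertices of a cube of a function that depends on a corner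
of the cube, in the pattern that [interchange] produces; [cobox] omits the factor
of the first corner. Lists that are too short are completed by zeros. *)
Fixpoint box (chi : seq nat -> fn) l l' : fn :=
  if l is h :: t then box (fun k => chi (h :: k)) t (behead l') *
    sh (h%:Z - (head 0%N l')%:Z) (cj (box (fun k => chi (head 0%N l' :: k)) t (behead l')))
  else chi [::].
Fixpoint cobox (chi : seq nat -> fn) l l' : fn :=
  if l is h :: t then cobox (fun k => chi (h :: k)) t (behead l') *
    sh (h%:Z - (head 0%N l')%:Z) (cj (box (fun k => chi (head 0%N l' :: k)) t (behead l')))
  else 1.

Lemma box_cobox chi l l' : box chi l l' = chi l * cobox chi l l'.
Proof.
elim: l chi l' => [|h t IH] chi l' /=; first by rewrite mulr1.
by rewrite IH mulrA.
Qed.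
Lemma b1_box chi l l' : (forall k, b1 (chi k)) -> b1 (box chi l l').
Proof. by elim: l chi l' => [|h t IH] chi l' Hc //=; bfn. Qed.
Hint Resolve b1_box : bfn.
Lemma eig_box chi l l' : (forall k, eig (chi k)) -> eig (box chi l l').
Proof.
elim: l chi l' => [|h t IH] chi l' Hc //=.
by apply: eigM; [exact: IH|apply/eig_sh/eig_cj; exact: IH].
Qed.
Lemma eig_cobox chi l l' : (forall k, eig (chi k)) -> eig (cobox chi l l').
Proof.
elim: l chi l' => [|h t IH] chi l' Hc /=; first by apply: eig_ti; [bfn|exact: ti1].
by apply: eigM; [exact: IH|apply/eig_sh/eig_cj; exact: eig_box].
Qed.
Lemma b1_cobox chi l l' : (forall k, b1 (chi k)) -> b1 (cobox chi l l').
Proof. by elim: l chi l' => [|h t IH] chi l' Hc /=; bfn. Qed.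
Hint Resolve b1_cobox : bfn.

(** Translating by [- h] turns [sh h u] into a factor that does not depend on [h];
the Cauchy--Schwarz inequality removes it, at the price of a second copy of the
average. *)
Lemma CS_shift H (A u : fn) (B : nat -> fn) : b1 A -> b1 u -> (forall h, b1 (B h)) ->
  avg R H (fun h => ex (A * sh h%:Z u * B h)) ^+ 2 <=
  avg R H (fun h => avg R H (fun h' =>
    ex (D (h%:Z - h'%:Z) A * (B h * sh (h%:Z - h'%:Z) (cj (B h')))))).
Proof.
move=> HA Hu HB; pose F h := sh (- h%:Z) (A * B h).
have cF h : cb (F h) by rewrite /F; bfn.
have -> : avg R H (fun h => ex (A * sh h%:Z u * B h)) = ex (u * avgF H F).
  rewrite avgFMl ex_avgF; last by bfn.
  apply: eq_mean => h; rewrite -[RHS](@sys_inv _ mu h%:Z); last by bfn.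
  by rewrite shM shNK; congr ex; ring.
apply: le_trans (CS1 _ Hu _) _; first by bfn.
rewrite nn_avgF //; apply: avg_le => h _; apply: avg_le => h' _; apply: eqW.
rewrite -[LHS](@sys_inv _ mu h%:Z); last by bfn.
rewrite /F shM shNK cj_sh shsh /D cjM shM; congr ex; ring.
Qed.

(** If [f] is the weak limit of [F n], then the iterated differences of [f] may be
replaced by those of [F n]. One [h] after the other: the factor [sh h (cj f)] of
the difference [D h f] is removed by [CS_shift] once the other factor has been
replaced, the finite average over [h] being moved inside the mean over [n]. *)
Lemma interchange M Hs f (F : nat -> fn) (chi : seq nat -> fn) : b1 f -> (forall n, b1 (F n)) -> (forall l, b1 (chi l)) ->
  (forall g, b1 g -> ex (f * g) = M (fun n => ex (F n * g))) ->
  FE Hs (fun l => ex (Dl l f * chi l)) ^+ (2 ^ size Hs) <=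
  FE Hs (fun l => FE Hs (fun l' => M (fun n => ex (Ds (dif l l') (F n) * box chi l l')))).
Proof.
elim: Hs f F chi => [|H Hs IH] f F chi Hf HF Hc fE.
  by rewrite !FE0 expr1 /= fE.
pose A h := FE Hs (fun l => ex (Dl l (D h%:Z f) * chi (h :: l))).
pose F' h n := F n * sh h%:Z (cj f).
have bF' h n : b1 (F' h n) by rewrite /F'; bfn.
pose B h := FE Hs (fun l => FE Hs (fun l' => M (fun n => ex (Ds (dif l l') (F' h n) * box (fun k => chi (h :: k)) l l')))).
have fE' h g : b1 g -> ex (D h%:Z f * g) = M (fun n => ex (F' h n * g)).
  move=> Hg; rewrite /D -mulrA fE; last by bfn.
  by apply: eq_mean => n; rewrite mulrA.
have AB h : A h ^+ (2 ^ size Hs) <= B h by apply: IH; bfn.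
rewrite FES /= expnS mulnC exprM.
have sq : (avg R H A ^+ (2 ^ size Hs)) ^+ 2 <= avg R H B ^+ 2.
  case: Hs {IH} @A @B AB => [|H' Hs] A B AB.
    rewrite expr1; apply: eqW; congr (_ ^+ 2); apply: eq_mean => h.
    by rewrite /A /B !FE0 /= fE'.
  have ev x : 0 <= x ^+ (2 ^ size (H' :: Hs)) :> R by rewrite exprn_even_ge0 // oddX.
  have h1 : avg R H A ^+ (2 ^ size (H' :: Hs)) <= avg R H B.
    apply: le_trans (mean_expn2 _ _ _) _; first by apply: (@bdd_mean R _ _ _ _ 1) => h l; apply: ex_b1; rewrite /Dl; bfn.
    exact: avg_le.
  by rewrite lerXn2r // nnegrE // (le_trans _ h1).
apply: le_trans sq _.
pose m := bindm (FE Hs) (fun=> bindm (FE Hs) (fun=> M) pair) pair.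
have mE (a : seq nat * (seq nat * nat) -> R) : m a = FE Hs (fun l => FE Hs (fun l' => M (fun n => a (l, (l', n))))).
  by rewrite bindE; apply: eq_mean => l; rewrite bindE.
pose P (x : seq nat * (seq nat * nat)) := Ds (dif x.1 x.2.1) (F x.2.2).
pose u (x : seq nat * (seq nat * nat)) := cj (Ds (dif x.1 x.2.1) f).
pose bx h (x : seq nat * (seq nat * nat)) := box (fun k => chi (h :: k)) x.1 x.2.1.
have bP x : b1 (P x) by rewrite /P; bfn.
have bu x : b1 (u x) by rewrite /u; bfn.
have bb h x : b1 (bx h x) by rewrite /bx; bfn.
have -> : avg R H B = m (fun x => avg R H (fun h => ex (P x * sh h%:Z (u x) * bx h x))).
  rewrite mean_avg; last by move=> h; apply: bdd_exb; bfn.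
  apply: eq_mean => h; rewrite mE; apply: eq_mean => l; apply: eq_mean => l'; apply: eq_mean => n.
  by rewrite /F' DsM Ds_sh Ds_cj.
apply: le_trans (mean_sqr _ _) _; first by apply: bdd_avg => h; apply: bdd_exb; bfn.
have cs x := CS_shift H (bP x) (bu x) (fun h => bb h x).
apply: le_trans (@mean_le R _ m _ _ _ _ cs) _.
- by apply: bddX; apply: bdd_avg => h; apply: bdd_exb; bfn.
- by apply: bdd_avg => h; apply: bdd_avg => h'; apply: bdd_exb; bfn.
apply: eqW; rewrite mean_avg; last by move=> h; apply: bdd_avg => h'; apply: bdd_exb; bfn.
rewrite FES; apply: eq_mean => h; rewrite mean_avg; last by move=> h'; apply: bdd_exb; bfn.
have -> : FE Hs (fun l => FE (H :: Hs) (fun l' => M (fun n => ex (Ds (dif (h :: l) l') (F n) * box chi (h :: l) l')))) =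
  FE Hs (fun l => avg R H (fun h' => FE Hs (fun l' => M (fun n => ex (Ds (dif (h :: l) (h' :: l')) (F n) * box chi (h :: l) (h' :: l')))))).
  by apply: eq_mean => l; rewrite FES.
rewrite [RHS]mean_avg; last first.
  move=> h'; apply: (@bdd_mean R _ _ _ _ 1) => l l'; apply: mean_norm => n; apply: ex_b1.
  by apply: b1M; [apply: b1_Ds|apply: b1_box].
apply: eq_mean => h'; rewrite mE; apply: eq_mean => l; apply: eq_mean => l'; apply: eq_mean => n.
by rewrite /= Ds_D.
Qed.

(** ** Functions of lower complexity *)

(** [V] is a product of functions each of which ignores one of the differences, up
to the shift by that difference. *)
Fixpoint lower (r : nat) (V : seq nat -> fn) : Prop :=
  if r is r'.+1 then exists V' b, [/\ forall h, lower r' (V' h), forall h l, b1 (V' h l), forall l, b1 (b l) &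
    forall h l, V (h :: l) = V' h l * sh h%:Z (b l)]
  else V [::] = 1.

Lemma lowerM r V V' : lower r V -> lower r V' -> lower r (fun l => V l * V' l).
Proof.
elim: r V V' => [|r IH] V V' /=; first by move=> -> ->; rewrite mulr1.
move=> [W [b [lW bW bb VE]]] [W' [b' [lW' bW' bb' VE']]].
exists (fun h l => W h l * W' h l), (fun l => b l * b' l); split=> [h|h l|l|h l]; try by bfn.
by rewrite VE VE' shM; ring.
Qed.
Lemma lower_cj r V : lower r V -> lower r (fun l => cj (V l)).
Proof.
elim: r V => [|r IH] V /=; first by move=> ->; rewrite cj1.
move=> [W [b [lW bW bb VE]]].
exists (fun h l => cj (W h l)), (fun l => cj (b l)); split=> [h|h l|l|h l]; try by bfn.
by rewrite VE cjM.
Qed.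
Lemma lower_sh r V k : lower r V -> lower r (fun l => sh k (V l)).
Proof.
elim: r V => [|r IH] V /=; first by move=> ->.
move=> [W [b [lW bW bb VE]]].
exists (fun h l => sh k (W h l)), (fun l => sh k (b l)); split=> [h|h l|l|h l]; try by bfn.
by rewrite VE shM !shsh addrC.
Qed.
Lemma lower_cobox r chi l' : (forall k, b1 (chi k)) -> lower r (fun l => cobox chi l l').
Proof.
elim: r chi l' => [|r IH] chi l' Hc //=.
exists (fun h l => cobox (fun k => chi (h :: k)) l (behead l')).
exists (fun l => sh (- (head 0%N l')%:Z) (cj (box (fun k => chi (head 0%N l' :: k)) l (behead l')))).
split=> [h|h l|l|h l]; try by bfn.
by rewrite shsh.
Qed.

(** The Cauchy--Schwarz--Gowers inequality: [CS_shift], applied once for each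
difference, removes the factors that ignore that difference, and at the end the
invariant factor is absorbed by [nu]. *)
Lemma gcs W Hs f V (P : seq nat -> fn) : b1 f -> lower (size Hs) V -> (forall l, b1 (V l)) ->
  (forall l, b1 (P l)) -> (forall l, ti W (P l)) ->
  FE Hs (fun l => ex (Dl l f * (V l * P l))) ^+ (2 ^ (size Hs).+1) <=
  FE Hs (fun l => FE Hs (fun l' => nu W (Ds (dif l l') f))).
Proof.
elim: Hs f V P => [|H Hs IH] f V P Hf /= lV bV bP tP.
  by rewrite !FE0 lV mul1r; apply: nu_ti.
case: lV => V' [b [lV' bV' bb VE]].
pose m := FE Hs.
pose B l h := V' h l * P (h :: l).
pose u l := cj (Dl l f) * b l.
have bA l : b1 (Dl l f) by rewrite /Dl; bfn.
have bB l h : b1 (B l h) by rewrite /B; bfn.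
have bu l : b1 (u l) by rewrite /u; bfn.
pose Z (h h' : nat) l := ex (D (h%:Z - h'%:Z) (Dl l f) * (B l h * sh (h%:Z - h'%:Z) (cj (B l h')))).
have bZ h h' : bdd (Z h h') by apply: bdd_exb => l; bfn.
rewrite expnS exprM.
have sq : FE (H :: Hs) (fun l => ex (Dl l f * (V l * P l))) ^+ 2 <= avg R H (fun h => avg R H (fun h' => m (Z h h'))).
  rewrite FES; have -> : avg R H (fun h => m (fun l => ex (Dl (h :: l) f * (V (h :: l) * P (h :: l))))) =
     m (fun l => avg R H (fun h => ex (Dl l f * sh h%:Z (u l) * B l h))).
    rewrite mean_avg; last by move=> h; apply: bdd_exb => l; bfn.
    apply: eq_mean => h; apply: eq_mean => l; congr ex.
    rewrite {1}/Dl /= Ds_D -/(Dl l f) VE /u /B shM /D; ring.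
  apply: le_trans (mean_sqr _ _) _; first by apply: bdd_avg => h; apply: bdd_exb; bfn.
  have cs l := CS_shift H (bA l) (bu l) (bB l).
  apply: le_trans (@mean_le R _ m _ _ _ _ cs) _.
  - by apply: bddX; apply: bdd_avg => h; apply: bdd_exb; bfn.
  - by apply: bdd_avg => h; apply: bdd_avg => h'; apply: bdd_exb; bfn.
  apply: eqW; rewrite mean_avg; last by move=> h; apply: bdd_avg => h'; apply: bZ.
  by apply: eq_mean => h; rewrite mean_avg // => h'; apply: bZ.
have ave_ge0 : 0 <= avg R H (fun h => avg R H (fun h' => m (Z h h'))) by apply: le_trans sq; apply: sqr_ge0.
apply: (@le_trans _ _ (avg R H (fun h => avg R H (fun h' => m (Z h h'))) ^+ (2 ^ (size Hs).+1))).
  by apply: lerXn2r; rewrite ?nnegrE // sqr_ge0.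
have bm h : bdd (fun h' => m (Z h h')) by apply: (@bdd_mean R _ _ _ _ 1) => k l; apply: ex_b1; bfn.
have bm2 : bdd (fun h => avg R H (fun h' => m (Z h h'))).
  by apply: (@bdd_mean R _ _ _ _ 1) => k l; apply: mean_norm => l'; apply: ex_b1; bfn.
have e2 := mean_expn2 (avg R H) (size Hs).+1 bm2.
apply: le_trans e2 _.
rewrite FES; apply: avg_le => h _; cbv beta.
apply: le_trans (mean_expn2 _ _ (bm h)) _.
have -> : FE Hs (fun l => FE (H :: Hs) (fun l' => nu W (Ds (dif (h :: l) l') f))) =
  FE Hs (fun l => avg R H (fun h' => FE Hs (fun l' => nu W (Ds (dif (h :: l) (h' :: l')) f)))).
  by apply: eq_mean => l; rewrite FES.
have nu1 g : b1 g -> `|nu W g| <= 1 by move=> Hg; rewrite ger0_norm ?nu_ge0 ?nu_le1.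
rewrite mean_avg; last first.
  by move=> h'; apply: (@bdd_mean R _ _ _ _ 1) => l l'; apply: nu1; bfn.
apply: avg_le => h' _ /=.
apply: le_trans (IH (D (h%:Z - h'%:Z) f) (fun l => V' h l * sh (h%:Z - h'%:Z) (cj (V' h' l)))
  (fun l => P (h :: l) * sh (h%:Z - h'%:Z) (cj (P (h' :: l)))) _ _ _ _ _); try by bfn.
- apply: eqW; congr (_ ^+ _); apply: eq_mean => l; rewrite /Z /B [in RHS]/Dl Ds_D -/(Dl l f); congr (ex (_ * _)).
  rewrite cjM shM; ring.
- by apply: lowerM => //; apply: lower_sh; apply: lower_cj.
- by move=> l; apply: tiM; bfn; apply: ti_sh; bfn; apply: ti_cj.
Qed.

(** ** Iterated seminorms as limits of finite averages *)
Fixpoint It (r : nat) (phi : fn -> R) f : R :=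
  if r is r'.+1 then ces (fun h => It r' phi (D h%:Z f)) else phi f.

Lemma It_norm r phi f : (forall g, b1 g -> `|phi g| <= 1) -> b1 f -> `|It r phi f| <= 1.
Proof. by move=> Hp; elim: r f => [|r IH] f Hf /=; [exact: Hp|apply: mean_norm => h; apply: IH; bfn]. Qed.

Lemma N_It r f : N r.+1 f = It r (N 1) f.
Proof. by elim: r f => // r IH f; apply: eq_mean => h; exact: IH. Qed.

Lemma It_nu r W f : b1 f -> It r.+1 (nu W.+1) f <= 2 * W.+1%:R * N r.+1 f.
Proof.
elim: r f => [|r IH] f Hf.
  have := ces_nu mu W Hf; rewrite ler_pdivrMr // => h; apply: le_trans h _.
  by rewrite mulrC mulrA.
have b : bdd (fun h : nat => N r.+1 (D h%:Z f)) by apply: bdd_N => h; bfn.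
rewrite /= -/(N r.+1) -meanZ //; apply: mean_le => [||h]; [|by auto|by apply: IH; bfn].
exists 1 => h; apply: (@It_norm r.+1) => [g Hg|]; last by bfn.
by rewrite ger0_norm ?nu_ge0 ?nu_le1.
Qed.

Lemma It_FE r phi f : (forall g, b1 g -> `|phi g| <= 1) -> b1 f ->
  IL r (fun Hs => FE Hs (fun l => phi (Dl l f))) = It r phi f.
Proof.
move=> Hp; elim: r f => [|r IH] f Hf; first by rewrite IL0 FE0.
rewrite ILS /= cesE; apply: eq_mean => H.
transitivity (IL r (fun Hs => avg R H (fun h => FE Hs (fun l => phi (Dl l (D h%:Z f)))))).
  by apply: eq_mean => Hs; rewrite FES.
rewrite mean_avg; first by apply: eq_mean => h; apply: IH; bfn.
by move=> h; exists 1 => Hs; apply: mean_norm => l; apply: Hp; rewrite /Dl; bfn.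
Qed.

Definition J W f Hs := FE Hs (fun l => FE Hs (fun l' => nu W (Ds (dif l l') f))).

Lemma nu_norm W f : b1 f -> `|nu W f| <= 1.
Proof. by move=> Hf; rewrite ger0_norm ?nu_ge0 ?nu_le1. Qed.

Lemma J_norm W f Hs : b1 f -> `|J W f Hs| <= 1.
Proof. by move=> Hf; apply: mean_norm => l; apply: mean_norm => l'; apply: nu_norm; bfn. Qed.

Lemma J_ge0 W f Hs : b1 f -> 0 <= J W f Hs.
Proof.
move=> Hf; apply: mean_ge_cst => [|l].
  by apply: (@bdd_mean R _ _ _ _ 1) => l l'; apply: nu_norm; bfn.
apply: mean_ge_cst => [|l']; last by apply: nu_ge0; bfn.
by exists 1 => l'; apply: nu_norm; bfn.
Qed.

Lemma J_cons W f H Hs : b1 f ->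
  J W f (H :: Hs) = avg R H (fun h => avg R H (fun h' => J W (D (h%:Z - h'%:Z) f) Hs)).
Proof.
move=> Hf; rewrite /J FES; apply: eq_mean => h.
transitivity (FE Hs (fun l => avg R H (fun h' => FE Hs (fun l' => nu W (Ds (dif (h :: l) (h' :: l')) f))))).
  by apply: eq_mean => l; rewrite FES.
rewrite mean_avg //.
by move=> h'; apply: (@bdd_mean R _ _ _ _ 1) => l l'; apply: nu_norm; bfn.
Qed.

Lemma J_abs W f Hs (h h' : nat) : b1 f -> J W (D (h%:Z - h'%:Z) f) Hs = J W (D `|h - h'|%N%:Z f) Hs.
Proof.
move=> Hf; have [k] : exists k, k = h%:Z - h'%:Z by exists (h%:Z - h'%:Z).
move=> <-; case: k => n //; apply: eq_mean => l; apply: eq_mean => l'.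
by rewrite NegzE D_opp Ds_sh Ds_cj nu_sh ?nu_cj //; bfn.
Qed.

(** The average over two copies of each difference is an average over their distance,
up to a factor two. *)
Lemma IL_J r W f : b1 f -> IL r (J W f) <= 2 ^+ r * It r (nu W) f.
Proof.
elim: r f => [|r IH] f Hf; first by rewrite IL0 /J !FE0 mul1r.
rewrite ILS /= cesE -meanZ; last by apply: bdd_avgH; exists 1 => h; apply: It_norm; bfn => g; apply: nu_norm.
apply: mean_le => [||H].
- by apply: (@bdd_mean R _ _ _ _ 1) => H Hs; apply: J_norm.
- by apply: bddM => //; apply: bdd_avgH; exists 1 => h; apply: It_norm; bfn => g; apply: nu_norm.
apply: (@le_trans _ _ (IL r (fun Hs => 2 * avg R H (fun h => J W (D h%:Z f) Hs)))).
  apply: mean_le => [||Hs].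
  - by exists 1 => Hs; apply: J_norm.
  - by apply: bddM => //; apply: bdd_avg => h; exists 1 => Hs; apply: J_norm; bfn.
  rewrite J_cons //.
  apply: le_trans (_ : avg R H (fun h => avg R H (fun h' => J W (D `|h - h'|%N%:Z f) Hs)) <= _).
    by apply: avg_le => h _; apply: avg_le => h' _; rewrite J_abs.
  by apply: (avg_fejer _ (a := fun n : nat => J W (D n%:Z f) Hs)) => n; apply: J_ge0; bfn.
rewrite meanZ; last by apply: bdd_avg => h; exists 1 => Hs; apply: J_norm; bfn.
rewrite exprS -mulrA ler_pM2l // -meanZ; last by exists 1 => h; apply: It_norm; bfn => g; apply: nu_norm.
rewrite mean_avg; last by move=> h; exists 1 => Hs; apply: J_norm; bfn.
by apply: avg_le => h _; apply: IH; bfn.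
Qed.

End Boxes.
#[global] Hint Resolve b1_Ds b1_box b1_cobox : bfn.

(** * Characteristic factors *)

Section Lowering.
Variables (R : realType) (mu : sys R).
Local Notation fn := (fn R).
Local Notation ex := (ex mu).
Local Notation nn := (nn mu).
Local Notation aeq := (aeq mu).
Local Notation ti := (ti mu).
Local Notation nu := (nu mu).
Local Notation N := (N mu).
Local Notation ces := (ces R).
Local Notation eig := (eig mu).
Local Notation eigl := (eigl mu).
Local Notation FE := (FE R).
Local Notation IL := (IL R).
Implicit Types (f g u w lam : fn) (M : mean R nat) (z : int) (l : seq nat) (Hs : seq nat).

Lemma ex_proj W f rho w : b1 f -> cb w -> ti W w ->
  (forall M, invm M -> forall g, cb g -> M (fun n => ex (sh (W * n)%N%:Z f * g)) = ex (rho * g)) ->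
  ex (rho * w) = ex (f * w).
Proof.
move=> Hf Hw tw rE; rewrite -(rE _ (@ces_inv R)) // -[RHS](mean_cst ces); apply: eq_mean => n.
have h := aeq_sym (ti_mul n Hw tw).
rewrite mulrC (aeq_ex _ _ _ h); bfn.
by rewrite mulrC -shM sys_inv //; bfn.
Qed.

Lemma nu0 W : nu W 0 = 0.
Proof. by rewrite -(mean_cst ces 0); apply: eq_mean => n; rewrite raddf0 mul0r ex0. Qed.

Lemma nn0 : nn 0 = 0. Proof. by rewrite !nnE mul0r ex0. Qed.

Lemma eigl_cj lam f : eigl lam f -> eigl (cj lam) (cj f).
Proof. by move=> [Hf ef]; split; [bfn|rewrite -cj_sh -cjM; apply: aeq_cj]. Qed.

Lemma eiglM lam lam' f g : b1 lam -> b1 lam' -> eigl lam f -> eigl lam' g -> eigl (lam * lam') (f * g).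
Proof.
move=> Hl Hl' [Hf ef] [Hg eg]; split; first by bfn.
by rewrite shM mulrACA; apply: aeqMM; bfn.
Qed.

(** The structure of the first nontrivial seminorm: a function that is not small for
[N 1] correlates with an eigenfunction. *)
Definition eigen_base := forall d : R, 0 < d -> exists2 d' : R, 0 < d' & forall g, b1 g -> d <= N 1 g ->
  exists lam chi0 beta, [/\ uni lam, uni chi0, ti 1 lam & aeq (sh 1 chi0) (lam * chi0)] /\
    [/\ b1 beta, ti 1 beta & d' <= ex (g * cj chi0 * cj beta)].

Hypothesis EB : eigen_base.

(** A correlation of [g] with [chi0 * beta] gives a function [chi], namely [chi0]
times the invariant projection of [g * cj chi0], which is the projection of [g]
to the eigenspace of [chi0]: both have the same integrals against the functions
of the conjugate eigenspace. This is why [chi] can later be replaced by [g] in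
front of any product of that kind. When [N 1 g] is small, [chi = 0] serves. *)
Lemma eig_pick (d : R) : 0 < d -> exists2 d1 : R, 0 < d1 & forall W g, b1 g -> exists chi,
  [/\ eig chi, d1 * (N 1 g - d) <= nn chi, ex (g * cj chi) = nn chi &
    forall V, eig V -> exists2 P, b1 P & ti W P /\ ex (g * (cj V * P)) = nu W (cj chi * V)].
Proof.
move=> d0; have [d' d'0 H] := EB d0; exists (d' ^+ 2); first by rewrite exprn_gt0.
move=> W g Hg; have [dN|Nd] := leP d (N 1 g); last first.
  exists 0; rewrite nn0 raddf0 mulr0 ex0; split=> //; first exact: eig0.
    by rewrite nmulr_lle0 ?subr_lt0 // sqr_ge0.
  move=> V eV; exists 0; first by bfn.
  by rewrite mul0r mulr0 mulr0 ex0 nu0; split=> //; apply: aeq_refl.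
have [lam [chi0 [beta [[ul uc tl ec] [Hb tb bE]]]]] := H g Hg dN.
have Hc : b1 chi0 by apply: uni_b1.
have Hl : b1 lam by apply: uni_b1.
have Hgc : b1 (g * cj chi0) by bfn.
have [rho Hr [r1 tr r3 _]] := proj mu 1 Hgc.
pose chi := chi0 * rho.
have Hchi : b1 chi by rewrite /chi; bfn.
have echi : eigl lam chi.
  split=> //; rewrite /chi shM mulrA; apply: aeqMM; bfn.
have key w : eigl (cj lam) w -> ex (g * w) = ex (chi * w).
  move=> [Hw ew]; have tw : ti 1 (chi0 * w).
    rewrite !tiE shM; have -> : chi0 * w = (lam * chi0) * (cj lam * w).
      by rewrite mulrACA uni_cjV // mul1r.
    by apply: aeqMM; bfn.
  have -> : chi * w = rho * (chi0 * w) by rewrite /chi; ring.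
  rewrite (ex_proj Hgc _ tw r1); bfn.
  by rewrite mulrA -[g * _ * _]mulrA [cj _ * _]mulrC uni_cjV // mulr1.
have nchi : nn chi = nn rho.
  by rewrite !nnE /chi cjM mulrACA (uni_cjV uc) mul1r.
exists chi; split.
- by exists lam.
- have h : d' ^+ 2 <= nn chi.
    have Hcb : b1 (cj beta) by bfn.
    have := CS1 mu Hcb (b1_cb Hr); rewrite nchi; apply: le_trans.
    rewrite mulrC (ex_proj Hgc _ (ti_cj tb) r1); bfn.
    by rewrite lerXn2r ?nnegrE ?(le_trans _ bE) // ltW.
  apply: le_trans h; rewrite ler_piMr ?sqr_ge0 // lerBlDr.
  by rewrite (le_trans (N_le1 _ _ Hg)) // lerDl ltW.
- by apply: key; apply: eigl_cj.
move=> V [lv [ulv tlv eV]].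
have HV : b1 V by case: eV.
have Hlv : b1 lv by apply: uni_b1.
have eG : eigl (cj lam * lv) (cj chi * V) by apply: eiglM => //; [bfn|exact: eigl_cj].
have HG : b1 (cj chi * V) by bfn.
have [P HP [p1 tP p3 _]] := proj mu W HG; exists P => //; split=> //.
have eP : eigl (cj lam * lv) P.
  by apply: (eig_proj _ _ eG HP p1); [bfn|apply: tiM; bfn; exact: ti_cj].
rewrite key; last first.
  have -> : cj lam = cj lv * (cj lam * lv) by rewrite mulrC -mulrA uni_cjV // mulr1.
  by apply: eiglM; bfn; apply: eigl_cj.
rewrite -p3 !nnE (ex_proj HG _ (ti_cj tP) p1); bfn.
rewrite -[RHS]ex_cj !cjM !cjK; congr ex; rewrite /chi; ring.
Qed.

Section Class.

(** Weak limits [f] of sequences [F n] whose differences are controlled by the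
seminorm [nu], once tested against eigenfunctions. *)
Variable cl : mean R nat -> (nat -> fn) -> Prop.
Hypothesis cl_b1 : forall M F, cl M F -> forall n, b1 (F n).
Hypothesis clE : forall e : R, 0 < e -> exists W, exists2 eta : R, 0 < eta & forall M F s G, cl M F -> eig G ->
  e <= M (fun n => ex (Ds s (F n) * G)) -> eta <= nu W.+1 G.

Definition repr M (F : nat -> fn) f := forall g, b1 g -> ex (f * g) = M (fun n => ex (F n * g)).

(** If many differences of [f] are large for [N 1], they correlate with
eigenfunctions [chi l], which [interchange] turns into a box of eigenfunctions
tested against the differences of [F n]. The hypothesis on [F n] makes [nu] of
these boxes large. Fixing one corner [l'], the box is [cj (chi l)] times a
function of lower complexity; by the choice of [chi l] in [eig_pick] the factor
[cj (chi l)] can be undone, so that [Dl l f] itself correlates with a product of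
a function of lower complexity and an invariant one, and [gcs] concludes. *)
Lemma lower_lists r (d : R) : 0 < d -> exists W, exists2 c : R, 0 < c & forall M F f Hs,
  cl M F -> b1 f -> repr M F f -> size Hs = r -> d <= FE Hs (fun l => N 1 (Dl l f)) -> c <= J mu W.+1 f Hs.
Proof.
move=> d0; have d20 : 0 < d / 2 by rewrite divr_gt0.
have [d1 d10 pick] := eig_pick d20.
pose c := d1 * (d / 2); have c0 : 0 < c by rewrite mulr_gt0.
pose e1 := c ^+ (2 ^ r) / 2; have e10 : 0 < e1 by rewrite divr_gt0 // exprn_gt0.
have [W [eta eta0 HE]] := clE e10.
pose y := eta * e1; have y0 : 0 < y by rewrite mulr_gt0.
exists W, (y ^+ (2 ^ r.+1)); first by rewrite exprn_gt0.
move=> M F f Hs cF Hf fE sH dF.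
have HF := cl_b1 cF.
have bD l : b1 (Dl l f) by rewrite /Dl; bfn.
have [chi chiP] := choice (fun l => pick W.+1 (Dl l f) (bD l)).
have ec l : eig (chi l) by case: (chiP l).
have bc l : b1 (chi l) by apply: eig_b1.
have bcc l : b1 (cj (chi l)) by bfn.
have h1 : c <= FE Hs (fun l => ex (Dl l f * cj (chi l))).
  apply: le_trans (_ : FE Hs (fun l => d1 * (N 1 (Dl l f) - d / 2)) <= _).
    rewrite meanZ; last by apply: bddB => //; apply: bdd_N.
    rewrite meanB ?mean_cst //; last by apply: bdd_N.
    rewrite /c ler_pM2l // lerBrDr; apply: le_trans dF; lra.
  apply: mean_le => [||l]; [by apply: bddM => //; apply: bddB => //; apply: bdd_N|by apply: bdd_exb; bfn|].
  by have [_ + ->] := chiP l.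
pose Gm l l' := M (fun n => ex (Ds (dif l l') (F n) * box (fun k => cj (chi k)) l l')).
have Gm1 l l' : `|Gm l l'| <= 1 by apply: mean_norm => n; apply: ex_b1; bfn.
have nub l l' : `|nu W.+1 (box (fun k => cj (chi k)) l l')| <= 1 by apply: nu_norm; bfn.
have h2 : c ^+ (2 ^ r) <= FE Hs (fun l => FE Hs (Gm l)).
  apply: le_trans (_ : FE Hs (fun l => ex (Dl l f * cj (chi l))) ^+ (2 ^ r) <= _).
    by apply: lerXn2r => //; rewrite nnegrE ?(le_trans _ h1) // ltW.
  by rewrite -{1}sH; apply: interchange.
have h3 : y <= FE Hs (fun l => FE Hs (fun l' => nu W.+1 (box (fun k => cj (chi k)) l l'))).
  apply: le_trans (_ : FE Hs (fun l => FE Hs (fun l' => eta * (Gm l l' - e1))) <= _).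
    have -> : FE Hs (fun l => FE Hs (fun l' => eta * (Gm l l' - e1))) = eta * (FE Hs (fun l => FE Hs (Gm l)) - e1).
      rewrite -[e1 in RHS](mean_cst (FE Hs)) -meanB //; last by exists 1 => l; apply: mean_norm.
      rewrite -meanZ; last by apply: bddB => //; exists 1 => l; apply: mean_norm.
      apply: eq_mean => l; rewrite meanZ; last by apply: bddB => //; exists 1.
      by rewrite meanB ?mean_cst //; exists 1.
    by rewrite /y ler_pM2l // lerBrDr; apply: le_trans h2; rewrite /e1; lra.
  apply: mean_le => [||l].
  - exists (`|eta| * (1 + `|e1|)) => l; apply: mean_norm => l'; rewrite normrM ler_wpM2l //.
    by apply: le_trans (ler_normB _ _) _; rewrite lerD2r.
  - by exists 1 => l; apply: mean_norm => l'.
  apply: mean_le => [||l'].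
  - by apply: bddM => //; apply: bddB => //; exists 1.
  - by exists 1.
  have ebx : eig (box (fun k => cj (chi k)) l l') by apply: eig_box => k; apply: eig_cj.
  have [eG|Ge] := leP e1 (Gm l l').
    apply: le_trans (HE _ _ _ _ cF ebx eG); rewrite ler_piMr ?(ltW eta0) //.
    by rewrite lerBlDr (le_trans (ler_norm _)) // (le_trans (Gm1 l l')) // lerDl ltW.
  apply: (@le_trans _ _ 0); last by apply: nu_ge0; bfn.
  by rewrite pmulr_rle0 // subr_le0 ltW.
move: h3; rewrite (@FE_swap R _ _ _ _ 1) // => /FE_exists[l' h3].
pose V l := cobox (fun k => cj (chi k)) l l'.
have eV l : eig (V l) by apply: eig_cobox => k; apply: eig_cj.
have bV l : b1 (V l) by apply: eig_b1.
have Pex l : exists P, [/\ b1 P, ti W.+1 P & ex (Dl l f * (cj (V l) * P)) = nu W.+1 (cj (chi l) * V l)].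
  by have [_ _ _ /(_ _ (eV l))[P bP [tP eP]]] := chiP l; exists P.
have [P PP] := choice Pex.
have h4 : y <= FE Hs (fun l => ex (Dl l f * (cj (V l) * P l))).
  apply: le_trans h3 _; apply: eqW; apply: eq_mean => l; have [_ _ ->] := PP l.
  by rewrite box_cobox.
apply: le_trans (_ : FE Hs (fun l => ex (Dl l f * (cj (V l) * P l))) ^+ (2 ^ r.+1) <= _).
  by apply: lerXn2r => //; rewrite nnegrE ?(le_trans _ h4) // ltW.
rewrite -{1}sH; apply: gcs => // [||l|l]; try by case: (PP l).
  by apply: lower_cj; apply: lower_cobox.
by move=> l; bfn.
Qed.

(** In the limit of large boxes, the average of [N 1] over the differences is the
seminorm of order [r.+2], whereas that of [nu] is bounded in terms of the one of
order [r.+1]. *)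
Lemma lower1 r (d : R) : 0 < d -> exists2 d' : R, 0 < d' & forall M F f,
  cl M F -> b1 f -> repr M F f -> d <= N r.+2 f -> d' <= N r.+1 f.
Proof.
move=> d0; have d20 : 0 < d / 2 by rewrite divr_gt0.
have [W [c c0 Hc]] := lower_lists r.+1 d20.
have C0 : 0 < 2 ^+ r.+1 * (2 * W.+1%:R) :> R by rewrite !mulr_gt0 // exprn_gt0.
exists (c * (d / 2) / (2 ^+ r.+1 * (2 * W.+1%:R))); first by rewrite divr_gt0 // mulr_gt0.
move=> M F f cF Hf fE dN; rewrite ler_pdivrMr // [leRHS]mulrC.
have h1 : c * (d / 2) <= IL r.+1 (J mu W.+1 f).
  pose x Hs := FE Hs (fun l => N 1 (Dl l f)).
  have xb Hs : 0 <= x Hs <= 1.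
    have b : bdd (fun l => N 1 (Dl l f)) by apply: bdd_N => l; rewrite /Dl; bfn.
    apply/andP; split; [apply: mean_ge_cst => // l; apply: N_ge0|apply: mean_le_cst => // l; apply: N_le1]; rewrite /Dl; bfn.
  have bx : bdd x by exists 1 => Hs; have /andP[a b] := xb Hs; rewrite ger0_norm.
  apply: (@le_trans _ _ (IL r.+1 (fun Hs => c * (x Hs - d / 2)))).
    rewrite meanZ; last by auto.
    rewrite meanB ?mean_cst // ler_pM2l // It_FE //; last first.
      by move=> g Hg; rewrite ger0_norm ?N_ge0 ?N_le1.
    by rewrite -N_It lerBrDr; apply: le_trans dN; lra.
  apply: IL_le => [||Hs sH]; [by auto|by exists 1 => Hs; apply: J_norm|].
  have /andP[x0 x1] := xb Hs.
  have [dx|xd] := leP (d / 2) (x Hs).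
    apply: le_trans (Hc _ _ _ _ cF Hf fE sH dx); rewrite ler_piMr ?(ltW c0) //; lra.
  by apply: (@le_trans _ _ 0); [rewrite pmulr_rle0 // subr_le0 ltW|exact: J_ge0].
apply: le_trans h1 _; apply: le_trans (IL_J _ _ _ Hf) _.
by rewrite -mulrA ler_pM2l ?exprn_gt0 // It_nu.
Qed.

Lemma lower_all s (d : R) : 0 < d -> exists2 d' : R, 0 < d' & forall M F f,
  cl M F -> b1 f -> repr M F f -> d <= N s f -> d' <= N 1 f.
Proof.
move=> d0; case: s => [|s].
  exists (d ^+ 2); first by rewrite exprn_gt0.
  move=> M F f _ Hf _ dN; apply: le_trans (N_mono _ _ Hf).
  by rewrite lerXn2r ?nnegrE ?(le_trans _ dN) // ltW.
elim: s d d0 => [|s IH] d d0; first by exists d.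
have [d1 d10 H1] := lower1 s d0; have [d' d'0 H2] := IH d1 d10.
by exists d' => // M F f cF Hf fE dN; apply: (H2 _ _ _ cF Hf fE); apply: (H1 _ _ _ cF Hf fE).
Qed.

End Class.

(** ** One slot at a time *)
Variables (k : nat) (p : 'I_k -> {poly R}).
Hypotheses (ip : forall i, ipoly (p i)) (pI : rindep p).
Local Notation av := (av mu p).
Implicit Types (F : 'I_k -> fn) (s : seq 'I_k).

Definition upd F m g : 'I_k -> fn := fun j => if j == m then g else F j.
Arguments upd : simpl never.

Lemma updE F m g : upd F m g m = g. Proof. by rewrite /upd eqxx. Qed.
Lemma updN F m g j : j != m -> upd F m g j = F j. Proof. by rewrite /upd => /negbTE->. Qed.

(** The average with a function in slot [m] is its integral against the weak limit of
these functions. *)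
Definition dual f0 F m (n : nat) : fn :=
  sh (- ev (p m) n) (f0 * \prod_(j | j != m) sh (ev (p j) n) (F j)).

Lemma b1_dual f0 F m n : b1 f0 -> (forall j, b1 (F j)) -> b1 (dual f0 F m n).
Proof. by move=> H0 HF; apply: b1_sh; apply: b1M => //; apply: b1_prod => j _; bfn. Qed.

Lemma av_dual M f0 F m g : b1 f0 -> (forall j, b1 (F j)) -> b1 g ->
  M (fun n => ex (dual f0 F m n * g)) = av M f0 (upd F m g).
Proof.
move=> H0 HF Hg; apply: eq_mean => n; have b := b1_dual m n H0 HF.
rewrite -[LHS](@sys_inv _ mu (ev (p m) n)); last by bfn.
rewrite shM /dual shNK [in RHS](bigD1 m) // updE /= -mulrA; congr (ex (_ * _)).
rewrite mulrC; congr (_ * _).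
by apply: eq_bigr => j jm; rewrite updN.
Qed.

Lemma upd_id F m : upd F m (F m) = F.
Proof. by apply/funext => j; rewrite /upd; case: eqP => [->|]. Qed.

(** This is proved by induction on the list [s] of the slots whose functions are
arbitrary. *)
Definition ctrl s := forall e : R, 0 < e -> exists W, exists2 eta : R, 0 < eta & forall M f0 F,
  invm M -> b1 f0 -> (forall j, b1 (F j)) -> (forall j, j \notin s -> eig (F j)) -> e <= av M f0 F ->
  forall j, j \notin s -> eta <= nu W.+1 (F j).

(** Let [f] be the weak limit of the dual functions of slot [m]. Since [f] is large,
and is itself the limit of such averages, [pet] makes some seminorm of [f] large;
by [lower_all], whose hypothesis is [ctrl s] for the differenced functions, so is
[N 1 f]. The eigenfunction with which [f] then correlates can be put into slot
[m]. *)
Lemma swap s m (e : R) : ctrl s -> m \notin s -> 0 < e -> exists2 d : R, 0 < d & forall M f0 F,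
  invm M -> b1 f0 -> (forall j, b1 (F j)) -> (forall j, j \notin m :: s -> eig (F j)) -> e <= av M f0 F ->
  exists2 chi, eig chi & d <= av M f0 (upd F m chi).
Proof.
move=> cs ms e0; have e20 : 0 < e ^+ 2 by rewrite exprn_gt0.
pose qs := [seq p j | j <- enum 'I_k & j != m].
have gq : good qs (p m).
  split=> [||q /mapP[j]]; [exact: ip|exact: rindep_nc|rewrite mem_filter => /andP[jm _] ->].
  by split; [exact: ip|apply: rindep_ncB => //; rewrite eq_sym].
have [t [dt dt0 Ht]] := pet mu e20 gq.
pose cl M (G : nat -> fn) := exists f0 F, [/\ invm M, b1 f0, forall j, b1 (F j), forall j, j \notin m :: s -> eig (F j) & G = dual f0 F m].
have cl_b1 M G : cl M G -> forall n, b1 (G n).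
  by move=> [f0 [F [_ H0 HF _ ->]]] n; apply: b1_dual.
have clE (e' : R) : 0 < e' -> exists W, exists2 eta : R, 0 < eta & forall M G ds g, cl M G -> eig g ->
    e' <= M (fun n => ex (Ds ds (G n) * g)) -> eta <= nu W.+1 g.
  move=> e'0; have [W [eta eta0 HW]] := cs e' e'0; exists W, eta => // M G ds g [f0 [F [iM H0 HF eF ->]]] eg h.
  rewrite -(updE (fun j => Ds ds (F j)) m g).
  have Hg : b1 g by apply: eig_b1 eg.
  apply: (HW M (Ds ds f0) (upd (fun j => Ds ds (F j)) m g)) => //; bfn.
  - by move=> j; rewrite /upd; case: ifP => _; bfn.
  - move=> j js; rewrite /upd; case: ifPn => // jm; apply: eig_Ds; apply: eF.
    by rewrite inE negb_or jm.
  apply: le_trans h _; rewrite -av_dual; bfn.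
  by apply: eqW; apply: eq_mean => n; rewrite /dual Ds_sh DsM Ds_prod; congr (ex (sh _ (_ * _) * _)); apply: eq_bigr => j _; rewrite Ds_sh.
have [d' d'0 Hd'] := lower_all cl_b1 clE t dt0.
have d'20 : 0 < d' / 2 by rewrite divr_gt0.
have [d1 d10 pick] := eig_pick d'20.
exists (d1 * (d' / 2)); first by rewrite mulr_gt0.
move=> M f0 F iM H0 HF eF eav.
have bd n := b1_dual m n H0 HF.
have [f Hf fE] := riesz mu M bd.
have rp : repr M (dual f0 F m) f by move=> g Hg; apply: fE; bfn.
have h1 : e <= ex (F m * f).
  by rewrite mulrC fE; bfn; rewrite av_dual // upd_id.
have h2 : pol_av mu (e ^+ 2) qs (p m) (cj f).
  exists M, f0, [seq (p j, F j) | j <- enum 'I_k & j != m]; split=> //.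
  - elim: (seq.filter _ _) => // j L IHL; rewrite map_cons; apply/all_b1_cons; split=> //=.
  - by rewrite -map_comp.
  apply: (@le_trans _ _ (ex (F m * f) ^+ 2)); first by rewrite lerXn2r ?nnegrE ?(le_trans _ h1) // ltW.
  apply: le_trans (CS1 _ (HF m) (b1_cb Hf)) _; rewrite !nnE fE; bfn.
  rewrite av_dual //; bfn; apply: eqW; apply: eq_mean => n; congr ex; congr (_ * _).
  rewrite /pprod big_map big_filter big_enum_cond /= [in LHS](bigD1 m) // updE /= mulrC; congr (_ * _).
  by apply: eq_bigr => j jm; rewrite updN.
have h3 : dt <= N t f by rewrite -N_cj //; apply: Ht => //; bfn.
have h4 : d' <= N 1 f by apply: Hd' rp h3 => //; exists f0, F.
have [chi [ec hc eq _]] := pick 1%N f Hf.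
exists (cj chi); first exact: eig_cj.
have bc := eig_b1 ec.
rewrite -av_dual //; bfn; rewrite -fE; bfn; rewrite eq; apply: le_trans hc.
by rewrite ler_pM2l // lerBrDr; apply: le_trans h4; lra.
Qed.

(** Exchange the function in slot [m] for an eigenfunction. *)
Lemma ctrl_add s m : ctrl s -> m \notin s -> ctrl (m :: s).
Proof.
move=> cs ms e e0; have [d d0 Hd] := swap cs ms e0; have [W [eta eta0 HW]] := cs d d0.
exists W, eta => // M f0 F iM H0 HF eF eav j; rewrite inE negb_or => /andP[jm js].
have [chi ec hc] := Hd M f0 F iM H0 HF eF eav.
rewrite -(updN F chi jm); apply: HW hc _ js => // i; rewrite /upd; case: ifPn => // im; [exact: (eig_b1 ec)|].
by move=> is_; apply: eF; rewrite inE negb_or im.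
Qed.

Lemma ctrl_all s : ctrl s.
Proof.
elim: s => [|m s IH].
  move=> e e0; have [[//|W] _ [eta eta0 HW]] := eigen_av mu ip pI e0.
  by exists W, eta => // M f0 F iM H0 HF eF eav j _; apply: HW eav j => // i; apply: eF.
have [ms|] := boolP (m \in s); last exact: ctrl_add.
move=> e /IH[W [eta eta0 HW]]; exists W, eta => // M f0 F iM H0 HF eF eav j.
have E i : (i \in m :: s) = (i \in s) by rewrite inE; case: eqP => // ->; rewrite ms.
by rewrite E => js; apply: HW eav j js => // i is_; apply: eF; rewrite E.
Qed.

(** The successive uses of [swap] need [ctrl] for the slots that are still free. *)
Lemma swaps i s (e : R) : 0 < e -> exists2 d : R, 0 < d & forall M f0 F,
  invm M -> b1 f0 -> (forall j, b1 (F j)) -> (forall j, j \notin i :: s -> eig (F j)) -> e <= av M f0 F ->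
  exists F', [/\ F' i = F i, forall j, b1 (F' j), forall j, j != i -> eig (F' j) & d <= av M f0 F'].
Proof.
elim: s e => [|m s IH] e e0.
  by exists e => // M f0 F iM H0 HF eF eav; exists F; split=> // j ji; apply: eF; rewrite inE.
have [ms|ms] := boolP (m \in i :: s).
  have [d d0 Hd] := IH e e0; exists d => // M f0 F iM H0 HF eF; apply: Hd => // j js; apply: eF.
  by move: js; rewrite !inE => js; rewrite orbCA negb_or js andbT; apply: contraNneq js => ->; rewrite -in_cons.
have [d1 d10 H1] := swap (ctrl_all (i :: s)) ms e0.
have [d d0 Hd] := IH d1 d10; exists d => // M f0 F iM H0 HF eF eav.
have [|chi ec hc] := H1 M f0 F iM H0 HF _ eav.
  by move=> j; rewrite !inE => js; apply: eF; rewrite !inE orbCA.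
have [|j|F' [F'i bF' eF' dF']] := Hd M f0 (upd F m chi) iM H0 _ _ hc.
- by move=> j; rewrite /upd; case: ifP => _ //; exact: (eig_b1 ec).
- move=> js; rewrite /upd; case: ifPn => // jm; apply: eF.
  by move: js; rewrite !inE !negb_or jm => /andP[-> ->].
exists F'; split=> //; rewrite F'i updN //; apply: contraNneq ms => <-; exact: mem_head.
Qed.

Lemma ti_mulz W f z : b1 f -> ti W f -> aeq (sh (z * W%:Z) f) f.
Proof.
move=> Hf tf; have nat (n : nat) : aeq (sh (n%:Z * W%:Z) f) f.
  by rewrite mulrC -PoszM; apply: ti_mul; bfn.
case: z => n //; rewrite NegzE mulNr; apply: aeq_sym.
rewrite -{1}[f](shK (n.+1%:Z * W%:Z)); apply: aeq_sh; bfn; exact: aeq_sym.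
Qed.

Lemma av_upd2 M f0 F m g g' : b1 f0 -> (forall j, b1 (F j)) -> b1 g -> b1 g' -> b1 (cc (2^-1) * (g - g')) ->
  av M f0 (upd F m g) - av M f0 (upd F m g') = 2 * av M f0 (upd F m (cc (2^-1) * (g - g'))).
Proof.
move=> H0 HF Hg Hg' Hb; have bd n := b1_dual m n H0 HF.
rewrite -!av_dual // -meanB; try by exists 1 => n; apply: ex_b1; bfn.
rewrite -meanZ; last by exists 1 => n; apply: ex_b1; bfn.
apply: eq_mean => n; rewrite mulrCA exZ; last by bfn.
by rewrite mulrA divff ?pnatr_eq0 // mul1r mulrBr exB; bfn.
Qed.

(** The part of an eigenfunction that the projection to period [W] leaves is again an
eigenfunction, on which [nu] vanishes; by [ctrl] its average is small. *)
Lemma invariant_slots i (e : R) : 0 < e -> exists W, forall s, i \notin s -> forall M f0 F,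
  invm M -> b1 f0 -> (forall j, b1 (F j)) -> (forall j, j != i -> eig (F j)) ->
  exists F', [/\ F' i = F i, forall j, b1 (F' j), forall j, j != i -> eig (F' j),
    forall j, j \in s -> ti W.+1 (F' j) & av M f0 F - e * (size s)%:R <= av M f0 F'].
Proof.
move=> e0; have e20 : 0 < e / 2 by rewrite divr_gt0.
have [W [eta eta0 HW]] := ctrl_all [:: i] e20; exists W; elim=> [|m s IH] is_ M f0 F iM H0 HF eF.
  by exists F; split=> //; rewrite mulr0 subr0.
move: is_; rewrite inE negb_or => /andP[im is_].
have [F' [F'i bF' eF' tF' avF']] := IH is_ M f0 F iM H0 HF eF.
have mi : m != i by rewrite eq_sym.
have [lam [ul tl el]] := eF' m mi.
have [P HP [p1 tP p3 _]] := proj mu W.+1 (bF' m).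
have eP : eigl lam P by apply: (eig_proj ul tl el HP p1).
have eg : eigl lam (cc (2^-1) * (F' m - P)) by apply: eiglZB.
have Hg : b1 (cc (2^-1) * (F' m - P)) by case: eg.
have eig_g : eig (cc (2^-1) * (F' m - P)) by exists lam.
exists (upd F' m P); split.
- by rewrite updN.
- by move=> j; rewrite /upd; case: ifP.
- by move=> j ji; rewrite /upd; case: ifP => _; [exists lam|exact: eF'].
- by move=> j; rewrite inE /upd; case: eqP => //= _; apply: tF'.
have nug : nu W.+1 (cc (2^-1) * (F' m - P)) = 0.
  have [Q HQ [q1 tQ q3 _]] := proj mu W.+1 Hg.
  rewrite -q3 !nnE (ex_proj Hg _ (ti_cj tQ) q1); bfn.
  rewrite -mulrA exZ; bfn; rewrite mulrBl exB; bfn.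
  by rewrite (ex_proj (bF' m) _ (ti_cj tQ) p1) ?subrr ?mulr0 //; bfn.
have := @av_upd2 M f0 F' m (F' m) P H0 bF' (bF' m) HP Hg; rewrite upd_id => dE.
have small : av M f0 (upd F' m (cc (2^-1) * (F' m - P))) < e / 2.
  rewrite ltNge; apply/negP => h.
  have := HW M f0 (upd F' m (cc (2^-1) * (F' m - P))) iM H0 _ _ h m.
  rewrite updE nug leNgt eta0 /= => k'; apply: notF; apply: k'.
  - by move=> j; rewrite /upd; case: ifP.
  - by move=> j; rewrite inE => ji; rewrite /upd; case: ifP => // _; apply: eF'.
  - by rewrite inE.
have sS : (size (m :: s))%:R = (size s)%:R + 1 :> R by rewrite natr1.
rewrite sS; move: avF' dE small; move: (av M f0 (upd F' m (cc _ * _))) (size s)%:R => a t h1 h2 h3.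
by move: h1 h2 h3; move: (av M f0 F) (av M f0 F') (av M f0 (upd F' m P)) => x b c h1 h2 h3; lra.
Qed.

(** An average that is not small forces every function to correlate with
functions of a bounded period: when all the other slots have a common period [W],
they are constant along a progression of step a multiple of [W], and what remains
is the average along a single polynomial. *)
Theorem rational_factor i (e : R) : 0 < e -> exists2 W, (0 < W)%N & exists2 eta : R, 0 < eta & forall M f0 F,
  invm M -> b1 f0 -> (forall j, b1 (F j)) -> e <= av M f0 F -> eta <= nu W (F i).
Proof.
move=> e0; pose s := [seq j <- enum 'I_k | j != i].
have is_ : i \notin s by rewrite mem_filter eqxx.
have sE j : (j \in s) = (j != i) by rewrite mem_filter mem_enum andbT.
have [d d0 Hd] := swaps i s e0.
pose e1 := d / (2 * (size s).+1%:R).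
have e10 : 0 < e1 by rewrite divr_gt0 // mulr_gt0.
have e1E : e1 * (size s)%:R <= d / 2.
  rewrite /e1 invfM mulrA -mulrA -[leRHS]mulr1 ler_pM2l ?divr_gt0 //.
  by rewrite mulrC ler_pdivrMr // mul1r ler_nat.
have [W HW] := invariant_slots i e10.
have [Dj DjP] := choice (fun j => let: ex_intro2 D D0 HD := divis (ip j) in ex_intro (fun D => (0 < D)%N /\ forall W n b : nat, exists z : int, ev (p j) (D * W * n + b) - ev (p j) b = z * W%:Z) D (conj D0 HD)).
pose D := (\prod_j Dj j)%N.
have D0 : (0 < D)%N by apply: prodn_gt0 => j; case: (DjP j).
have [T TE] : exists T, (D * W.+1)%N = T.+1 by exists (D * W.+1).-1; rewrite prednK // muln_gt0 D0.
pose q b := p i \Po (T.+1%:R *: 'X + b%:R%:P).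
have qev b n : (q b).[n%:R] = (p i).[(n * T.+1 + b)%:R].
  by rewrite horner_comp !hornerE natrD natrM [T.+1%:R * _]mulrC.
have iq b : ipoly (q b).
  by move=> m; rewrite horner_comp !hornerE -[T.+1%:R]/(T.+1%:~R) -[b%:R]/((b%:Z)%:~R) -intrM -intrD; apply: ip.
have evq b n : ev (q b) n = ev (p i) (n * T.+1 + b) by rewrite /ev qev.
have ncq b : nc (q b).
  have h := rindep_nc pI i.
  by rewrite /nc size_comp_poly2 // size_addl ?size_scale ?size_polyX ?pnatr_eq0 // (leq_ltn_trans (size_polyC_leq1 _)).
have d20 : 0 < d / 2 by rewrite divr_gt0.
have ch b : {x : nat * R | [/\ (0 < x.1)%N, 0 < x.2 & forall M u f, invm M -> b1 u -> b1 f ->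
    d / 2 <= M (fun n => ex (u * sh (ev (q b) n) f)) -> x.2 <= nu x.1 f]}.
  by apply: cid; have [V V0 [eta eta0 HV]] := single mu d20 (iq b) (ncq b); exists (V, eta).
pose V := (\prod_(b < T.+1) (sval (ch b)).1)%N.
pose eta := \big[Num.min/1]_(b < T.+1) (sval (ch b)).2.
exists V; first by apply: prodn_gt0 => b; case: (svalP (ch b)).
exists eta.
  rewrite /eta; elim/big_ind: _ => // [x y x0 y0|b _]; first by rewrite lt_min x0.
  by case: (svalP (ch b)).
move=> M f0 F iM H0 HF eav.
have [|F1 [F1i bF1 eF1 avF1]] := Hd M f0 F iM H0 HF _ eav.
  by move=> j; rewrite inE sE; case: eqP.
have [F2 [F2i bF2 eF2 tF2 avF2]] := HW s is_ M f0 F1 iM H0 bF1 eF1.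
have {}avF2 : d / 2 <= av M f0 F2.
  by apply: le_trans avF2; rewrite lerBrDr; apply: le_trans avF1; rewrite {2}[d]splitr lerD2l.
have bA n : b1 (f0 * \prod_j sh (ev (p j) n) (F2 j)) by apply: b1M => //; apply: b1_prod => j _; bfn.
have [b bT [M' iM' h]] := dil_exists iM T (bdd_exb mu bA) avF2.
have bT' : (b < T.+1)%N by [].
apply: (@le_trans _ _ (sval (ch b)).2).
  by rewrite /eta (bigD1 (Ordinal bT')) //= ge_min lexx.
apply: (@le_trans _ _ (nu (sval (ch b)).1 (F i))); last first.
  by apply: nu_dvd => //; rewrite /V (bigD1 (Ordinal bT')) //= dvdn_mulr.
have [_ _ Hch] := svalP (ch b).
have bu : b1 (f0 * \prod_(j | j != i) sh (ev (p j) b) (F2 j)) by apply: b1M => //; apply: b1_prod => j _; bfn.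
apply: (Hch M' (f0 * \prod_(j | j != i) sh (ev (p j) b) (F2 j)) (F i)) => //.
apply: le_trans h _; apply: eqW; apply: eq_mean => n.
rewrite (bigD1 i) //= F2i F1i evq.
set X := \prod_(j | _) _; set g := sh _ (F i); set Y := \prod_(j | _) _.
have Hg : b1 g by rewrite /g; bfn.
have bp (c : 'I_k -> int) (r : seq 'I_k) : b1 (\prod_(j <- r | j != i) sh (c j) (F2 j)) by apply: b1_prod => j _; bfn.
have bX : b1 X by apply: bp.
have bY : b1 Y by apply: bp.
have -> : f0 * (g * X) = X * (f0 * g) by ring.
have -> : f0 * Y * g = Y * (f0 * g) by ring.
apply: aeq_ex; bfn; rewrite /X /Y {X Y bX bY}.
elim: (index_enum _) => [|j r IH]; first by rewrite !big_nil; bfn.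
rewrite !big_cons; case: ifPn => // ji; apply: aeqMM; bfn.
have [_ /(_ W.+1 ((D %/ Dj j) * n)%N b)[z zE]] := DjP j.
have E : (n * T.+1 + b = Dj j * W.+1 * ((D %/ Dj j) * n) + b)%N.
  have dv : (Dj j %| D)%N by rewrite /D (bigD1 j) //= dvdn_mulr.
  by rewrite -TE -{1}(divnK dv); congr (_ + _)%N; rewrite !mulnA [in LHS]mulnC; lia.
rewrite E; have -> : ev (p j) (Dj j * W.+1 * (D %/ Dj j * n) + b) = ev (p j) b + z * W.+1%:Z by rewrite -zE addrC subrK.
by rewrite -shsh; apply: aeq_sh; bfn; apply: ti_mulz => //; apply: tF2; rewrite sE.
Qed.

End Lowering.

(** * A correlating frequency *)

Section Fourier.
Variable C : numClosedFieldType.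
Implicit Types (z w : C).

Lemma prim_root_closed n : (0 < n)%N -> exists z : C, n.-primitive_root z.
Proof.
move=> n0; have [r Dp] := closed_field_poly_normal ('X^n - 1 : {poly C}).
have mon : 'X^n - 1 \is @monic C by rewrite -polyC1 monicXnsubC.
rewrite (monicP mon) scale1r in Dp.
have ru : all n.-unity_root r.
  by apply/allP => z; rewrite -root_prod_XsubC -Dp.
have ur : uniq r by rewrite -separable_prod_XsubC -Dp separable_Xn_sub_1 // pnatr_eq0 -lt0n.
have sr : (n <= size r)%N.
  by rewrite -ltnS -(size_prod_XsubC r id) -Dp -polyC1 size_XnsubC.
by have /hasP[z _ pz] := has_prim_root n0 ru ur sr; exists z.
Qed.

Lemma prim_root_unit n w : (0 < n)%N -> n.-primitive_root w -> w * w^* = 1.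
Proof.
move=> n0 pw; have := congr1 (fun x : C => `|x|) (prim_expr_order pw).
rewrite normrX normr1 => /eqP; rewrite pexpr_eq1 // => /eqP h.
by rewrite -normCK h expr1n.
Qed.

Section Zm.
Variables (p : nat) (w : C).
Local Notation m := p.+1.
Hypothesis pw : m.-primitive_root w.

Let ww : w * w^* = 1. Proof. exact: prim_root_unit pw. Qed.
Let wX n : w ^+ n * (w ^+ n)^* = 1. Proof. by rewrite rmorphXn -exprMn ww expr1n. Qed.

Lemma orthogonality (x y : 'I_m) : \sum_(xi < m) w ^+ (xi * x) * (w ^+ (xi * y))^* = (if x == y then m%:R else 0).
Proof.
case: eqP => [->|xy]; first by under eq_bigr do rewrite wX; rewrite sumr_const card_ord.
pose q := w ^+ x * (w ^+ y)^*.
have q1 : q != 1.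
  apply/eqP => q1; apply: xy; apply/val_inj/eqP => /=.
  have /eqP : w ^+ x = w ^+ y by rewrite -[LHS]mulr1 -(wX y) [w ^+ y * _]mulrC mulrA -/q q1 mul1r.
  by rewrite (eq_prim_root_expr pw) !modn_small.
have qm : q ^+ m = 1.
  by rewrite /q exprMn -rmorphXn -!exprM ![(_ * m)%N]mulnC !exprM (prim_expr_order pw) !expr1n rmorph1 mulr1.
have -> : \sum_(xi < m) w ^+ (xi * x) * (w ^+ (xi * y))^* = \sum_(xi < m) q ^+ xi.
  by apply: eq_bigr => xi _; rewrite /q exprMn -rmorphXn -!exprM ![(xi * _)%N]mulnC.
apply/eqP; have := subrX1 q m; rewrite qm subrr => /esym/eqP.
by rewrite mulf_eq0 subr_eq0 (negbTE q1).
Qed.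

Definition hat (B : 'I_m -> C) (xi : 'I_m) := \sum_(n < m) B n * w ^+ (xi * n).

Lemma parseval B : \sum_xi `|hat B xi| ^+ 2 = m%:R * \sum_n `|B n| ^+ 2.
Proof.
have -> : \sum_xi `|hat B xi| ^+ 2 = \sum_(xi < m) \sum_(n < m) \sum_(n' < m) (B n * (B n')^*) * (w ^+ (xi * n) * (w ^+ (xi * n'))^*).
  apply: eq_bigr => xi _; rewrite normCK /hat rmorph_sum /= big_distrlr /=.
  by apply: eq_bigr => n _; apply: eq_bigr => n' _; rewrite rmorphM /= mulrACA.
rewrite exchange_big mulr_sumr; apply: eq_bigr => n _; rewrite exchange_big /= (bigD1 n) //= [X in _ + X]big1.
  by rewrite addr0 -mulr_sumr orthogonality eqxx mulrC normCK.
by move=> n' n'n; rewrite -mulr_sumr orthogonality eq_sym (negbTE n'n) mulr0.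
Qed.

End Zm.

Lemma hat_conv p w (pw : p.+1.-primitive_root w) (A B : 'I_p.+1 -> C) (xi : 'I_p.+1) :
  hat w (fun h => \sum_n A n * (B (n + h))^*) xi = hat w^* A xi * (hat w^* B xi)^*.
Proof.
have wX n : w ^+ n * (w ^+ n)^* = 1 by rewrite rmorphXn -exprMn (prim_root_unit _ pw) // expr1n.
rewrite /hat rmorph_sum /= big_distrlr /=.
under eq_bigr do rewrite mulr_suml.
rewrite exchange_big; apply: eq_bigr => n _ /=.
rewrite (reindex_inj (addrI (- n))) /=; apply: eq_bigr => k _.
have cX n' : w^* ^+ n' = (w ^+ n')^* by rewrite rmorphXn.
rewrite addrA addrN add0r rmorphM /= !cX conjCK.
have -> : w ^+ (xi * (- n + k)%R) = (w ^+ (xi * n))^* * w ^+ (xi * k).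
  rewrite -[LHS]mul1r -(wX (xi * n)%N) -mulrA mulrCA; congr (_ * _).
  rewrite -exprD -mulnDr; apply/eqP; rewrite (eq_prim_root_expr pw) -modnMmr -[in X in _ == X]modnMmr.
  have -> : ((n + (- n + k)%R) %% p.+1 = k %% p.+1)%N.
    by have : n + (- n + k) = k by [rewrite addrA addrN add0r]; move=> /(congr1 val) /= ->; rewrite modn_small.
  by [].
rewrite mulrACA; ring.
Qed.

(** The sequence is embedded into the cyclic group of order [2 L], where the shifts
by less than [L] do not wrap around. By [parseval] the sum of the squares of the
correlations is a weighted average of the squares of the Fourier coefficients of
the first half, hence at most the largest of these times the total weight. *)
Lemma correlate (L : nat) (a : nat -> C) : (0 < L)%N -> (forall n, `|a n| <= 1) ->
  exists2 w : C, `|w| = 1 & \sum_(h < L) `|\sum_(n < L) a n * (a (n + h)%N)^*| ^+ 2 <=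
    (L.*2)%:R * `|\sum_(n < L) a n * (w ^+ n)^*| ^+ 2.
Proof.
move=> L0 a1; have [p pE] : exists p, p.+1 = L.*2 by exists L.*2.-1; rewrite prednK // double_gt0.
have [w pw] := prim_root_closed (ltn0Sn p).
have pv : p.+1.-primitive_root w^* by rewrite fmorph_primitive_root.
pose A (n : 'I_p.+1) := if (n < L)%N then a n else 0.
pose B (n : 'I_p.+1) := a n.
pose v xi := `|hat w^* A xi| ^+ 2.
have rv xi : v xi \is Num.real by rewrite realX // normr_real.
case: (@real_arg_maxP C _ 0 xpredT v) => // xi _ vM.
exists (w ^+ xi).
  have h := prim_root_unit (ltn0Sn p) pw.
  by have /eqP := congr1 (fun x : C => `|x|) h; rewrite normrM norm_conjC normr1 -expr2 sqrp_eq1 // => /eqP h1; rewrite normrX h1 expr1n.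
have lL : (L <= p.+1)%N by rewrite pE -addnn leq_addr.
have e1 : v xi = `|\sum_(n < L) a n * ((w ^+ xi) ^+ n)^*| ^+ 2.
  rewrite /v /hat; congr (`|_| ^+ 2).
  rewrite (big_ord_widen _ (fun n => a n * ((w ^+ xi) ^+ n)^*) lL) [RHS]big_mkcond /=.
  apply: eq_bigr => n _; rewrite /A; case: ifP => _; last by rewrite mul0r.
  by rewrite -exprM -rmorphXn.
rewrite -e1 -pE.
have m0 : 0 < p.+1%:R :> C by rewrite ltr0n.
pose corr (h : 'I_p.+1) := \sum_n A n * (B (n + h))^*.
have le1 : \sum_(h < L) `|\sum_(n < L) a n * (a (n + h)%N)^*| ^+ 2 <= \sum_h `|corr h| ^+ 2.
  rewrite (big_ord_widen _ (fun h => `|\sum_(n < L) a n * (a (n + h)%N)^*| ^+ 2) lL) [leLHS]big_mkcond /=.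
  apply: ler_sum => h _; case: ifP => hL; last by rewrite exprn_ge0.
  apply/eqW; congr (`|_| ^+ 2).
  rewrite (big_ord_widen _ (fun n => a n * (a (n + h)%N)^*) lL) [LHS]big_mkcond /=.
  apply: eq_bigr => n _; rewrite /A; case: ifP => nL; last by rewrite mul0r.
  by rewrite /B /= modn_small //; move: nL hL pE; lia.
apply: le_trans le1 _; rewrite -(ler_pM2l m0) -(parseval pw).
under eq_bigr do rewrite hat_conv // normrM norm_conjC exprMn.
apply: le_trans (_ : \sum_i v xi * `|hat w^* B i| ^+ 2 <= _).
  by apply: ler_sum => i _; rewrite ler_wpM2r ?exprn_ge0 //; apply: vM.
rewrite -mulr_sumr (parseval pv) mulrCA ler_pM2l // mulrC ler_wpM2r ?exprn_ge0 //.
apply: le_trans (_ : \sum_(n < p.+1) 1 <= _); last by rewrite sumr_const card_ord.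
by apply: ler_sum => n _; rewrite exprn_ile1 //; apply: a1.
Qed.

End Fourier.

(** * Sampling along intervals of integers *)

Section Blocks.
Variable R : realType.
Local Notation C := R[i].

Lemma sum_blocks (K L : nat) (F : nat -> R) :
  \sum_(y < K * L) F y = \sum_(b < K) \sum_(r < L) F (b * L + r)%N.
Proof.
elim: K => [|K IH]; first by rewrite !big_ord0.
by rewrite mulSnr big_split_ord /= IH big_ord_recr.
Qed.

Lemma sum_middle (F : nat -> R) (s P q : nat) : (forall x, -1 <= F x) ->
  \sum_(y < P) F (s + y)%N - (s + q)%:R <= \sum_(x < s + P + q) F x.
Proof.
move=> F1; rewrite !big_split_ord /=.
have h (n : nat) (G : nat -> R) : (forall x, -1 <= G x) -> - n%:R <= \sum_(i < n) G i.
  move=> G1; apply: le_trans (_ : \sum_(i < n) -1 <= _); last by apply: ler_sum.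
  by rewrite sumr_const card_ord mulNrn.
have := h s F F1; have := h q (fun i => F (s + P + i)%N) (fun i => F1 _); rewrite natrD.
move: (\sum_(i < s) _) (\sum_(i < q) _) (\sum_(i < P) _) => a b c; lra.
Qed.

Lemma count_multiples (u L M : nat) : (0 < L)%N ->
  \sum_(n < M) (if ((n + u) %% L == 0)%N then 1 else 0 : R) <= (M %/ L).+1%:R.
Proof.
move=> L0; set K := (M %/ L).+1.
have MK : (M <= K * L)%N by apply: ltnW; apply: ltn_ceil.
apply: le_trans (_ : \sum_(n < K * L) (if ((n + u) %% L == 0)%N then 1 else 0 : R) <= _).
  rewrite -(subnKC MK) big_split_ord /= lerDl sumr_ge0 // => i _; by case: ifP.
rewrite (sum_blocks _ _ (fun n => if ((n + u) %% L == 0)%N then 1 else 0)); apply: le_trans (_ : \sum_(b < K) 1 <= _); last by rewrite sumr_const card_ord.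
apply: ler_sum => b _.
have r0L : ((L - u %% L) %% L < L)%N by rewrite ltn_mod.
apply: le_trans (_ : \sum_(r < L) (if r == Ordinal r0L then 1 else 0) <= _).
  apply: ler_sum => r _; case: ifP => [h|_]; last by case: ifP.
  case: ifP => // /negP[]; apply/eqP/val_inj => /=.
  have rL : (r < L)%N := ltn_ord r.
  move: h; rewrite -addnA modnMDl -modnDmr.
  have uL : (u %% L < L)%N by rewrite ltn_mod.
  move: (u %% L)%N uL => v vL /eqP h.
  have [v0|v0] := posnP v; first by rewrite v0 subn0 modnn; move: h; rewrite v0 addn0 modn_small.
  have h2 : (r + v = L)%N.
    have /dvdnP[k kE] : (L %| r + v)%N by rewrite /dvdn h.
    have k1 : k = 1%N by move: kE; case: k => [|[|k]] //; nia.
    by rewrite kE k1 mul1n.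
  by rewrite modn_small; lia.
by rewrite -big_mkcond /= big_pred1_eq.
Qed.

(** A local version of [N 1]: the differences stay in a window that starts at [y] and
has twice the length [L]. *)
Definition cor (L : nat) (g : int -> C) (y : int) : R :=
  (L%:R ^+ 3)^-1 * re (\sum_(h < L) `|\sum_(n < L) g (y + n%:Z) * (g (y + (n + h)%N%:Z))^*| ^+ 2).

Lemma re_normsq (z : C) : re (`|z| ^+ 2) = re (z * z^*).
Proof. by rewrite normCK. Qed.

Lemma normsq_le (z : C) (c : R) : `|z| <= c%:C%C -> re (`|z| ^+ 2) <= c ^+ 2.
Proof.
move=> h; have c0 := le_trans (normr_ge0 _) h.
rewrite -[leRHS]re_real rmorphXn; apply: re_le.
by rewrite lerXn2r // nnegrE.
Qed.

Lemma cor_le1 L g y : (forall x, `|g x| <= 1) -> cor L g y <= 1.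
Proof.
move=> g1; case: L => [|L]; first by rewrite /cor expr0n /= invr0 mul0r ler01.
rewrite /cor mulrC ler_pdivrMr ?exprn_gt0 // mul1r re_sum.
apply: le_trans (_ : \sum_(h < L.+1) L.+1%:R ^+ 2 <= _); last first.
  by rewrite sumr_const card_ord [leRHS]exprS mulr_natl.
apply: ler_sum => h _; apply: normsq_le.
apply: le_trans (ler_norm_sum _ _ _) _.
apply: le_trans (_ : \sum_(n < L.+1) 1 <= _).
  by apply: ler_sum => n _; rewrite normrM norm_conjC mulr_ile1.
by rewrite sumr_const card_ord rmorph_nat.
Qed.

(** The windows that start at [s + b * L], over all offsets [s], are all the windows;
the constants account for the ends of the interval. *)
Lemma pick_offset (L N : nat) (c : nat -> R) : (0 < L)%N -> (L <= N.+1)%N -> (forall y, c y <= 1) ->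
  exists K s, [/\ (s < L)%N, (s + K * L <= N.+1)%N, (N.+1 <= K * L + 2 * L)%N &
    \sum_(y < N.+1) c y - 2 * L%:R <= L%:R * \sum_(b < K) c (s + b * L)%N].
Proof.
move=> L0 LN c1; pose K := (N.+1 %/ L).-1.
have K1 : K.+1 = (N.+1 %/ L)%N by rewrite /K prednK // divn_gt0.
have KN : ((K.+1 * L) <= N.+1)%N by rewrite K1 leq_trunc_div.
have NK : (N.+1 < K.+2 * L)%N by rewrite K1; apply: ltn_ceil.
case: L L0 LN @K K1 KN NK => // L _ LN K K1 KN NK.
have [s sL sc] := @avg_exists R L (fun s => \sum_(b < K) c (s + b * L.+1)%N) _ (lexx _).
exists K, s; split; [by []|by nia|by nia|].
move: sc; rewrite avgE ler_pdivrMr // => sc; rewrite [leRHS]mulrC; apply: le_trans sc.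
rewrite exchange_big /=.
have -> : \sum_(b < K) \sum_(i < L.+1) c (i + b * L.+1)%N = \sum_(y < K * L.+1) c y.
  by rewrite (sum_blocks _ _ c); apply: eq_bigr => b _; apply: eq_bigr => r _; rewrite addnC.
have NE : (N.+1 = K * L.+1 + (N.+1 - K * L.+1))%N by nia.
rewrite lerBlDr NE big_split_ord /= lerD2l.
apply: le_trans (_ : \sum_(i < N.+1 - K * L.+1) 1 <= _); first by apply: ler_sum.
by rewrite sumr_const card_ord -natrM ler_nat; nia.
Qed.

(** Cut the interval into blocks of length [L] and take in each block the frequency of
[correlate]; the mean [beta] of the modulated function over the block is then
large on average. *)
Lemma blocks (L N : nat) (g : int -> C) : (0 < L)%N -> (L * L <= N.+1)%N -> (forall x, `|g x| <= 1) ->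
  exists t (w beta : nat -> C), [/\ forall b, `|w b| = 1, forall b, `|beta b| <= 1 &
    avg R N (fun x => cor L g x%:Z) / 2 - 3 / L%:R <=
    avg R N (fun x => re (g x%:Z * (w ((x + t) %/ L)%N ^+ ((x + t) %% L))^* * (beta ((x + t) %/ L)%N)^*))].
Proof.
move=> L0 LN g1; have LN' : (L <= N.+1)%N by nia.
have [K [s [sL sK NK hs]]] := pick_offset L0 LN' (fun y => cor_le1 L y%:Z g1).
pose t := (L - s)%N.
pose st (b : nat) : int := (b * L)%N%:Z - t%:Z.
have [w wP] := choice (fun b => let: ex_intro2 w w1 wE := correlate L0 (fun n => g1 (st b + n%:Z)) in
  ex_intro (fun w => `|w| = 1 /\ _ <= _ * `|\sum_(n < L) g (st b + n%:Z) * (w ^+ n)^*| ^+ 2) w (conj w1 wE)).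
have w1 b : `|w b| = 1 by case: (wP b).
pose T b := \sum_(n < L) g (st b + n%:Z) * (w b ^+ n)^*.
pose beta b := (L%:R^-1)%:C%C * T b.
have LR : 0 < L%:R :> R by rewrite ltr0n.
have L0' : L%:R != 0 :> R by rewrite gt_eqF.
have nL : `|(L%:R^-1)%:C%C| = (L%:R^-1)%:C%C :> C.
  by rewrite ger0_norm // lecE /= eqxx invr_ge0 ltW.
have T1 b : `|T b| <= (L%:R)%:C%C.
  apply: le_trans (ler_norm_sum _ _ _) _; apply: le_trans (_ : \sum_(n < L) 1 <= _).
    by apply: ler_sum => n _; rewrite normrM norm_conjC normrX w1 expr1n mulr1.
  by rewrite sumr_const card_ord rmorph_nat.
have b1' b : `|beta b| <= 1.
  rewrite /beta normrM nL; apply: le_trans (ler_wpM2l _ (T1 b)) _; first by rewrite -nL.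
  by rewrite -rmorphM mulVf.
have TE b : T b = (L%:R)%:C%C * beta b by rewrite /beta mulrA -rmorphM divff // mul1r.
exists t, w, beta; split=> //.
set F := fun x : nat => re _.
have F1 x : `|F x| <= 1.
  have := @re_norm R (g x%:Z * (w ((x + t) %/ L)%N ^+ ((x + t) %% L))^* * (beta ((x + t) %/ L)%N)^*) 1.
  by apply; rewrite !normrM !norm_conjC normrX w1 expr1n mulr1 mulr_ile1.
have F1' x : -1 <= F x by have := F1 x; rewrite ler_norml => /andP[].
have NE : N.+1 = (s + K * L + (N.+1 - (s + K * L)))%N by rewrite subnKC.
have h1 : \sum_(y < K * L) F (s + y)%N - 2 * L%:R <= \sum_(x < N.+1) F x.
  rewrite [in leRHS]NE; apply: le_trans (sum_middle _ _ _ F1'); rewrite lerD2l lerN2 -natrM ler_nat; lia.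
have h2 : \sum_(y < K * L) F (s + y)%N = \sum_(b < K) L%:R * re (`|beta b.+1| ^+ 2).
  rewrite (sum_blocks _ _ (fun y => F (s + y)%N)); apply: eq_bigr => b _.
  have E (r : 'I_L) : F (s + (b * L + r))%N = re (g (st b.+1 + r%:Z) * (w b.+1 ^+ r)^* * (beta b.+1)^*).
    have e : (s + (b * L + r) + t = b.+1 * L + r)%N by rewrite /t; nia.
    rewrite /F e divnMDl // modnMDl divn_small ?modn_small // addn0.
    by congr (re (g _ * _ * _)); rewrite /st /t; lia.
  under eq_bigr do rewrite E.
  by rewrite -re_sum -mulr_suml -/(T _) TE -mulrA re_cc re_normsq.
have h3 (b : nat) : cor L g (s + b * L)%N%:Z <= 2 * re (`|beta b.+1| ^+ 2).
  have [_ h] := wP b.+1; have {h} := re_le h; rewrite -/(T _) => h.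
  have e : st b.+1 = (s + b * L)%N%:Z by rewrite /st /t; lia.
  rewrite /cor mulrC ler_pdivrMr ?exprn_gt0 //.
  apply: le_trans (_ : _ <= re (L.*2%:R * `|T b.+1| ^+ 2)) _.
    apply: le_trans h; apply: eqW; congr re; apply: eq_bigr => h _; congr (`|_| ^+ 2).
    by apply: eq_bigr => n _; rewrite e.
  have -> : L.*2%:R = ((2 * L%:R)%:C%C) :> C by rewrite -natrM mul2n rmorph_nat.
  rewrite re_cc TE normrM exprMn.
  have -> : `|(L%:R)%:C%C| = (L%:R)%:C%C :> C by rewrite ger0_norm // lecE /= eqxx ltW.
  have -> : (L%:R)%:C%C ^+ 2 = (L%:R ^+ 2)%:C%C :> C by rewrite rmorphXn.
  rewrite re_cc; apply: eqW; move: (re _) => x; ring.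
have h4 : \sum_(b < K) cor L g (s + b * L)%N%:Z <= 2 * \sum_(b < K) re (`|beta b.+1| ^+ 2).
  by rewrite mulr_sumr; apply: ler_sum => b _; apply: h3.
move: h1 hs; rewrite h2 -mulr_sumr !avgE.
move: h4; move: (\sum_(b < K) cor _ _ _) (\sum_(b < K) re _) (\sum_(x < N.+1) F x) (\sum_(y < N.+1) cor L g y%:Z) => A B S Q h4 h1 hs.
have N0 : 0 < N.+1%:R :> R by [].
rewrite ler_pdivlMr // mulrBl [Q / _ / _]mulrAC divfK ?gt_eqF //.
have h5 : 3 * L%:R <= 3 / L%:R * N.+1%:R :> R.
  by rewrite -mulrA ler_pM2l // mulrC ler_pdivlMr // -natrM ler_nat.
have h6 : Q - 2 * L%:R <= L%:R * (2 * B) by apply: le_trans hs _; rewrite ler_pM2l.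
rewrite mulrCA in h6; move: h5 h6 h1.
by move: (L%:R) (3 / L%:R * N.+1%:R) (L%:R * B) => x y z h5 h6 h1; lra.
Qed.

End Blocks.

(** * The system attached to longer and longer intervals *)

#[local] Existing Instance ultra_ultra.
#[local] Existing Instance ultra_proper.

Section Sampling.
Variables (R : realType) (Nj : nat -> nat).
Hypothesis Nj_ge : forall j, (j <= Nj j)%N.
Local Notation C := R[i].
Local Notation fn := (fn R).

Definition cmean : mean R point := bindm (LIM R) (fun j => avg R (Nj j)) (fun j x => (j, x%:Z)).
Lemma cmeanE phi : cmean phi = LIM R (fun j => avg R (Nj j) (fun x => phi (j, x%:Z))).
Proof. exact: bindE. Qed.

Lemma bdd_level (phi : point -> R) : bdd phi -> bdd (fun j => avg R (Nj j) (fun x => phi (j, x%:Z))).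
Proof. by move=> [K pK]; exists K => j; apply: mean_norm. Qed.

Lemma avg_shift1 N (a : nat -> R) : avg R N (fun x => a x.+1) - avg R N a = (a N.+1 - a 0%N) / N.+1%:R.
Proof.
rewrite !avgE -mulrBl -sumrB; congr (_ / _).
by rewrite -(big_mkord xpredT (fun x => a x.+1 - a x)) telescope_sumr.
Qed.

Lemma cmean_shift1 (phi : point -> R) : bdd phi -> cmean (fun x => phi (x.1, x.2 + 1)) = cmean phi.
Proof.
move=> bp; have [K pK] := bp; rewrite !cmeanE; apply: (@LIM_near0 _ _ _ (K + K)).
- by apply: (@bdd_level (fun x => phi (x.1, x.2 + 1))); exists K.
- exact: bdd_level.
move=> j; pose a (x : nat) := phi (j, x%:Z).
have -> : (fun x : nat => phi ((j, x%:Z).1, (j, x%:Z).2 + 1)) = (fun x => a x.+1).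
  by apply/funext => x; rewrite /a /= -PoszD addn1.
rewrite avg_shift1 normrM normfV normr_nat; apply: ler_pM => //; first by rewrite invr_ge0.
  by apply: le_trans (ler_normB _ _) _; apply: lerD; apply: pK.
by rewrite lef_pV2 ?posrE // ler_nat ltnS.
Qed.

Lemma cmean_inv l (f : fn) : cb f -> ex cmean (sh l f) = ex cmean f.
Proof.
have s1 (g : fn) : cb g -> ex cmean (sh 1 g) = ex cmean g.
  by move=> Hg; apply: (cmean_shift1 (phi := fun x => re (g x))); exact: bdd_re.
have nat (n : nat) (g : fn) : cb g -> ex cmean (sh n%:Z g) = ex cmean g.
  move=> Hg; elim: n => [|n IH]; first by rewrite sh0.
  by rewrite -addn1 PoszD addrC -shsh s1 //; bfn.
move=> Hf; case: l => n; first exact: nat.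
by rewrite NegzE -(nat n.+1) ?shNK //; bfn.
Qed.

Definition level (j : nat) (f : fn) : R := avg R (Nj j) (fun x => re (f (j, x%:Z) * (f (j, x%:Z))^*)).

Lemma nn_level f : nn cmean f = LIM R (fun j => level j f).
Proof. exact: cmeanE. Qed.

Lemma level_ge0 j f : 0 <= level j f.
Proof.
by rewrite /level -(mean_cst (avg R (Nj j)) 0); apply: avg_le => i _; apply: re_sq_ge0.
Qed.

Lemma bdd_levels f : cb f -> bdd (fun j => level j f).
Proof.
move=> Hf; apply: (@bdd_level (fun x => re ((f * cj f) x))); apply: bdd_re; bfn.
Qed.

Lemma nn_add f g : cb f -> cb g -> nn cmean (f + g) <= 2 * nn cmean f + 2 * nn cmean g.
Proof.
move=> Hf Hg; have : 0 <= nn cmean (f - g) by apply: nn_ge0; bfn.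
rewrite nnB // nnD //; lra.
Qed.

(** Diagonal argument: on the interval of index [j] take the latest term of a rapidly
convergent subsequence for which the distances between the terms before it are
already realised on that interval. *)
Lemma cmean_complete (F : nat -> fn) : (forall i, b1 (F i)) ->
  (forall e : R, 0 < e -> exists N, forall i j, (N <= i)%N -> (N <= j)%N -> nn cmean (F i - F j) <= e) ->
  exists2 f : fn, b1 f & forall e : R, 0 < e -> exists N, forall i, (N <= i)%N -> nn cmean (F i - f) <= e.
Proof.
move=> HF cF; pose ea (a : nat) : R := a.+1%:R^-1.
have ea0 a : 0 < ea a by rewrite invr_gt0.
have [na naP] := choice (fun a => cF (ea a / 2) (divr_gt0 (ea0 a) (ltr0n _ 2))).
pose ns a := (\sum_(b < a.+1) na b)%N.
have ns_ge a b : (a <= b)%N -> (na a <= ns b)%N.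
  by move=> ab; rewrite /ns (bigD1 (Ordinal (ab : (a < b.+1)%N))) //= leq_addr.
pose G a := F (ns a).
have GG a b : (a <= b)%N -> nn cmean (G a - G b) < ea a.
  move=> ab; apply: le_lt_trans (naP a _ _ (ns_ge _ _ (leqnn a)) (ns_ge _ _ ab)) _.
  by have := ea0 a; lra.
pose good j i := forall a b, (a <= b)%N -> (b <= i)%N -> level j (G a - G b) < ea a.
have good0 j : good j 0%N.
  move=> a b ab; rewrite leqn0 => /eqP b0; move: ab; rewrite b0 leqn0 => /eqP ->.
  rewrite subrr (_ : level j 0 = 0) ?ea0 //.
  by rewrite -[RHS](mean_cst (avg R (Nj j))); apply: eq_mean => x; rewrite mul0r.
have top j : exists i, good j i /\ forall a, (a <= j)%N -> good j a -> (a <= i)%N.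
  pose P (i : 'I_j.+1) := `[< good j i >].
  have P0 : P ord0 by apply/asboolP; apply: good0.
  case: (@arg_maxnP _ ord0 P (fun i => nat_of_ord i) P0) => i /asboolP gi im.
  exists i; split=> // a aj ga; apply: (im (Ordinal (aj : (a < j.+1)%N))).
  exact/asboolP.
have [ij ijP] := choice top.
pose f : fn := fun x => G (ij x.1) x.
have bf : b1 f by move=> x; apply: HF.
have cFG a b : cb (G a - G b) by apply: cbB; apply: b1_cb; apply: HF.
have ug a : ultra [set j | good j a].
  have h : ultra [set j | forall xy : 'I_a.+1 * 'I_a.+1, (xy.1 <= xy.2)%N -> level j (G xy.1 - G xy.2) < ea xy.1].
    apply: filter_forall => -[x y] /=.
    have [xy|yx] := boolP (x <= y)%N; last by apply: (filterS _ filterT) => j _ xy; case/negP: yx.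
    apply: (filterS _ (LIM_near_lt (bdd_levels (cFG x y)) _)); last by rewrite -nn_level; apply: GG xy.
    by move=> j /= h _.
  apply: filterS h => j /= h x y xy ya.
  have xa := leq_trans xy ya.
  exact: (h (Ordinal (xa : (x < a.+1)%N), Ordinal (ya : (y < a.+1)%N))).
have Gf a : nn cmean (G a - f) <= ea a.
  rewrite nn_level -(mean_cst (LIM R) (ea a)); apply: LIM_le_near => //.
    by apply: bdd_levels; apply: cbB; apply: b1_cb => //; apply: HF.
  apply: filterS (filterI (ug a) (ultra_ge a)) => j /= [gj aj].
  have [gij /(_ a aj gj) ai] := ijP j.
  exact: ltW (gij a (ij j) ai (leqnn _)).
exists f => // e e0; have [a /(_ a (leqnn a)) ha] := inv_small 4 e0.
exists (na a) => i ai.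
have -> : F i - f = (F i - G a) + (G a - f) by rewrite addrA subrK.
apply: le_trans (nn_add _ _) _; [by apply: cbB; apply: b1_cb; apply: HF|by apply: cbB; apply: b1_cb => //; apply: HF|].
have h1 := naP a _ _ ai (ns_ge _ _ (leqnn a)); have h2 := Gf a.
move: ha h1 h2 (ea0 a); rewrite -/(ea a) -/(G a); move: (ea a) (nn _ _) (nn _ _) => x y z; lra.
Qed.

Definition csys : sys R := Sys cmean_inv cmean_complete.

(** ** Functions built from blocks *)
Section Blocks.
Variables (L t : nat -> nat).
Hypotheses (L0 : forall j, (0 < L j)%N) (LN : forall j, (L j * L j <= (Nj j).+1)%N).
Hypothesis Loo : forall K, ultra [set j | (K <= L j)%N].

(** The ends of the blocks have density [1 / L j], which tends to zero. *)
Lemma block_aeq (f g : fn) : b1 f -> b1 g ->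
  (forall j (n : nat), ((n + (t j).+1) %% L j != 0)%N -> f (j, n%:Z) = g (j, n%:Z)) -> aeq cmean f g.
Proof.
move=> Hf Hg fg; rewrite /aeq nn_level; apply: LIM_cvg0; first by apply: bdd_levels; bfn.
move=> e e0; have [K HK] := inv_small 8 e0.
apply: filterS (Loo K.+1) => j /= KL; rewrite ger0_norm ?level_ge0 //.
set N := Nj j; have N0 : 0 < N.+1%:R :> R by [].
have LR : 0 < (L j)%:R :> R by rewrite ltr0n.
apply: (@le_trans _ _ (8 / (L j)%:R)); last first.
  by have := HK (L j).-1; rewrite prednK //; apply; rewrite -ltnS prednK.
rewrite /level avgE -/N ler_pdivrMr //.
apply: le_trans (_ : \sum_(n < N.+1) 4 * (if ((n + (t j).+1) %% L j == 0)%N then 1 else 0) <= _).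
  apply: ler_sum => n _; case: ifPn => [_|h]; last first.
    have -> : (f - g) (j, n%:Z) = f (j, n%:Z) - g (j, n%:Z) by [].
    by rewrite fg // subrr mul0r mulr0.
  rewrite mulr1; have h1 : `|(f - g) (j, n%:Z)| <= (2 : R)%:C%C.
    apply: le_trans (ler_normB _ _) _; have -> : (2 : R)%:C%C = 1 + 1 :> C by rewrite -[2]/(1 + 1) rmorphD.
    by apply: lerD; [apply: Hf|apply: Hg].
  by have := normsq_le h1; rewrite re_normsq -natrX.
rewrite -mulr_sumr; apply: le_trans (ler_wpM2l _ (count_multiples R (t j).+1 N.+1 (L0 j))) _ => //.
have -> : 8 / (L j)%:R * N.+1%:R = 4 * (2 * N.+1%:R / (L j)%:R) :> R by ring.
rewrite ler_pM2l // ler_pdivlMr // -!natrM ler_nat.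
have := LN j; rewrite -/N => LN'; have := leq_trunc_div N.+1 (L j); have := L0 j; nia.
Qed.

Definition blockwise (v : nat -> nat -> C) : fn := fun x => if x.2 is Posz n then v x.1 ((n + t x.1) %/ L x.1)%N else 1.

Lemma block_next j n : ((n + (t j).+1) %% L j != 0)%N ->
  ((n.+1 + t j) %/ L j = (n + t j) %/ L j)%N /\ ((n.+1 + t j) %% L j = ((n + t j) %% L j).+1)%N.
Proof.
rewrite addnS addSn => h; have l0 := L0 j.
have e := divn_eq (n + t j) (L j); have r := ltn_pmod (n + t j) l0.
set q := ((n + t j) %/ L j)%N in e *; set s := ((n + t j) %% L j)%N in e r *.
have sL : (s.+1 < L j)%N.
  rewrite ltn_neqAle r andbT; apply: contra h => /eqP sL.
  by rewrite e -addnS sL modnDr modnMl.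
by rewrite e -addnS divnMDl // modnMDl divn_small // modn_small // addn0.
Qed.

Lemma blockwise_ti v : (forall j b, `|v j b| <= 1) -> ti csys 1 (blockwise v).
Proof.
move=> v1; have b : b1 (blockwise v).
  by move=> [j [n|n]]; rewrite /blockwise /= ?v1 // normr1.
apply: block_aeq => [||j n h]; [exact: b1_sh|by []|].
by rewrite /sh /blockwise /= addn1; have [-> _] := block_next h.
Qed.

End Blocks.

Lemma avg_cor H (g : fn) : b1 g ->
  cmean (fun x => cor H.+1 (fun y => g (x.1, y)) x.2) = avg R H (fun h => nn cmean (avgF H (fun n => sh (1 * n)%N%:Z (D h%:Z g)))).
Proof.
move=> Hg; pose Z (h : nat) := avgF H (fun n => sh (1 * n)%N%:Z (D h%:Z g)).
have bZ h : b1 (Z h) by rewrite /Z; bfn.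
rewrite -(@mean_avg R _ cmean H (fun h x => re ((Z h * cj (Z h)) x))); last by move=> h; apply: bdd_re; bfn.
apply: eq_mean => -[j y]; cbn [fst snd]; rewrite /cor avgE re_sum [in LHS]mulrC exprSr invfM mulrA.
congr (_ / _); rewrite mulr_suml; apply: eq_bigr => h _.
rewrite -[(Z h * cj (Z h)) (j, y)]/(Z h (j, y) * (Z h (j, y))^*) -normCK.
have -> : Z h (j, y) = (H.+1%:R^-1)%:C%C * \sum_(n < H.+1) g (j, y + n%:Z) * (g (j, y + (n + h)%N%:Z))^*.
  rewrite /Z /avgF /cc /= fct_sumE; congr (_ * _); apply: eq_bigr => n _.
  by rewrite /sh /D /sh /cj /= mul1n PoszD addrA.
rewrite normrM exprMn.
have -> : `|(H.+1%:R^-1)%:C%C| = (H.+1%:R^-1)%:C%C :> C.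
  by rewrite ger0_norm // lecE /= eqxx invr_ge0 ler0n.
have -> : (H.+1%:R^-1)%:C%C ^+ 2 = (H.+1%:R^-1 ^+ 2)%:C%C :> C by rewrite rmorphXn.
by rewrite [RHS]re_cc mulrC exprVn.
Qed.

(** The seminorm [N 1 g] is at most a limit of averages of the local correlations [cor]
with windows of length [H]. For each interval [j] take the largest [H], among those
with a square at most the length of the interval, for which they are still large;
this [H] tends to infinity with [j]. Then [blocks] gives for each
block of length [H] a frequency, and the functions that rotate with this frequency
inside each block satisfy the equation of an eigenfunction up to the ends of the
blocks, where the eigenvalue is a function that is constant on the blocks. *)
Theorem csys_eigen : eigen_base csys.
Proof.
move=> d d0; exists (d / 8); first by rewrite divr_gt0.
move=> g Hg dN; have d20 : 0 < d / 2 by rewrite divr_gt0.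
pose A j H := avg R (Nj j) (fun x : nat => cor H.+1 (fun y => g (j, y)) x%:Z).
have bcor H : bdd (fun x : point => cor H.+1 (fun y => g (x.1, y)) x.2).
  exists 1 => -[j y] /=; rewrite ger0_norm; first by apply: cor_le1 => x; apply: Hg.
  rewrite /cor mulr_ge0 ?invr_ge0 ?exprn_ge0 // re_sum sumr_ge0 // => h _.
  by rewrite re_normsq re_sq_ge0.
have UH : ultra [set H | d / 2 < cmean (fun x => cor H.+1 (fun y => g (x.1, y)) x.2)].
  have b : bdd (fun h : nat => nu csys 1 (D h%:Z g)) by apply: bdd_nu => h; bfn.
  apply: filterS (LIM_near_gt (bdd_avgH b) (_ : d / 2 < _)); last first.
    by rewrite -cesE; apply: lt_le_trans dN; lra.
  move=> H /= h; rewrite avg_cor //; apply: lt_le_trans h _; apply: avg_le => h' _.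
  by apply: nu_avg; bfn.
have UA H : d / 2 < cmean (fun x => cor H.+1 (fun y => g (x.1, y)) x.2) -> ultra [set j | d / 2 < A j H].
  by rewrite cmeanE; apply: LIM_near_gt; apply: (bdd_level (bcor H)).
pose adm j H := (H.+1 * H.+1 <= (Nj j).+1)%N /\ d / 2 < A j H.
have top j : exists H, [/\ (H.+1 * H.+1 <= (Nj j).+1)%N, (exists2 H', (H' <= j)%N & adm j H') -> adm j H &
    forall H', (H' <= j)%N -> adm j H' -> (H' <= H)%N].
  have [[H0 H0j a0]|no] := pselect (exists2 H', (H' <= j)%N & adm j H'); last first.
    by exists 0%N; split=> // H' h a; case: no; exists H'.
  pose P (i : 'I_j.+1) := `[< adm j i >].
  have P0 : P (Ordinal (H0j : (H0 < j.+1)%N)) by apply/asboolP.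
  case: (@arg_maxnP _ _ P (fun i => nat_of_ord i) P0) => i /asboolP gi im.
  exists i; split=> [||a aj ga]; [by case: gi|by []|].
  apply: (im (Ordinal (aj : (a < j.+1)%N))); exact/asboolP.
have [Hj HjP] := choice top.
have Uadm K : ultra [set j | (K <= Hj j)%N /\ d / 2 < A j (Hj j)].
  have [H [HA KH]] : exists H, d / 2 < cmean (fun x => cor H.+1 (fun y => g (x.1, y)) x.2) /\ (K <= H)%N.
    by have [H [h1 h2]] := @filter_ex _ _ ultra_proper _ (filterI UH (ultra_ge K)); exists H.
  apply: filterS (filterI (UA H HA) (ultra_ge (H.+1 * H.+1)%N)) => j /= [h1 h2].
  have hj : (H <= j)%N by nia.
  have ha : adm j H by split=> //; have := Nj_ge j; lia.
  have [_ h3 h4] := HjP j; split; first by apply: leq_trans KH (h4 _ hj ha).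
  by case: h3 => //; exists H.
pose L j := (Hj j).+1.
have L0 j : (0 < L j)%N by [].
have LN j : (L j * L j <= (Nj j).+1)%N by case: (HjP j).
have Loo K : ultra [set j | (K <= L j)%N].
  by apply: filterS (Uadm K) => j [h _]; apply: leqW.
have [t tP] := choice (fun j => blocks (L0 j) (LN j) (fun x => Hg (j, x))).
have [w wP] := choice tP.
have [be beP] := choice wP.
pose lam := blockwise L t (fun j b => w j b).
pose beta := blockwise L t (fun j b => be j b).
pose chi0 : fn := fun x => if x.2 is Posz n then w x.1 ((n + t x.1) %/ L x.1)%N ^+ ((n + t x.1) %% L x.1) else 1.
have w1 j b : `|w j b| = 1 by case: (beP j).
have be1 j b : `|be j b| <= 1 by case: (beP j).
have ul : uni lam by move=> [j [n|n]]; rewrite /lam /blockwise /= ?w1 ?normr1.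
have uc : uni chi0 by move=> [j [n|n]]; rewrite /chi0 /= ?normrX ?w1 ?expr1n ?normr1.
have bb : b1 beta by move=> [j [n|n]]; rewrite /beta /blockwise /= ?be1 // normr1.
exists lam, chi0, beta; split; split=> //.
- by apply: blockwise_ti => // j b; rewrite w1.
- apply: (block_aeq L0 LN Loo (t := t)); [by apply: b1_sh; apply: uni_b1|by apply: b1M; apply: uni_b1|].
  move=> j n h; rewrite /sh /lam /blockwise /chi0 !fctE /= addn1; have [-> ->] := block_next L0 h.
  by rewrite exprS.
- exact: blockwise_ti.
have -> : ex csys (g * cj chi0 * cj beta) = cmean (fun x => re ((g * cj chi0 * cj beta) x)) by [].
rewrite cmeanE -(mean_cst (LIM R) (d / 8)); apply: LIM_le_near => //.
  by apply: (@bdd_level (fun x => re ((g * cj chi0 * cj beta) x))); apply: bdd_re; have := uni_b1 uc; bfn.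
have d8 : 0 < d / 8 by rewrite divr_gt0.
have [K HK] := inv_small 3 d8.
apply: filterS (Uadm K) => j /= [KH dA].
have [_ _ h] := beP j; apply: le_trans h.
have := HK _ KH; rewrite -/(L j) -/(A j (Hj j)) => h3; move: dA.
have -> : A j (Hj j) = avg R (Nj j) (fun x : nat => cor (L j) (fun x => g (j, x)) x%:Z) by [].
move: h3; move: (3 / _) (avg _ _ _) => x y; lra.
Qed.

End Sampling.

(** * Khintchine's bound *)

Lemma tangent (R : realFieldType) (x a : R) n : 0 <= x -> 0 <= a ->
  a ^+ n.+1 + n.+1%:R * a ^+ n * (x - a) <= x ^+ n.+1.
Proof.
move=> x0 a0; elim: n => [|n IH]; first by rewrite !expr1 mul1r expr0 mul1r addrCA subrr addr0.
have h := ler_wpM2l x0 IH; rewrite [leRHS]exprS; apply: le_trans h.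
have -> : a ^+ n.+2 + n.+2%:R * a ^+ n.+1 * (x - a) =
    x * (a ^+ n.+1 + n.+1%:R * a ^+ n * (x - a)) - n.+1%:R * a ^+ n * (x - a) ^+ 2.
  by rewrite !exprS -[n.+2%:R]natr1; ring.
by rewrite gerBl; apply: mulr_ge0; [apply: mulr_ge0 => //; apply: exprn_ge0|apply: sqr_ge0].
Qed.

Lemma mean_jensen (R : realType) (Y : Type) (m : mean R Y) (phi : Y -> R) n : bdd phi -> (forall y, 0 <= phi y) ->
  m phi ^+ n.+1 <= m (fun y => phi y ^+ n.+1).
Proof.
move=> bp p0; set a := m phi; have a0 : 0 <= a by apply: mean_ge0.
apply: le_trans (_ : m (fun y => a ^+ n.+1 + n.+1%:R * a ^+ n * (phi y - a)) <= _).
  rewrite meanD ?mean_cst //; last by auto.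
  by rewrite meanZ; auto; rewrite meanB ?mean_cst // subrr mulr0 addr0.
by apply: mean_le => [||y]; [auto|auto|apply: tangent].
Qed.

Section Khintchine.
Variables (R : realType) (mu : sys R).
Hypothesis EB : eigen_base mu.
Local Notation C := R[i].
Local Notation fn := (fn R).
Local Notation ex := (ex mu).
Local Notation nn := (nn mu).
Local Notation aeq := (aeq mu).
Local Notation ti := (ti mu).
Local Notation nu := (nu mu).

(** [nu] increases with the period along divisibility and is bounded by one. *)
Lemma near_sup f (kap : R) : b1 f -> 0 < kap -> exists2 W, (0 < W)%N & forall V, (0 < V)%N -> nu V f <= nu W f + kap.
Proof.
move=> Hf k0; pose S := [set nu V.+1 f | V in [set: nat]].
have hS : has_sup S.
  split; first by exists (nu 1 f), 0%N.
  by exists 1 => _ [V _ <-]; apply: nu_le1.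
have [_ [W _ <-] hW] := sup_adherent k0 hS.
exists W.+1 => // -[//|V] _; rewrite -lerBlDr; apply: le_trans (ltW hW); rewrite lerD2r.
by apply: ub_le_sup; [case: hS|exists V].
Qed.

(** The integral of [rho] against its own negative part is a mean of integrals of
nonnegative functions; so the negative part vanishes. *)
Lemma proj_nonneg (phi : point -> R) W rho : (forall x, 0 <= phi x <= 1) -> b1 rho -> ti W rho ->
  (forall M, invm M -> forall g, cb g -> M (fun n => ex (sh (W * n)%N%:Z (fun x => (phi x)%:C%C) * g)) = ex (rho * g)) ->
  exists2 psi : point -> R, forall x, 0 <= psi x <= 1 & aeq rho (fun x => (psi x)%:C%C).
Proof.
move=> p01 Hr tr rE; pose f : fn := fun x => (phi x)%:C%C.
have Hf : b1 f.
  by move=> x; have /andP[p0 p1] := p01 x; rewrite /f ger0_norm ?lecE /= ?eqxx.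
have cf : cj f = f by apply/funext => x; rewrite /cj /f; apply/eqP; rewrite eq_complex /= oppr0 !eqxx.
have iM := @ces_inv R.
have rr : aeq rho (cj rho).
  apply: ex_sep; bfn => g Hg; rewrite -[RHS]ex_cj cjM cjK -!(rE _ iM); bfn.
  apply: eq_mean => n; rewrite -[RHS]ex_cj cjM cjK; congr (ex (_ * _)).
  by rewrite cj_sh cf.
pose u x := re (rho x). pose v x := complex.Im (rho x).
have bu : bdd u by apply: bdd_re; bfn.
have rsq x : re (rho x * (rho x)^*) = u x ^+ 2 + v x ^+ 2 by apply: re_sq.
have b01 x : u x ^+ 2 + v x ^+ 2 <= 1 by rewrite -rsq -sq_le1.
have bv : bdd v.
  exists 1 => x; have := b01 x; have := sqr_ge0 (u x) => h1 h2.
  by rewrite -(@expr_le1 _ 2) // real_normK ?num_real //; lra.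
have u1 x : `|u x| <= 1 by apply: (@re_norm R _ 1); apply: Hr.
pose m x := Num.max 0 (- u x); pose psi x := Num.max 0 (u x).
have m01 x : 0 <= m x <= 1.
  by rewrite /m le_max lexx ge_max ler01 /= (le_trans (ler_norm _)) // normrN.
have psi01 x : 0 <= psi x <= 1.
  by rewrite /psi le_max lexx ge_max ler01 /= (le_trans (ler_norm _)).
have nneg1 (w : R) : 0 <= w <= 1 -> `|w%:C%C| <= 1 :> C.
  by move=> /andP[w0 w1]; rewrite ger0_norm ?lecE /= ?eqxx.
have bm : bdd m by exists 1 => x; have /andP[m0 m1] := m01 x; rewrite ger0_norm.
have Hm : b1 (fun x => (m x)%:C%C) by move=> x; apply: nneg1.
have Hpsi : b1 (fun x => (psi x)%:C%C) by move=> x; apply: nneg1.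
exists psi => //.
have v0 : mu (fun x => v x ^+ 2) = 0.
  have : nn (rho - cj rho) = 4 * mu (fun x => v x ^+ 2).
    rewrite -meanZ; last by auto.
    apply: eq_mean => x; rewrite -[(_ * _) x]/((rho x - (rho x)^*) * (rho x - (rho x)^*)^*) re_sq /v.
    by case: (rho x) => a b /=; ring.
  by rewrite rr => /esym/eqP; rewrite mulf_eq0 pnatr_eq0 /= => /eqP.
have m0 : mu (fun x => m x ^+ 2) = 0.
  have h1 : ex (rho * (fun x => (m x)%:C%C)) = - mu (fun x => m x ^+ 2).
    rewrite -meanN; last by auto.
    apply: eq_mean => x; rewrite -[(_ * _) x]/(rho x * (m x)%:C%C) mulrC re_cc -/(u x) /m.
    by case: (lerP 0 (- u x)) => h; ring.
  have h2 : 0 <= ex (rho * (fun x => (m x)%:C%C)).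
    rewrite -(rE _ iM); last by bfn.
    apply: mean_ge_cst => [|n]; first by apply: bdd_exM; bfn.
    apply: mean_ge0 => [|x]; first by apply: bdd_re; bfn.
    rewrite -[(_ * _) x]/(((phi (x.1, x.2 + (W * n)%N%:Z))%:C%C : C) * (m x)%:C%C) re_cc re_real.
    by apply: mulr_ge0; [have /andP[] := p01 (x.1, x.2 + (W * n)%N%:Z)|have /andP[] := m01 x].
  apply/eqP; rewrite eq_le mean_ge0; [|by auto|by move=> x; apply: sqr_ge0].
  by rewrite andbT -oppr_ge0 -h1.
rewrite /aeq; transitivity (mu (fun x => v x ^+ 2) + mu (fun x => m x ^+ 2)); last by rewrite v0 m0 addr0.
rewrite -meanD; auto; apply: eq_mean => x.
rewrite -[(_ * _) x]/((rho x - (psi x)%:C%C) * (rho x - (psi x)%:C%C)^*) re_sq /v /psi /m /u.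
case: (rho x) => a b /=; rewrite subr0 addrC; congr (_ + _).
case: (lerP 0 a) => h; case: (lerP 0 (- a)) => h'; rewrite ?subrr ?subr0 ?sqrrN //.
  by have -> : a = 0 by lra.
by move: h'; rewrite oppr_lt0 => /(lt_trans h); rewrite ltxx.
Qed.

Variables (k : nat) (p : 'I_k -> {poly R}).
Hypotheses (ip : forall i, ipoly (p i)) (pI : rindep p) (p0 : forall i, (p i).[0] = 0).

Lemma rindep_dilate (V : nat) : (0 < V)%N -> rindep (fun i => p i \Po (V%:R *: 'X)).
Proof.
move=> V0 c c0 a h; have V0' : V%:R != 0 :> R by rewrite pnatr_eq0 -lt0n.
apply: (pI c0 (a := a)).
have := congr1 (fun q : {poly R} => q \Po (V%:R^-1 *: 'X)) h; rewrite comp_polyC => <-.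
rewrite raddf_sum /=; apply: eq_bigr => i _.
rewrite comp_polyZ -comp_polyA comp_polyZ comp_polyX scalerA divff // scale1r comp_polyXr //.
Qed.

Lemma ipoly_dilate (V : nat) i : ipoly (p i \Po (V%:R *: 'X)).
Proof.
by move=> m; rewrite horner_comp !hornerE -[V%:R]/((V%:Z)%:~R) -intrM; apply: ip.
Qed.

Lemma ev_dilate (V n : nat) i : ev (p i \Po (V%:R *: 'X)) n = ev (p i) (V * n).
Proof. by rewrite /ev horner_comp !hornerE natrM. Qed.

(** Let [rho] be the projection of [f = phi] to the functions of period [W], for [W]
so large that larger periods bring almost nothing. Along the multiples of a
suitable [V], the values of the polynomials are divisible by [W], so that the
average with [rho] in all the slots is the integral of [f * rho ^ k], that is of
[rho ^ k.+1], which is at least the power of the integral of [rho]. To replace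
[f] by [rho] in a slot, pass through the projection [sig] to a much larger period
[U]: [f - sig] contributes little by [rational_factor], and [sig - rho] is small. *)
Theorem khintchine (phi : point -> R) (e : R) : (forall x, 0 <= phi x <= 1) -> 0 < e ->
  exists2 V, (0 < V)%N & forall M, invm M ->
  mu phi ^+ k.+1 - e <= M (fun n => ex ((fun x => (phi x)%:C%C) * \prod_i sh (ev (p i) (V * n)) (fun x => (phi x)%:C%C))).
Proof.
move=> p01 e0; pose f : fn := fun x => (phi x)%:C%C.
have Hf : b1 f.
  by move=> x; have /andP[a b] := p01 x; rewrite /f ger0_norm ?lecE /= ?eqxx.
have k0 : 0 < k.+1%:R :> R by [].
pose e1 := e / (3 * k.+1%:R); have e10 : 0 < e1 by rewrite divr_gt0 // mulr_gt0.
have [W W0 sW] := near_sup Hf (exprn_gt0 2 e10).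
have [Dj DjP] := choice (fun j => let: ex_intro2 D D0 HD := divis (ip j) in
  ex_intro (fun D => (0 < D)%N /\ forall W n b : nat, exists z : int, ev (p j) (D * W * n + b) - ev (p j) b = z * W%:Z) D (conj D0 HD)).
pose D := (\prod_j Dj j)%N; have D0 : (0 < D)%N by apply: prodn_gt0 => j; case: (DjP j).
pose V := (D * W)%N; have V0 : (0 < V)%N by rewrite muln_gt0 D0.
have evW j n : exists z, ev (p j) (V * n) = z * W%:Z.
  have [_ /(_ W ((D %/ Dj j) * n)%N 0%N)[z zE]] := DjP j; exists z.
  have dv : (Dj j %| D)%N by rewrite /D (bigD1 j) //= dvdn_mulr.
  have -> : (V * n = Dj j * W * ((D %/ Dj j) * n) + 0)%N.
    by rewrite /V -{1}(divnK dv) addn0; lia.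
  rewrite -zE [X in _ - X](_ : _ = 0) ?subr0 //.
  by apply: (intr_inj (R := R)); rewrite ev_inj // p0.
exists V => // M iM; pose q i := p i \Po (V%:R *: 'X).
have iq i : ipoly (q i) by apply: ipoly_dilate.
have qI : rindep q by apply: rindep_dilate.
have -> : M (fun n => ex (f * \prod_i sh (ev (p i) (V * n)) f)) = av mu q M f (fun=> f).
  by apply: eq_mean => n; congr (ex (_ * _)); apply: eq_bigr => i _; rewrite ev_dilate.
have rf i := rational_factor EB iq qI i e10.
have [Wi WiP] := choice (fun i => let: ex_intro2 W W0 HW := rf i in
  ex_intro (fun W => (0 < W)%N /\ exists2 eta : R, 0 < eta & forall M f0 F,
  invm M -> b1 f0 -> (forall j, b1 (F j)) -> e1 <= av mu q M f0 F -> eta <= nu W (F i)) W (conj W0 HW)).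
pose U := (W * \prod_i Wi i)%N.
have U0 : (0 < U)%N by rewrite muln_gt0 W0 prodn_gt0 // => i; case: (WiP i).
have [rho Hr [r1 tr r3 _]] := proj mu W Hf.
have [sig Hs [s1 ts s3 _]] := proj mu U Hf.
have WU : (W %| U)%N by apply: dvdn_mulr.
have close : nn (sig - rho) <= e1 ^+ 2.
  rewrite nnB; bfn.
  have -> : ex (sig * cj rho) = nn rho.
    rewrite (ex_proj Hf _ (ti_dvd WU _ (ti_cj tr)) s1); bfn.
    by rewrite -(ex_proj Hf _ (ti_cj tr) r1); bfn.
  have := sW U U0; rewrite -r3 -s3; move: (nn sig) (nn rho) (e1 ^+ 2) => x y z; lra.
pose g : fn := cc (2^-1) * (sig - f).
have Hg : b1 g.
  have -> : g = avgF 1 (fun i => if i is 0%N then sig else - f).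
    by rewrite /avgF !big_ord_recr big_ord0 /= add0r.
  by apply: b1_avgF => -[|_] //; bfn.
have nug i : nu (Wi i) g = 0.
  apply/eqP; rewrite eq_le nu_ge0 // andbT.
  have wu : (Wi i %| U)%N by rewrite /U (bigD1 i) //= mulnCA dvdn_mulr.
  apply: le_trans (nu_dvd mu wu Hg) _.
  have [Q HQ [q1 tQ q3 _]] := proj mu U Hg.
  rewrite -q3 !nnE (ex_proj Hg _ (ti_cj tQ) q1); bfn.
  rewrite /g -mulrA exZ; bfn; rewrite mulrBl exB; bfn.
  by rewrite (ex_proj Hf _ (ti_cj tQ) s1) ?subrr ?mulr0 //; bfn.
have step F m : (forall j, b1 (F j)) -> F m = f -> av mu q M f (upd F m rho) <= av mu q M f F + 3 * e1.
  move=> HF Fm; have bd n := b1_dual q m n Hf HF.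
  have h1 : av mu q M f (upd F m sig) - av mu q M f F <= 2 * e1.
    rewrite -{2}(upd_id F m) Fm av_upd2 // -/g ler_pM2l //.
    rewrite leNgt; apply/negP => h; have [_ [eta eta0 HE]] := WiP m.
    have bg j : b1 (upd F m g j) by rewrite /upd; case: ifP.
    by have := HE M f (upd F m g) iM Hf bg (ltW h); rewrite updE nug leNgt eta0.
  have h2 : av mu q M f (upd F m rho) - av mu q M f (upd F m sig) <= e1.
    rewrite -!av_dual // -meanB; try by exists 1 => n; apply: ex_b1; bfn.
    apply: mean_le_cst => [|n]; first by apply: bddB; exists 1 => n; apply: ex_b1; bfn.
    rewrite -exB -?mulrBr; bfn.
    have := CS1 mu (bd n) (_ : cb (rho - sig)); rewrite -opprB nnN => h.
    have {h} h := le_trans (h _) close.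
    have {}h : ex (dual q f F m n * - (sig - rho)) ^+ 2 <= e1 ^+ 2 by apply: h; bfn.
    by rewrite (le_trans (ler_norm _)) // -(@ler_pXn2r _ 2) ?nnegrE // ?real_normK ?num_real // ltW.
  by move: h1 h2; move: (av _ _ _ _ _) (av _ _ _ _ _) (av _ _ _ _ _) => x y z; lra.
have hybrid (s : seq 'I_k) : uniq s -> av mu q M f (fun j => if j \in s then rho else f) <= av mu q M f (fun=> f) + (size s)%:R * (3 * e1).
  elim: s => [|m s IH] /=; first by rewrite mul0r addr0.
  move=> /andP[ms us]; have := step (fun j => if j \in s then rho else f) m.
  rewrite (negbTE ms) (_ : upd _ _ _ = fun j => if j \in m :: s then rho else f); last first.
    by apply/funext => j; rewrite /upd inE; case: eqP.
  move=> /(_ _ erefl) h; apply: le_trans (h _) _; first by move=> j; case: ifP.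
  have -> : (size s).+1%:R = (size s)%:R + 1 :> R by rewrite natr1.
  by have := IH us; move: (av _ _ _ _ _) (av _ _ _ _ _) (size s)%:R => x y z h'; lra.
have h1 := hybrid (index_enum 'I_k) (index_enum_uniq _).
have sE : size (index_enum 'I_k) = k by rewrite -[RHS]card_ord cardT enumT.
have h2 : av mu q M f (fun j => if j \in index_enum 'I_k then rho else f) = ex (rho ^+ k.+1).
  rewrite -(mean_cst M (ex _)); apply: eq_mean => n.
  transitivity (ex (f * rho ^+ k)).
    rewrite mulrC [in RHS]mulrC; apply: aeq_ex; bfn.
      by apply/b1_cb/b1_prod => j _; case: ifP => _; bfn.
    have -> : rho ^+ k = \prod_(j < k) rho by rewrite prodr_const card_ord.
    under eq_bigr do rewrite mem_index_enum ev_dilate.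
    elim: (index_enum _) => [|j s IH]; first by rewrite !big_nil; bfn.
    rewrite !big_cons; apply: aeqMM; bfn; try by apply: b1_prod => j' _; bfn.
    by have [z ->] := evW j n; apply: ti_mulz.
  have tX (l : nat) : ti W (rho ^+ l).
    by elim: l => [|l IH]; [exact: ti1|rewrite exprS; apply: tiM; bfn].
  by rewrite -(ex_proj Hf _ (tX k) r1) ?exprS //; bfn.
have [psi psi01 rpsi] := proj_nonneg p01 Hr tr r1.
have Hpsi : b1 (fun x => (psi x)%:C%C).
  by move=> x; have /andP[a b] := psi01 x; rewrite ger0_norm ?lecE /= ?eqxx.
have bpsi : bdd psi by exists 1 => x; have /andP[a b] := psi01 x; rewrite ger0_norm.
have h3 (l : nat) : ex (rho ^+ l) = mu (fun x => psi x ^+ l).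
  have aX : aeq (rho ^+ l) ((fun x => (psi x)%:C%C) ^+ l).
    by elim: l => [|l IH]; [rewrite !expr0; bfn|rewrite !exprS; apply: aeqMM; bfn].
  rewrite (aeq_ex1 _ _ aX); bfn; apply: eq_mean => x.
  have -> : ((fun x => (psi x)%:C%C) ^+ l : fn) x = (psi x ^+ l)%:C%C.
    elim: l {aX} => [|l IH]; first by rewrite !expr0.
    transitivity ((psi x)%:C%C * (psi x ^+ l)%:C%C : C); last by rewrite exprS rmorphM.
    by rewrite exprS -IH.
  exact: re_real.
have mE : mu phi = mu psi.
  have -> : mu psi = ex (rho ^+ 1) by rewrite h3; apply: eq_mean => x; rewrite expr1.
  rewrite expr1 -[rho]mulr1 (ex_proj Hf _ (ti1 mu W) r1) ?mulr1 //; bfn.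
have J := @mean_jensen R _ mu psi k bpsi (fun x => (andP (psi01 x)).1).
move: h1; rewrite h2 h3 sE mE => h1.
have h4 : k%:R * (3 * e1) <= e.
  have eE : e = 3 * k.+1%:R * e1.
    by rewrite /e1 mulrCA divff ?mulr1 // gt_eqF // mulr_gt0.
  have e31 : 0 < 3 * e1 by rewrite mulr_gt0.
  have -> : e = k.+1%:R * (3 * e1) by rewrite [LHS]eE mulrAC [LHS]mulrC.
  by rewrite (ler_pM2r e31) ler_nat.
by move: J h1 h4; move: (mu (fun x => psi x ^+ k.+1)) (mu psi ^+ k.+1) (av _ _ _ _ _) (k%:R * _) => x y z t; lra.
Qed.

End Khintchine.

(** * Densities *)

Section Density.
Variable R : realType.
Implicit Types A : set int.

Lemma counting_sum A N : counting_fun A N = (\sum_(x < N) `[< A x.+1%:Z >])%N.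
Proof.
rewrite /counting_fun; elim: N => [|N IH].
  rewrite big_ord0 (_ : _ `&` _ = set0) ?fset_set0 //.
  by rewrite -subset0 => x [_]; rewrite /= in_itv /=; lia.
rewrite big_ord_recr /= -IH; set X := A `&` _ in IH *.
have fX : finite_set X by apply: finite_counting_set.
have [AN|AN] := asboolP (A N.+1%:Z).
  have -> : A `&` [set` `[1%:Z, N.+1%:Z]] = N.+1%:Z |` X.
    apply/seteqP; split=> x /=; rewrite /X /= !in_itv /=.
      by move=> [Ax xN]; have [->|xn] := eqVneq x N.+1%:Z; [left|right; split=> //; lia].
    by move=> [->|[Ax xN]]; split=> //; lia.
  have nX : (N.+1%:Z \in X) = false.
    by apply/negbTE/negP; rewrite inE /X /= in_itv /= => -[_]; lia.
  by rewrite fset_setU1 // cardfsU1 in_fset_set // nX addnC.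
rewrite addn0; congr #|` fset_set _|.
apply/seteqP; split=> x; rewrite /X /= !in_itv /= => -[Ax xN]; split=> //; last by lia.
by have [xE|xn] := eqVneq x N.+1%:Z; [case: AN; rewrite -xE|lia].
Qed.

Local Notation u A := (fun N : nat => (counting_fun A N)%:R / N%:R : R).

Lemma density_01 A N : 0 <= u A N <= 1.
Proof.
rewrite divr_ge0 ?ler0n //=; case: N => [|N]; first by rewrite invr0 mulr0 ler01.
rewrite ler_pdivrMr ?ltr0n // mul1r ler_nat counting_sum.
apply: leq_trans (_ : \sum_(x < N.+1) 1 <= _)%N; last by rewrite sum1_card card_ord.
by apply: leq_sum => x _; case: `[< _ >].
Qed.

Lemma density_bounded A : bounded_fun (u A).
Proof.
exists 1; split=> // x x1 N _ /=; have /andP[a b] := density_01 A N.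
by rewrite ger0_norm // (le_trans b) // ltW.
Qed.

Lemma has_ub_sdrop A n : has_ubound (sdrop (u A) n).
Proof. by exists 1 => _ [N _ <-]; have /andP[] := density_01 A N. Qed.

Lemma upper_density_le A (e : R) : 0 < e -> exists n, forall N, (n <= N)%N -> u A N <= upper_density R A + e.
Proof.
move=> e0; rewrite /upper_density limn_supE; last exact: density_bounded.
have hi : has_inf (range (sups (u A))).
  split; first by exists (sups (u A) 0%N), 0%N.
  by apply: bounded_fun_has_lbound_sups; apply: density_bounded.
have [_ [n _ <-] hn] := inf_adherent e0 hi.
exists n => N nN; apply: le_trans (ltW hn); apply: ub_le_sup; first exact: has_ub_sdrop.
by exists N.
Qed.

Lemma upper_density_frequently A (e : R) n : 0 < e -> exists2 N, (n <= N)%N & upper_density R A - e < u A N.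
Proof.
move=> e0; rewrite /upper_density limn_supE; last exact: density_bounded.
have h : inf (range (sups (u A))) <= sups (u A) n.
  by apply: ge_inf; [apply: bounded_fun_has_lbound_sups; apply: density_bounded|exists n].
have [||_ [N nN <-] hN] := @sup_gt R (sdrop (u A) n) (sups (u A) n - e).
- by exists (u A n), n => /=.
- by rewrite -[X in _ < X]/(sups (u A) n) ltrBlDr ltrDl.
by exists N => //; apply: le_lt_trans hN; rewrite lerD2r.
Qed.

Lemma upper_density_ge0 A : 0 <= upper_density R A.
Proof.
apply/ler_addgt0Pr => e e0; have [n /(_ n (leqnn n)) h] := upper_density_le A e0.
by apply: le_trans h; have /andP[] := density_01 A n.
Qed.

(** Positions count from zero, elements of [A] from one. *)
Definition ind A : point -> R := fun x => if `[< A (x.2 + 1) >] then 1 else 0.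

Lemma ind_01 A x : 0 <= ind A x <= 1.
Proof. by rewrite /ind; case: ifP => _; rewrite ?lexx ?ler01. Qed.

Lemma avg_ind A N j : avg R N (fun x => ind A (j, x%:Z)) = u A N.+1.
Proof.
rewrite avgE counting_sum natr_sum; congr (_ / _); apply: eq_bigr => x _.
by rewrite /ind /= -PoszD addn1; case: `[< _ >].
Qed.

Lemma translateP A m y : translate A m y <-> A (y - m).
Proof.
split=> [[x Ax <-]|h]; first by rewrite addrK.
by exists (y - m) => //; rewrite subrK.
Qed.

Lemma ind_prod A k (m : 'I_k -> int) (x : point) :
  ((fun x => (ind A x)%:C%C) * \prod_i sh (- m i) (fun x => (ind A x)%:C%C) : fn R) x =
  (ind (A `&` \bigcap_(i in [set: 'I_k]) translate A (m i)) x)%:C%C.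
Proof.
pose f : fn R := fun x => (ind A x)%:C%C.
have pE (s : seq 'I_k) : (\prod_(i <- s) sh (- m i) f) x = \prod_(i <- s) f (x.1, x.2 - m i).
  elim: s => [|i s IH]; first by rewrite !big_nil.
  by rewrite !big_cons -IH.
rewrite -[LHS]/(f x * (\prod_i sh (- m i) f) x) pE.
have fE y : f y = if `[< A (y.2 + 1) >] then 1 else 0 by rewrite /f /ind; case: ifP.
rewrite /ind; case: asboolP => [[Ax Am]|no].
  rewrite fE asboolT // mul1r big1 // => i _; rewrite fE /= asboolT //.
  by rewrite addrAC; apply/translateP; apply: Am.
have [Ax|nAx] := pselect (A (x.2 + 1)); last by rewrite fE asboolF // mul0r.
have [i ni] : exists i, ~ A (x.2 + 1 - m i).
  apply: contrapT => h; apply: no; split=> // i _; apply/translateP.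
  by apply: contrapT => ni; apply: h; exists i.
by rewrite (bigD1 i) //= [f (_, _)]fE /= asboolF ?mul0r ?mulr0 // addrAC.
Qed.

End Density.

(** The shift changes the average over a window only at its two ends. *)
Lemma window_inv (R : realType) (m : nat -> nat) : invm (bindm (LIM R) (fun J => avg R J) (fun J n => (m J + n)%N)).
Proof.
move=> a [K aK]; rewrite !bindE; apply: (@LIM_near0 _ _ _ (K + K)).
- by exists K => J; apply: mean_norm.
- by exists K => J; apply: mean_norm.
move=> J; pose b n := a (m J + n)%N.
have -> : (fun n => a (m J + n).+1) = (fun n => b n.+1) by apply/funext => n; rewrite /b addnS.
rewrite avg_shift1 normrM normfV normr_nat ler_pM2r ?invr_gt0 ?ltr0n //.
by apply: le_trans (ler_normB _ _) _; apply: lerD; apply: aK.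
Qed.

Theorem theorem2p1 (R : realType) (k : nat) (L : set int)
    (p : 'I_k -> {poly R}) (e : R)
    (L_pos : L `<=` posints)
    (p_int : forall i, integer_poly (p i))
    (p_indep : rationally_independent p)
    (p_0 : forall i, (p i).[0] = 0)
    (e_pos : 0 < e) :
  syndetic [set n : int | posints n /\
    upper_density R L ^+ k.+1 - e <=
    upper_density R
      (L `&` \bigcap_(i in [set: 'I_k]) translate L (int_horner (p i) n))].
Proof.
apply: contrapT => ns; set S := [set n | _] in ns.
set dl := upper_density R L in S ns.
have gap M : posints M -> exists a b : int, [/\ posints a, M < b - a & forall n, a <= n <= b -> ~ S n].
  move=> M0; apply: contrapT => no; apply: ns; exists M => // a b a0 ab.
  apply: contrapT => h; apply: no; exists a, b; split=> // n nab Sn; apply: h; exists n.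
  by split=> //=; rewrite in_itv.
have e20 : 0 < e / 2 by rewrite divr_gt0.
(* intervals along which [L] has its upper density *)
have along j : exists N : nat, (j <= N)%N /\ dl - j.+1%:R^-1 < (counting_fun L N.+1)%:R / N.+1%:R.
  have j0 : 0 < j.+1%:R^-1 :> R by rewrite invr_gt0 ltr0n.
  by have [[//|N] jN hN] := upper_density_frequently L j.+1 j0; exists N.
have [Nm NmP] := choice along.
have Nge j : (j <= Nm j)%N by case: (NmP j).
pose mu := csys R Nge.
have muE A : mu (ind R A) = LIM R (fun j => (counting_fun A (Nm j).+1)%:R / (Nm j).+1%:R).
  rewrite [LHS]cmeanE; apply: eq_mean => j; exact: avg_ind.
have bu A : bdd (fun j => (counting_fun A (Nm j).+1)%:R / (Nm j).+1%:R : R).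
  by exists 1 => j; have /andP[a b] := density_01 R A (Nm j).+1; rewrite ger0_norm.
have mu_ge : dl <= mu (ind R L).
  rewrite muE; apply: le_trans (_ : LIM R (fun j => dl - 1 / j.+1%:R) <= _).
    rewrite meanB ?mean_cst ?LIM_inv ?subr0 //.
    by exists 1 => j; rewrite mul1r ger0_norm ?invr_ge0 ?ler0n // invf_le1 ?ltr0n // ler1n.
  apply: mean_le => // [|j]; last by have [_ /ltW] := NmP j; rewrite mul1r.
  by apply: bddB => //; exists 1 => j; rewrite mul1r ger0_norm ?invr_ge0 ?ler0n // invf_le1 ?ltr0n // ler1n.
have mu_le A : mu (ind R A) <= upper_density R A.
  rewrite muE; apply/ler_addgt0Pr => eps eps0; have [n hn] := upper_density_le A eps0.
  rewrite -[leRHS](mean_cst (LIM R)); apply: LIM_le_near => //.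
  apply: filterS (ultra_ge n) => j /= nj; apply: hn.
  by apply: leqW; apply: leq_trans nj _.
pose P i := - p i.
have iP i : ipoly (P i) by apply: ipolyN; apply: p_int.
have PI : rindep P.
  move=> c [i ci] a h; apply: (p_indep (fun i => - c i) (ex_intro _ i _) a); first by rewrite oppr_eq0.
  by rewrite -h; apply: eq_bigr => j _; rewrite /P scalerN intrN scaleNr.
have P0 i : (P i).[0] = 0 by rewrite hornerN p_0 oppr0.
have [V V0 HV] := khintchine (csys_eigen Nge) iP PI P0 (ind_01 R L) e20.
(* the multiples of [V] in long gaps of [S] *)
have windows J : exists m : nat, (0 < m)%N /\ forall n, (n <= J)%N -> ~ S (V * (m + n))%N%:Z.
  have [|a [b [a0 ab Sab]]] := gap (V * J.+2)%N%:Z; first by rewrite /posints /= ltz_nat muln_gt0 V0.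
  case: a a0 ab Sab => // a a0 ab Sab; exists (a %/ V).+1; split=> // n nJ; apply: Sab.
  have h1 := ltn_ceil a V0; have h2 := leq_trunc_div a V.
  move: ab; move: (a %/ V)%N h1 h2 => q h1 h2 ab; apply/andP; split; first by nia.
  have : (V * (q.+1 + n) <= a + V * J.+2)%N by nia.
  by move: (V * (q.+1 + n))%N (V * J.+2)%N ab => x y; lia.
have [m mP] := choice windows.
pose M := bindm (LIM R) (fun J => avg R J) (fun J n => (m J + n)%N).
have := HV M (@window_inv R m); apply/negP; rewrite -ltNge.
apply: (@le_lt_trans _ _ (dl ^+ k.+1 - e)); last first.
  apply: (@lt_le_trans _ _ (dl ^+ k.+1 - e / 2)).
    by rewrite ltrD2l ltrN2 gtr_pMr ?invf_lt1 ?ltr1n ?ltr0n.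
  by rewrite lerD2r lerXn2r ?nnegrE ?(le_trans _ mu_ge) // upper_density_ge0.
rewrite /M bindE; apply: mean_le_cst => [|J].
  exists 1 => J; apply: mean_norm => n; apply: ex_b1.
  have Hf : b1 (fun x => (ind R L x)%:C%C).
    by move=> x; have /andP[a b] := ind_01 R L x; rewrite ger0_norm ?lecE /= ?eqxx.
  by apply: b1M => //; apply: b1_prod => i _; apply: b1_sh.
apply: avg_le_cst => n nJ; set N := (V * (m J + n))%N.
have -> : ex mu ((fun x => (ind R L x)%:C%C) * \prod_i sh (ev (P i) N) (fun x => (ind R L x)%:C%C)) =
  mu (ind R (L `&` \bigcap_(i in [set: 'I_k]) translate L (int_horner (p i) N%:Z))).
  have -> : \prod_i sh (ev (P i) N) (fun x => (ind R L x)%:C%C) = \prod_i sh (- int_horner (p i) N%:Z) (fun x => (ind R L x)%:C%C) :> fn R.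
    by apply: eq_bigr => i _; rewrite /P evN //; apply: p_int.
  by apply: eq_mean => x; rewrite ind_prod.
apply: le_trans (mu_le _) _; have [m0 nS] := mP J; have {}nS := nS n nJ.
rewrite leNgt; apply/negP => h; apply: nS; split; last exact: ltW.
by rewrite /posints /= ltz_nat muln_gt0 V0 addn_gt0 m0.
Qed.
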